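(* Let $A$, $W_1$, $W_2$, $\overline W$, the observation $M_\varepsilon$ and the posterior distribution $\Pi(\cdot\,|\,M_\varepsilon)$ be as described in the context. Let $f^\dagger\in\overline W$ be fixed and let $P^M_{f^\dagger}$ be the law of $M_\varepsilon=Af^\dagger+\varepsilon\mathbb W$. Let $\Pi$ be a centred Gaussian Borel probability measure on $\overline W$, with RKHS $V_\Pi$, that satisfies the concentration condition (stated in the context) for $f^\dagger$. Let $\psi\in W_1$ be such that $|\langle\psi,\varphi\rangle_{W_1}|\le C\|\varphi\|_{\overline W}$ for all $\varphi\in W_1$ (for some constant $C>0$) and $\psi=-A^*A\widetilde\psi$ for some $\widetilde\psi\in V_\Pi$. Let $\bar f=\mathbb E^\Pi[f\,|\,M_\varepsilon]$ be the posterior mean, let $\alpha\in(0,1)$, and let $$C_\varepsilon=\{x\in\mathbb R:|\langle\bar f,\psi\rangle_{W_1}-x|\le R_\varepsilon\},$$ with $R_\varepsilon=R_\varepsilon(\alpha,M_\varepsilon)$ chosen so that $\Pi(f:\langle f,\psi\rangle_{W_1}\in C_\varepsilon\,|\,M_\varepsilon)=1-\alpha$. Then, as $\varepsilon\to0$, $$P^M_{f^\dagger}\big(\langle f^\dagger,\psi\rangle_{W_1}\in C_\varepsilon\big)\to1-\alpha$$ and $$\varepsilon^{-1}R_\varepsilon\to\Phi^{-1}(1-\alpha)\quad\text{in }P^M_{f^\dagger}\text{-probability},$$ where $\Phi(t)=\Pr(|Z|\le t)$, $t\ge0$, and $Z\sim\mathcal N(0,\|A\widetilde\psi\|^2_{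W_2})$.
   Context: Setting. $W_1,W_2$ are separable Hilbert spaces of real-valued functions, and $A:W_1\to W_2$ is linear, bounded and injective, with adjoint $A^*:W_2\to W_1$, $\langle Af,g\rangle_{W_2}=\langle f,A^*g\rangle_{W_1}$. $\overline W$ is a separable Hilbert space with $W_1\subset\overline W$ dense in the norm of $\overline W$, such that $A:\overline W\to W_2$ is (defined and) continuous; in particular there is $c>0$ with $\|Af\|_{W_2}\le c\|f\|_{\overline W}$ for all $f\in\overline W$. Noise and observation. $\mathbb W=(\mathbb W(\varphi):\varphi\in W_2)$ is a centred Gaussian white noise process with $\mathbb E(\mathbb W(\varphi)\mathbb W(\varphi'))=\langle\varphi,\varphi'\rangle_{W_2}$. For $\varepsilon>0$ the observation is $M_\varepsilon=Af+\varepsilon\mathbb W$, i.e. the Gaussian process $(\langle M_\varepsilon,\varphi\rangle_{W_2}=\langle Af,\varphi\rangle_{W_2}+\varepsilon\mathbb W(\varphi):\varphi\in W_2)$; its law is $P^M_f$. Posterior. For a prior $\Pi$ on $\overline W$, with $p_f(M_\varepsilon)=\exp\{\varepsilon^{-2}\langle M_\varepsilon,Af\rangle_{W_2}-\tfrac12\varepsilon^{-2}\|Af\|_{W_2}^2\}$ the density of $P_f^M$ with respect to $P_0^M$, the posterior is $\Pi(B\,|\,M_\varepsilon)=\int_B p_f(M_\varepsilon)\,d\Pi(f)\big/\int_{\overline W}p_f(M_\varepsilon)\,d\Pi(f)$ for Borel $B\subseteq\overline W$. Concentration condition for $\Pi$ and $f^\dagger$. Define, for $\delta>0$, $$\phi_{\Pi,f^\dagger}(\delta)=\inf_{g\in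 V_\Pi,\ \|g-f^\dagger\|_{\overline W}\le\delta}\frac{\|g\|_{V_\Pi}^2}{2}-\log\Pi(f:\|f\|_{\overline W}\le\delta).$$ The condition is: there exists a sequence $\delta_\varepsilon\to0$ with $\delta_\varepsilon/\varepsilon\to\infty$ as $\varepsilon\to0$ such that $\phi_{\Pi,f^\dagger}(\delta_\varepsilon/(2c))\le(\delta_\varepsilon/\varepsilon)^2$. Conventions. For $\psi$ as in the claim, the functional $\langle\cdot,\psi\rangle_{W_1}$ is extended continuously from $W_1$ to $\overline W$, and $\langle f,\psi\rangle_{W_1}$ for $f\in\overline W$ denotes this extension. *)

(* Defs.v *)
From HB Require Import structures.
From mathcomp Require Import all_boot all_order all_algebra.
From mathcomp Require Import all_classical all_reals all_analysis.

Set Implicit Arguments.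
Unset Strict Implicit.
Unset Printing Implicit Defensive.

Import Order.TTheory GRing.Theory Num.Theory.
Import numFieldNormedType.Exports.

Local Open Scope classical_set_scope.
Local Open Scope ring_scope.

HB.mixin Record CompleteNormedModule_isHilbert (R : realType) V
    & CompleteNormedModule R V := {
  inner : {dot V for idfun};
  inner_norm : forall x : V, inner x x = `|x| ^+ 2
}.

#[short(type="hilbertType")]
HB.structure Definition Hilbert (R : realType) :=
  {V of CompleteNormedModule R V & CompleteNormedModule_isHilbert R V}.

Definition separable (T : topologicalType) :=
  exists2 S : set T, countable S & dense S.

Notation borel T := (g_sigma_algebraType (@open T)).

(* The centred normal law with standard deviation [s].  The case [s = 0] is
   separated because [normal_prob m 0] is the uniform law on [0, 1]. *)
Definition centered_normal (R : realType) (s : R) (B : set R) : \bar R :=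
  if s == 0 then \d_(0 : R) B else normal_prob 0 s B.

Definition is_centered_normal (R : realType) (mu : set R -> \bar R) :=
  exists s : R, forall B : set R, measurable B -> mu B = centered_normal s B.

(* [Phi s t] is Pr(|Z| <= t) for Z ~ N(0, s ^ 2). *)
Definition Phi (R : realType) (s t : R) : R :=
  fine (centered_normal s `[- t, t]).

Definition Phi_inv (R : realType) (s u : R) : R :=
  xget 0 [set t | 0 <= t /\ Phi s t = u].

Definition white_noise (R : realType) (V : hilbertType R) (d : measure_display)
    (Omega : measurableType d) (P : probability Omega R)
    (W : V -> {RV P >-> R}) :=
  (forall (n : nat) (phi : 'I_n -> V) (a : 'I_n -> R),
     is_centered_normal
       (fun B => P ((fun w => \sum_(i < n) a i * W (phi i) w) @^-1` B))) /\
  (forall phi phi' : V,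
     ('E_P[fun w => (W phi w * W phi' w)%R] = (inner phi phi')%:E)%E).

(* The variables of a process indexed by [V] are only determined almost surely,
   for each index separately.  Integrating a path of the process over the index
   requires a jointly measurable modification; two such modifications have,
   almost surely, paths that agree almost everywhere for any given sigma-finite
   measure on [V]. *)
Definition measurable_modification (R : realType) (V : hilbertType R)
    (d : measure_display) (Omega : measurableType d) (P : probability Omega R)
    (W : V -> {RV P >-> R}) (N : V -> Omega -> R) :=
  measurable_fun [set: borel V * Omega] (fun z => N z.1 z.2) /\
  (forall phi : V, {ae P, forall w, N phi w = W phi w}).

Section gaussian_prior.
Context (R : realType) (V : hilbertType R).
Implicit Types (Pi : probability (borel V) R).

Definition centered_gaussian Pi :=
  forall x : V, is_centered_normal (fun B => Pi ((fun f : V => inner f x) @^-1` B)).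

(* The RKHS of [Pi] consists of the vectors h = E[xi(f) f], f ~ Pi, where xi
   ranges over the closure in L^2(Pi) of the continuous linear functionals, and
   has the norm |h| = |xi|_{L^2(Pi)}.  The expectation is in the weak sense.
   As the set of all such xi for a given h is an equivalence class modulo
   Pi-almost everywhere equality, the norm does not depend on the choice. *)
Definition rkhs_repr Pi (h : V) : set (V -> R) :=
  [set xi | [/\ (xi : borel V -> R) \in Lfun Pi 2%:E,
     forall e : R, 0 < e -> exists x : V,
       ('N[Pi]_(2%:E) [(fun f => (xi f - inner f x)%:E)] < e%:E)%E &
     forall x : V, (\int[Pi]_f (xi f * inner f x)%:E = (inner h x)%:E)%E]].

Definition rkhs Pi : set V := [set h | rkhs_repr Pi h !=set0].

Definition rkhs_norm Pi (h : V) : R :=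
  let xi : V -> R := xget (fun=> 0) (rkhs_repr Pi h) in
  fine 'N[Pi]_(2%:E)[(fun f => (xi f)%:E)]%E.

(* Valued in the extended reals: it is +oo if no element of the RKHS is within
   distance [delta] of [f0]. *)
Definition concentration Pi (f0 : V) (delta : R) : \bar R :=
  (ereal_inf [set (rkhs_norm Pi g ^+ 2 / 2)%:E
              | g in [set g | rkhs Pi g /\ (`|g - f0| <= delta)%R]]
   - lne (Pi [set f : V | (`|f| <= delta)%R]))%E.

Definition concentration_condition Pi (f0 : V) (c : R) :=
  exists delta : R -> R,
    [/\ delta e @[e --> 0^'+] --> 0,
        delta e / e @[e --> 0^'+] --> +oo &
        \forall e \near 0^'+,
          (concentration Pi f0 (delta e / (2 * c)) <= ((delta e / e) ^+ 2)%:E)%E].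

(* The mean of [mu], as a weak integral; the integrability condition is that of
   the Bochner integral. *)
Definition is_mean (mu : set (borel V) -> \bar R) (m : V) :=
  mu.-integrable [set: borel V] (fun f : V => `|f|%:E) /\
  (forall x : V, (\int[mu]_f (inner f x)%:E = (inner m x)%:E)%E).

Definition mean (mu : set (borel V) -> \bar R) : V := xget 0 [set m | is_mean mu m].

End gaussian_prior.

Section posterior.
Context (R : realType) (V V2 : hilbertType R) (A : V -> V2).

(* A path of the observation is a function [M : V2 -> R], with [M phi] in the
   role of <M, phi>. *)
Definition observation (N : V2 -> R) (e : R) (f : V) (phi : V2) : R :=
  inner (A f) phi + e * N phi.

Definition likelihood (e : R) (M : V2 -> R) (f : V) : R :=
  expR (e ^- 2 * M (A f) - 2^-1 * e ^- 2 * `|A f| ^+ 2).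

Definition posterior (Pi : probability (borel V) R) (e : R) (M : V2 -> R)
    (B : set (borel V)) : \bar R :=
  (\int[Pi]_(f in B) (likelihood e M f)%:E /
   \int[Pi]_f (likelihood e M f)%:E)%E.

End posterior.

(* The continuous extension of [g : U -> R] along a map [iota : U -> V] with
   dense range; it is unique if it exists. *)
Definition extension (R : realType) (U : Type) (V : topologicalType)
    (iota : U -> V) (g : U -> R) : V -> R :=
  xget (fun=> 0) [set G : V -> R | continuous G /\ G \o iota = g].

Definition cvg_in_probability (R : realType) (d : measure_display)
    (Omega : measurableType d) (P : probability Omega R)
    (F : set_system R) (X : R -> Omega -> R) (x : R) :=
  forall eta : R, 0 < eta ->
    P [set w | eta < `|X e w - x|] @[e --> F] --> 0%E.

(* Main.v *)
(* Write v = A psit, so that the functional extends to L f = - <A f, v>, and let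
   B(x, y) be the prior covariance of <A f, x> and <A f, y>.  Let q solve
   B(q, .) + e^2 <q, .> = - e^2 <v, .> and let k represent cov(A* q, .).  The
   Cameron-Martin formula for the shifts by t k computes the Laplace transform of
   L under the posterior: almost surely L is normal with mean
   L f0 - <A f0, q> + N(A k) / e and variance s^2 = B(q, q) + e^2 |v + q|^2.  Hence
   the radius is exactly s / |v| times the quantile, and the coverage is that of a
   normal variable with bias - <A f0, q> and standard deviation e |v + q|.  As psit
   lies in the RKHS, B(q, q) = O(e^4) and |q| = O(e), so both standard deviations
   are equivalent to e |v|.  The concentration condition splits f0 into an element
   of the RKHS with norm O(delta / e) and a remainder of size O(delta), which makes
   the bias O(e delta). *)
Require Import Defs.
From HB Require Import structures.
From mathcomp Require Import all_boot all_order all_algebra.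
From mathcomp Require Import all_classical all_reals all_analysis.
From mathcomp Require Import measurable_realfun ring lra.
Import Order.TTheory GRing.Theory Num.Theory.
Import numFieldNormedType.Exports.
Set Implicit Arguments.
Unset Strict Implicit.
Unset Printing Implicit Defensive.
Local Open Scope classical_set_scope.
Local Open Scope ring_scope.

(** * Measures determined by Laplace transforms *)

(** All laws are identified through real Laplace transforms. The linearity of a noise path holds
    only off a null set that depends on its arguments, so the Laplace identity for the posterior is
    available, almost surely, only for countably many t at once. The uniqueness theorem is therefore
    stated for a family of exponents closed under sums, negation and division by positive integers,
    such as the rational multiples of one function. Applied to the functionals <., z>, the same
    theorem gives Cameron-Martin. The prior is given by its one-dimensional marginals only. The
    second moment of its norm has to be derived before a covariance operator exists; together with
    exponential moments of linear functionals it also makes the likelihood integrable against 1 +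
    |f|. The equation for q is the one for which the linear tilts produced by the shift add up to -
    t <A f, v> exactly. Its term e^2 <q, .> makes it coercive, so that it is solvable by Lax-Milgram
    at each fixed e. The case A psit = 0 is contradictory: the functional is then 0, and no credible
    set has posterior mass 1 - alpha. *)

Lemma cvg_expR_diffquo (R : realType) (h : nat -> R) (x : R) :
  (forall n, 0 < h n) -> h n @[n --> \oo] --> 0 ->
  (expR (x * h n) - 1) / h n @[n --> \oo] --> x.
Proof.
move=> h_gt0 h0.
have h1 : x * expR (x * h n) @[n --> \oo] --> x.
  rewrite -[X in _ --> X]mulr1; apply: cvgM; first exact: cvg_cst.
  rewrite -[X in _ --> X](@expR0 R) -[X in expR X](mulr0 x).
  apply: (cvg_comp (fun n => x * h n) expR); last exact: continuous_expR.
  by apply: cvgM => //; exact: cvg_cst.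
(* The inequality 1 + y <= e^y, taken at y = x h and at y = - x h, puts the quotient between x and x
   e^(x h), whatever the sign of x. *)
apply: (@squeeze_cvgr _ _ _ _ (fun=> x) (fun n => x * expR (x * h n))) => //.
  near=> n; have xE : x = x * h n / h n by rewrite mulfK ?gt_eqF.
  have hV : 0 <= (h n)^-1 by rewrite invr_ge0 ltW.
  apply/andP; split.
    by rewrite {1}xE ler_wpM2r// lerBrDl expR_ge1Dx.
  rewrite {2}xE mulrAC ler_wpM2r//.
  have := expR_ge1Dx (- (x * h n)); rewrite expRN.
  set k := x * _ => ke; have e0 := expR_gt0 k.
  have : (1 - k) * expR k <= 1 by rewrite -ler_pdivlMr// div1r.
  lra.
exact: cvg_cst.
Unshelve. all: by end_near. Qed.

Lemma normr_expR_subr1 (R : realType) (h : R) : `|expR h - 1| <= `|h| * expR `|h|.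
Proof.
have a := expR_ge1Dx h; have b := expR_ge1Dx (- h).
have [h0|h0] := leP 0 h.
  rewrite ger0_norm; last lra.
  rewrite expRN in b; have e0 := expR_gt0 h.
  have : (1 - h) * expR h <= 1 by rewrite -ler_pdivlMr// div1r.
  by rewrite ger0_norm//; lra.
rewrite ler0_norm; last by rewrite subr_le0 expR_le1 ltW.
have := expR_ge1Dx (- h); rewrite (ler0_norm (ltW h0)) => c.
by have d : 0 < - h by [lra]; have := expR_gt0 h; nra.
Qed.

(** The bound is uniform in n, so that F times a partial sum of the sine series of X is dominated by
    |F| e^|X|. *)
Lemma series_sin_coeff_le (R : realType) (x : R) n :
  `|series (sin_coeff x) n| <= expR `|x|.
Proof.
rewrite /series/=; apply: (le_trans (ler_norm_sum _ _ _)).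
apply: (@le_trans _ _ (series (exp_coeff `|x|) n)).
  apply: ler_sum => k _; rewrite /sin_coeff /exp_coeff/=.
  rewrite !normrM normrX normrV ?unitfE ?pnatr_eq0 -?lt0n ?fact_gt0//.
  rewrite (ger0_norm (ler0n _ k`!)) -normrX ler_wpM2r ?invr_ge0//.
  rewrite normrX normrN1 expr1n mulr1 normrX ler_piMl ?exprn_ge0//.
  by rewrite normr_nat lern1 leq_b1.
apply: nondecreasing_cvgn_le; last exact: is_cvg_series_exp_coeff.
by apply/nondecreasing_seqP => k; rewrite seriesSr lerDl exp_coeff_ge0.
Qed.

Lemma Bernoulli_inequality (R : realDomainType) (y : R) n :
  -1 <= y -> 1 + y *+ n <= (1 + y) ^+ n.
Proof.
move=> y1; elim: n => [|n ih]; first by rewrite mulr0n addr0 expr0.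
rewrite exprS; apply: (@le_trans _ _ ((1 + y) * (1 + y *+ n))).
  rewrite mulrDl mul1r mulrDr mulr1 mulrSr -!addrA lerD2l addrA lerDl.
  by rewrite mulrnAr mulrn_wge0// -expr2 sqr_ge0.
by rewrite ler_wpM2l// addrC -lerBlDr sub0r.
Qed.

Lemma cvg_mulnX (R : realType) (y : R) : 0 <= y < 1 ->
  n%:R * y ^+ n @[n --> \oo] --> 0.
Proof.
(* In n y^n = (n z^n) z^n, Bernoulli at 1 / z - 1 keeps n z^n below 1 / (1 - z), and the other
   factor z^n tends to 0. *)
move=> /andP[y0 y1]; set z := Num.sqrt y.
have z0 : 0 <= z by exact: sqrtr_ge0.
have yE : y = z * z by rewrite -expr2 sqr_sqrtr.
have z1 : z < 1 by rewrite -(sqrtr1) ltr_sqrt.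
apply: (@squeeze_cvgr _ _ _ _ (fun=> 0) (fun n => (1 - z)^-1 * z ^+ n)).
- near=> n; rewrite mulr_ge0 ?exprn_ge0//=.
  rewrite yE exprMn mulrA ler_wpM2r ?exprn_ge0//.
  rewrite -div1r ler_pdivlMr ?subr_gt0//.
  have [->|zn0] := eqVneq z 0.
    by rewrite expr0n subr0 mulr1; case: (n) => [|k]; rewrite ?mul0r ?mulr0 ?ler01.
  have zp : 0 < z by rewrite lt_neqAle eq_sym zn0.
  have /(@Bernoulli_inequality _ _ n) : -1 <= z^-1 - 1.
    by have : 0 < z^-1 by [rewrite invr_gt0]; lra.
  rewrite (addrC 1 (z^-1 - 1)) subrK exprVn -[leRHS]div1r ler_pdivlMr ?exprn_gt0// => h.
  apply: le_trans h; rewrite mulrDl mul1r -mulr_natr.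
  have zz : z^-1 * z = 1 by rewrite mulVf.
  set c := n%:R; set d := z ^+ n.
  have dd : 0 <= d by rewrite exprn_ge0.
  have c0 : 0 <= c by rewrite ler0n.
  have : 1 - z <= z^-1 - 1.
    rewrite lerBrDr -(ler_pM2r zp) zz; have := sqr_ge0 (z - 1); lra.
  move=> h; have := ler_wpM2l (mulr_ge0 c0 dd) h; lra.
- exact: cvg_cst.
- rewrite -[X in _ --> X](mulr0 (1 - z)^-1); apply: cvgM; first exact: cvg_cst.
  by apply: cvg_expr; rewrite ger0_norm.
Unshelve. all: by end_near. Qed.

(* A sequence of polynomials in [s] converging boundedly on [-1, 1] to the
   indicator of the positive reals. *)
Lemma cvg_poly_gt0 (R : realType) (s : R) : -1 <= s <= 1 ->
  (1 - ((1 - s) / 2) ^+ n) ^+ (n * 2 ^ n) @[n --> \oo] --> ((0 < s)%R%:R : R).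
Proof.
move=> s1; set x := (1 - s) / 2.
have x01 : 0 <= x <= 1 by rewrite /x; lra.
have xn n : 0 <= x ^+ n <= 1 by rewrite exprn_ge0 ?exprn_ile1//; lra.
(* The exponent n 2^n makes n (2 x)^n decisive: it tends to 0 when 2 x < 1, that is 0 < s, and is at
   least n otherwise. *)
case: ltP => s0.
  apply: (@squeeze_cvgr _ _ _ _ (fun n => 1 - n%:R * (2 * x) ^+ n) (fun=> 1)).
  - near=> n; have /andP[a b] := xn n; apply/andP; split; last first.
      by apply: exprn_ile1; lra.
    apply: (@le_trans _ _ (1 + (- x ^+ n) *+ (n * 2 ^ n))).
      by rewrite exprMn -[in leRHS]mulr_natr natrM natrX; lra.
    by apply: Bernoulli_inequality; lra.
  - rewrite -[X in _ --> X]subr0; apply: cvgB; first exact: cvg_cst.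
    by apply: cvg_mulnX; rewrite /x; lra.
  - exact: cvg_cst.
apply: (@squeeze_cvgr _ _ _ _ (fun=> 0) (fun n => expR (- n%:R))).
- near=> n; have /andP[a b] := xn n; apply/andP; split.
    by rewrite exprn_ge0//; lra.
  apply: (@le_trans _ _ (expR (- x ^+ n) ^+ (n * 2 ^ n))).
    by rewrite lerXn2r ?nnegrE ?expR_ge0//; [lra|exact: expR_ge1Dx].
  rewrite -expRM_natr ler_expR mulNr lerN2 natrM natrX mulrCA -exprMn.
  by rewrite ler_peMr// exprn_ege1// /x; lra.
- exact: cvg_cst.
- exact: cvgn_expR.
Unshelve. all: by end_near. Qed.

Section laplace_uniqueness.
Context d (T : measurableType d) (R : realType).
Variables mu nu : {measure set T -> \bar R}.
Variable Y : set (T -> R).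
Hypothesis Y_meas : forall X, Y X -> measurable_fun setT X.
Hypothesis Y0 : Y (cst 0).
Hypothesis YD : forall X X', Y X -> Y X' -> Y (X \+ X').
Hypothesis YN : forall X, Y X -> Y (\- X).
Hypothesis Yn : forall X (n : nat), Y X -> Y (fun t => X t / n.+1%:R).
Hypothesis Y_int : forall X, Y X ->
  [/\ mu.-integrable setT (fun t => (expR (X t))%:E),
      nu.-integrable setT (fun t => (expR (X t))%:E) &
      (\int[mu]_t (expR (X t))%:E = \int[nu]_t (expR (X t))%:E)%E].

(** The class of dominating functions. Quantifying over all X makes it stable under multiplication
    by e^|X| ([dom_expabs]), which controls both difference quotients and power series in X. *)
Let dom (F : T -> R) := forall X, Y X ->
  mu.-integrable setT (fun t => (F t * expR (X t))%:E) /\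
  nu.-integrable setT (fun t => (F t * expR (X t))%:E).

Let test (F : T -> R) := measurable_fun setT F /\ forall X, Y X ->
  [/\ mu.-integrable setT (fun t => (F t * expR (X t))%:E),
      nu.-integrable setT (fun t => (F t * expR (X t))%:E) &
      (\int[mu]_t (F t * expR (X t))%:E = \int[nu]_t (F t * expR (X t))%:E)%E].

Let mexp (F X : T -> R) : measurable_fun setT F -> Y X ->
  measurable_fun setT (fun t => (F t * expR (X t))%:E).
Proof.
move=> mF YX; apply/measurable_EFinP/measurable_funM => //.
by apply: measurableT_comp => //; exact: Y_meas.
Qed.

Let test_dom F : test F -> dom F.
Proof. by move=> [mF tF] X YX; have [] := tF _ YX. Qed.

Let dom_norm F : dom F -> dom (fun t => `|F t|).
Proof.
move=> dF X YX; have [a b] := dF _ YX; split.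
  by move/integrable_norm : a; apply: eq_integrable => // t _ /=;
    rewrite normrM (ger0_norm (expR_ge0 _)).
by move/integrable_norm : b; apply: eq_integrable => // t _ /=;
  rewrite normrM (ger0_norm (expR_ge0 _)).
Qed.

Let domZ a F : dom F -> dom (fun t => a * F t).
Proof.
move=> dF X YX; have [iF jF] := dF _ YX; split.
  by have := integrableZl measurableT a iF; apply: eq_integrable => // t _ /=;
    rewrite -EFinM mulrA.
by have := integrableZl measurableT a jF; apply: eq_integrable => // t _ /=;
  rewrite -EFinM mulrA.
Qed.

Let domD F G : dom F -> dom G -> dom (F \+ G).
Proof.
move=> dF dG X YX; have [iF jF] := dF _ YX; have [iG jG] := dG _ YX; split.
  by have := integrableD measurableT iF iG; apply: eq_integrable => // t _ /=;
    rewrite -EFinD mulrDl.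
by have := integrableD measurableT jF jG; apply: eq_integrable => // t _ /=;
  rewrite -EFinD mulrDl.
Qed.

Let dom_exp F X : Y X -> dom F -> dom (fun t => F t * expR (X t)).
Proof.
move=> YX dF Z YZ; have [a b] := dF _ (YD YX YZ); split.
  by apply: eq_integrable a => // t _ /=; rewrite expRD mulrA.
by apply: eq_integrable b => // t _ /=; rewrite expRD mulrA.
Qed.

Let dom_le (F G : T -> R) : dom G -> measurable_fun setT F ->
  (forall t, `|F t| <= `|G t|) -> dom F.
Proof.
move=> dG mF FG X YX; have [a b] := dG _ YX; split.
  apply: le_integrable a => //; first exact: mexp.
  by move=> t _ /=; rewrite lee_fin !normrM ler_wpM2r.
apply: le_integrable b => //; first exact: mexp.
by move=> t _ /=; rewrite lee_fin !normrM ler_wpM2r.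
Qed.

Let dom_expabs F X : Y X -> measurable_fun setT F -> dom F ->
  dom (fun t => `|F t| * expR `|X t|).
Proof.
move=> YX mF dF.
have d' : dom (fun t => `|F t| * expR (X t) + `|F t| * expR (- X t)).
  by apply: domD; apply: dom_exp => //; [exact: dom_norm|exact: YN|exact: dom_norm].
apply: (dom_le d').
  apply: measurable_funM; first exact: measurableT_comp.
  by do 2 apply: measurableT_comp => //; exact: Y_meas.
move=> t; apply: le_trans (ler_norm _); rewrite ger0_norm ?mulr_ge0 ?expR_ge0//.
rewrite -mulrDr ler_wpM2l//; have := expR_ge0 (X t); have := expR_ge0 (- X t).
by case: (ger0P (X t)) => _; lra.
Qed.

Let test_cvg (F_ : nat -> T -> R) (F G : T -> R) : (forall n, test (F_ n)) ->
  (forall t, F_ n t @[n --> \oo] --> F t) -> dom G ->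
  (forall n t, `|F_ n t| <= G t) -> test F.
Proof.
move=> tF FF dG FG.
have mF : measurable_fun setT F.
  apply: (@measurable_fun_cvg _ _ _ _ F_ F) => [n|t _]; last exact: FF.
  by have [] := tF n.
split => // X YX; have [iG jG] := dG _ YX.
have mFn n : measurable_fun setT (fun t => (F_ n t * expR (X t))%:E).
  by apply: mexp => //; have [] := tF n.
have cv t : (fun n => (F_ n t * expR (X t))%:E) @ \oo --> (F t * expR (X t))%:E.
  by apply: cvg_EFin; [exact: nearW|apply: cvgM; [exact: FF|exact: cvg_cst]].
have le n t : (`|(F_ n t * expR (X t))%:E| <= (G t * expR (X t))%:E)%E.
  by rewrite lee_fin normrM (ger0_norm (expR_ge0 _)) ler_wpM2r ?expR_ge0.
have [iF _ cF] := @dominated_convergence _ _ _ mu _ measurableT _ _ _ mFn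
  (mexp mF YX) (aeW _ (fun t _ => cv t)) iG (aeW _ (fun t n _ => le n t)).
have [jF _ cF'] := @dominated_convergence _ _ _ nu _ measurableT _ _ _ mFn
  (mexp mF YX) (aeW _ (fun t _ => cv t)) jG (aeW _ (fun t n _ => le n t)).
split => //; move/cvg_lim : cF => <-//; move/cvg_lim : cF' => <-//.
congr (limn _); apply/funext => n /=; have [_ tFn] := tF n.
by have [_ _ /= ->] := tFn _ YX.
Qed.

Let testZ a F : test F -> test (fun t => a * F t).
Proof.
move=> tF; have [mF dF] := tF; split; first exact: measurable_funM.
move=> X YX; have [i j] := domZ a (test_dom tF) YX; split => //.
have [iF jF e] := dF _ YX.
under eq_integral do rewrite -mulrA EFinM.
by rewrite integralZl// e -integralZl//; apply: eq_integral => t _; rewrite -EFinM mulrA.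
Qed.

Let testD F G : test F -> test G -> test (F \+ G).
Proof.
move=> tF tG; have [mF dF] := tF; have [mG dG] := tG; split.
  exact: measurable_funD.
move=> X YX; have [i j] := domD (test_dom tF) (test_dom tG) YX; split => //.
have [iF jF e] := dF _ YX; have [iG jG e'] := dG _ YX.
under eq_integral do rewrite /= mulrDl EFinD.
rewrite integralD// e e' -integralD//; apply: eq_integral => t _ /=.
by rewrite -EFinD mulrDl.
Qed.

Let test_exp F X : Y X -> test F -> test (fun t => F t * expR (X t)).
Proof.
move=> YX [mF tF]; split.
  apply: measurable_funM => //.
  by apply: measurableT_comp => //; exact: Y_meas.
move=> Z YZ; have [i j e] := tF _ (YD YX YZ); split.
- by apply: eq_integrable i => // t _ /=; rewrite expRD mulrA.
- by apply: eq_integrable j => // t _ /=; rewrite expRD mulrA.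
- under eq_integral do rewrite -mulrA -expRD.
  by rewrite e; apply: eq_integral => t _; rewrite expRD mulrA.
Qed.

Let eq_test F G : F =1 G -> test F -> test G.
Proof. by move=> /funext ->. Qed.

Let testM F X : Y X -> test F -> test (fun t => F t * X t).
Proof.
move=> YX tF; have [mF _] := tF.
pose F_ n t := n.+1%:R * (F t * expR (X t / n.+1%:R) + -1 * F t).
(* Two factors e^|X| in the dominating function: one bounds |X|, the other bounds e^(|X| / (n +
   1)). *)
apply: (@test_cvg F_ _ (fun t => `| `|F t| * expR `|X t| | * expR `|X t|)).
- move=> n; apply: testZ; apply: testD; last exact: testZ.
  by apply: test_exp => //; exact: Yn.
- move=> t; rewrite /F_; have := @cvg_expR_diffquo R harmonic (X t) (@harmonic_gt0 _)
    (@cvg_harmonic R).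
  move=> /(cvgM (cvg_cst (F t))); apply: cvg_trans; apply: near_eq_cvg.
  by near=> n; rewrite /= invrK; ring.
- apply: dom_expabs => //; last by apply: dom_expabs => //; exact: test_dom.
  apply: measurable_funM; first exact: measurableT_comp.
  by do 2 apply: measurableT_comp => //; exact: Y_meas.
- move=> n t; have n0 : (0 : R) < n.+1%:R by rewrite ltr0n.
  rewrite (ger0_norm (mulr_ge0 _ (expR_ge0 _)))// /F_.
  have -> : n.+1%:R * (F t * expR (X t / n.+1%:R) + -1 * F t) =
    F t * (n.+1%:R * (expR (X t / n.+1%:R) - 1)) by ring.
  rewrite normrM -mulrA ler_wpM2l// normrM (gtr0_norm n0).
  apply: (@le_trans _ _ (n.+1%:R * (`|X t / n.+1%:R| * expR `|X t / n.+1%:R|))).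
    by rewrite ler_wpM2l ?(ltW n0)// normr_expR_subr1.
  rewrite normrM (gtr0_norm (_ : 0 < n.+1%:R^-1)) ?invr_gt0//.
  rewrite mulrA mulrCA divff ?gt_eqF// mulr1 ler_pM ?expR_ge0//.
    by have := expR_ge1Dx `|X t|; lra.
  by rewrite ler_expR ler_piMr// invf_le1// ler1n.
Unshelve. all: by end_near. Qed.

(** Multipliers, unlike test functions, are closed under products: polynomials in a multiplier stay
    in the class, and so do indicators of intersections, which gives the pi-system of the final
    argument. *)
Let mult (M : T -> R) := forall F, test F -> test (fun t => F t * M t).

Let mult_cst a : mult (cst a).
Proof. by move=> F tF; apply: eq_test (testZ a tF) => t; rewrite mulrC. Qed.

Let multM M N : mult M -> mult N -> mult (fun t => M t * N t).
Proof.
by move=> mM mN F tF; apply: eq_test (mN _ (mM _ tF)) => t; rewrite mulrA.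
Qed.

Let multD M N : mult M -> mult N -> mult (fun t => M t + N t).
Proof.
move=> mM mN F tF.
by apply: eq_test (testD (mM _ tF) (mN _ tF)) => t /=; rewrite mulrDr.
Qed.

Let multX M n : mult M -> mult (fun t => M t ^+ n).
Proof.
move=> mM; elim: n => [|n ih]; first exact: (mult_cst 1).
by under eq_fun do rewrite exprS; exact: multM.
Qed.

Let mult_sum (M : nat -> T -> R) n : (forall k, mult (M k)) ->
  mult (fun t => \sum_(0 <= k < n) M k t).
Proof.
move=> mM; elim: n => [|n ih].
  by under eq_fun do rewrite big_nil; exact: (mult_cst 0).
by under eq_fun do rewrite big_nat_recr//=; exact: multD.
Qed.

Let mult_cvg (M_ : nat -> T -> R) M : (forall n, mult (M_ n)) ->
  (forall t, M_ n t @[n --> \oo] --> M t) ->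
  (forall n t, `|M_ n t| <= 1) -> mult M.
Proof.
move=> mM MM M1 F tF.
apply: (@test_cvg (fun n t => F t * M_ n t) _ (fun t => `|F t|)).
- by move=> n; exact: mM.
- by move=> t; apply: cvgM => //; exact: cvg_cst.
- exact/dom_norm/test_dom.
- by move=> n t; rewrite normrM ler_piMr.
Qed.

Let mult_sin X n b : Y X -> mult (fun t => sin ((X t - b) / n.+1%:R)).
Proof.
move=> YX F tF; have [mF _] := tF.
(* Partial sums of the sine series may exceed 1, so [mult_cvg] does not apply here; the exponential
   bound [series_sin_coeff_le] provides the domination. *)
apply: (@test_cvg (fun m t => F t * series (sin_coeff ((X t - b) / n.+1%:R)) m)
  _ (fun t => expR `|b| * (`|F t| * expR `|X t|))).
- move=> m; rewrite /series/=.
  suff : mult (fun t => \sum_(0 <= k < m) sin_coeff ((X t - b) / n.+1%:R) k) by exact.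
  apply: mult_sum => k; rewrite /sin_coeff/=; apply: multM; last exact: mult_cst.
  apply: multM; first exact: mult_cst.
  apply: multX; apply: multM; last exact: mult_cst.
  apply: multD; last exact: mult_cst.
  by move=> G tG; exact: testM.
- move=> t; apply: cvgM; first exact: cvg_cst.
  by rewrite sin.unlock; exact: is_cvg_series_sin_coeff.
- by apply: domZ; apply: dom_expabs => //; exact: test_dom.
- move=> m t; rewrite normrM mulrCA ler_wpM2l//.
  apply: (le_trans (series_sin_coeff_le _ _)).
  rewrite -expRD ler_expR normrM normfV (ger0_norm (ler0n _ n.+1)).
  apply: (@le_trans _ _ `|X t - b|); last by rewrite (addrC `|b|) ler_normB.
  by rewrite ler_piMr// invf_le1// ?ltr0n ?ler1n.
Qed.

Let mult_sin_gt0 X n b : Y X ->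
  mult (fun t => (0 < sin ((X t - b) / n.+1%:R))%R%:R).
Proof.
move=> YX; pose s t := sin ((X t - b) / n.+1%:R).
apply: (@mult_cvg (fun k t => (1 - ((1 - s t) / 2) ^+ k) ^+ (k * 2 ^ k))).
- move=> k; apply: multX; apply: multD; first exact: mult_cst.
  rewrite (_ : (fun t => _) = (fun t => -1 * ((1 + -1 * s t) * 2^-1) ^+ k)); last first.
    by apply/funext => t; rewrite !mulN1r.
  apply: multM; first exact: mult_cst.
  apply: multX; apply: multM; last exact: mult_cst.
  apply: multD; first exact: mult_cst.
  by apply: multM; [exact: mult_cst|exact: mult_sin].
- by move=> t; apply: cvg_poly_gt0; rewrite sin_geN1 sin_le1.
- move=> k t; have s1 : -1 <= s t <= 1 by rewrite sin_geN1 sin_le1.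
  have x01 : 0 <= (1 - s t) / 2 <= 1 by lra.
  have /andP[a b'] : 0 <= ((1 - s t) / 2) ^+ k <= 1.
    by rewrite exprn_ge0 ?exprn_ile1//; lra.
  by rewrite ger0_norm ?exprn_ge0 ?exprn_ile1//; lra.
Qed.

Let mult_gt X b : Y X -> mult (fun t => (b < X t)%R%:R).
Proof.
move=> YX; apply: (@mult_cvg (fun n t => (0 < sin ((X t - b) / n.+1%:R))%R%:R)).
- by move=> n; exact: mult_sin_gt0.
- move=> t; apply: cvg_near_cst; near=> n; congr (_%:R); congr nat_of_bool.
  set x := X t - b.
  have n0 : (0 : R) < n.+1%:R by rewrite ltr0n.
  have xn : `|x| / n.+1%:R < pi.
    rewrite ltr_pdivrMr//; apply: (@lt_le_trans _ _ (pi * n%:R)).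
      rewrite mulrC -ltr_pdivrMr ?pi_gt0//; near: n.
      exact: nbhs_infty_gtr.
    by rewrite ler_wpM2l ?pi_ge0// ler_nat.
  have xn' : `|x / n.+1%:R| < pi by rewrite normrM normfV (gtr0_norm n0).
  rewrite -[b < X t]subr_gt0 -/x; case: (ltgtP 0 x) => x0.
  + rewrite sin_gt0_pi// divr_gt0//=.
    by apply: le_lt_trans xn'; exact: ler_norm.
  + have : 0 < sin (- x / n.+1%:R).
      apply: sin_gt0_pi; rewrite divr_gt0 ?oppr_gt0//=.
      by apply: le_lt_trans xn'; rewrite mulNr -normrN ler_norm.
    by rewrite mulNr sinN oppr_gt0 => h; rewrite ltNge (ltW h).
  + by rewrite -x0 mul0r sin0 ltxx.
- by move=> n t; case: (_ < _); rewrite ?normr1 ?normr0.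
Unshelve. all: by end_near. Qed.

Let test1 : test (cst 1).
Proof.
split; first exact: measurable_cst.
move=> X YX; have [i j e] := Y_int YX; split.
- by apply: eq_integrable i => // t _ /=; rewrite mul1r.
- by apply: eq_integrable j => // t _ /=; rewrite mul1r.
- by under eq_integral do rewrite mul1r;
    rewrite e; apply: eq_integral => t _; rewrite mul1r.
Qed.

(* Since n (e^(X / n) - 1) tends to X, the functions F such that F e^X has the
   same integral under [mu] and [nu] for all X in [Y] are stable under
   multiplication by elements of [Y], hence by their sines and by polynomials in
   these.  Bounded limits give the indicators of {b < X}, because b < X iff
   0 < sin ((X - b) / m) for all large m. *)
Theorem laplace_measure_unique :
  measurable `<=` <<s [set A | exists X b, Y X /\ A = [set t | b < X t]] >> ->
  forall A, measurable A -> mu A = nu A.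
Proof.
move=> gen.
pose G := [set A | measurable A /\ mult (\1_A : T -> R)].
have Gm A : measurable A -> mult (\1_A : T -> R) -> mu A = nu A.
  move=> mA /(_ _ test1)[_ /(_ _ Y0)[_ _]].
  rewrite (eq_integral (fun t => (\1_A t)%:E)); last first.
    by move=> t _; rewrite /cst expR0 mulr1 mul1r.
  rewrite [in RHS](eq_integral (fun t => (\1_A t)%:E)); last first.
    by move=> t _; rewrite /cst expR0 mulr1 mul1r.
  by rewrite !integral_indic// !setIT.
have GT : G setT.
  by split => //; rewrite indicT; exact: (mult_cst 1).
apply: (@measure_unique _ _ _ G (fun=> setT)).
- apply/seteqP; split.
    apply: (subset_trans gen); apply: sub_smallest2r => //.
    move=> _ [X [b [YX ->]]]; split.
      have := Y_meas YX; move=> /(_ measurableT `]b, +oo[%classic).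
      rewrite setTI => /(_ (measurable_itv _)); congr measurable.
      by apply/seteqP; split => t /=; rewrite in_itv/= andbT.
    have := mult_gt b YX; congr mult.
    by apply/funext => t; rewrite indicE; congr (_%:R); congr nat_of_bool;
      apply/idP/idP; rewrite inE.
  by apply: smallest_sub => //; [exact: sigma_algebra_measurable|move=> A []].
- move=> A B [mA tA] [mB tB]; split; first exact: measurableI.
  by rewrite indicI; exact: multM.
- by [].
- by rewrite bigcup_const//; exists 0%N.
- by move=> A [mA tA]; exact: Gm.
- move=> _; have [i _ _] := Y_int Y0.
  have := integrable_lty measurableT i.
  rewrite (eq_integral (cst 1%E)); last by move=> t _ /=; rewrite expR0.
  by rewrite integral_cst// mul1e.
Qed.

End laplace_uniqueness.

(** * Hilbert spaces *)

Lemma form_cauchy_schwarz (R : realType) (U : lmodType R) (b : U -> U -> R) (p q : U) :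
  (forall x y z, b (x + y) z = b x z + b y z) ->
  (forall (a : R) x y, b (a *: x) y = a * b x y) ->
  (forall x y, b x y = b y x) -> (forall x, 0 <= b x x) ->
  b p q ^+ 2 <= b p p * b q q.
Proof.
move=> bD bZ bC b0.
have h t : 0 <= b p p + t * (2 * b p q) + t ^+ 2 * b q q.
  have := b0 (p + t *: q); rewrite bD (bC p) (bC (t *: q)) !bD !bZ (bC q p).
  by rewrite !(bC _ (t *: q)) !bZ (bC q p); congr (0 <= _); ring.
have [q0|q0] := eqVneq (b q q) 0.
  rewrite q0 mulr0; have [->|pq] := eqVneq (b p q) 0; first by rewrite expr0n.
  (* For b q q = 0 the quadratic is affine in t, and this t gives it the value -1. *)
  have := h (- (b p p + 1) / (2 * b p q)); rewrite q0 mulr0 addr0 divfK.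
    lra.
  by rewrite mulf_neq0.
have qp : 0 < b q q by rewrite lt_neqAle eq_sym q0 b0.
have := h (- b p q / b q q); rewrite -(ler_pM2r qp) mul0r => {}h.
rewrite -subr_ge0; apply: le_trans h _; rewrite le_eqVlt; apply/orP; left.
by apply/eqP; field.
Qed.

Section inner_product.
Context (R : realType) (V : hilbertType R).
Implicit Types x y z : V.

Lemma innerC x y : inner x y = inner y x.
Proof. by have := hermC (@inner R V) x y; rewrite expr0 mul1r. Qed.

Lemma innerDl x y z : inner (x + y) z = inner x z + inner y z.
Proof. by rewrite linearDl. Qed.

Lemma innerDr x y z : inner x (y + z) = inner x y + inner x z.
Proof. by rewrite linearDr. Qed.

Lemma innerZl (a : R) x y : inner (a *: x) y = a * inner x y.
Proof. by rewrite linearZl_LR. Qed.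

Lemma innerZr (a : R) x y : inner x (a *: y) = a * inner x y.
Proof. by rewrite innerC innerZl innerC. Qed.

Lemma innerNl x y : inner (- x) y = - inner x y.
Proof. by rewrite linearNl. Qed.

Lemma innerNr x y : inner x (- y) = - inner x y.
Proof. by rewrite innerC innerNl innerC. Qed.

Lemma innerBl x y z : inner (x - y) z = inner x z - inner y z.
Proof. by rewrite innerDl innerNl. Qed.

Lemma innerBr x y z : inner x (y - z) = inner x y - inner x z.
Proof. by rewrite innerDr innerNr. Qed.

Lemma inner0l x : inner 0 x = 0.
Proof. by rewrite -(scale0r (0 : V)) innerZl mul0r. Qed.

Lemma inner0r x : inner x 0 = 0.
Proof. by rewrite innerC inner0l. Qed.

Lemma inner_ge0 x : 0 <= inner x x.
Proof. by rewrite inner_norm sqr_ge0. Qed.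

Lemma normr_inner_le x y : `|inner x y| <= `|x| * `|y|.
Proof.
rewrite -(@ler_pXn2r _ 2) ?nnegrE ?mulr_ge0// exprMn real_normK ?num_real//.
rewrite -!inner_norm; apply: form_cauchy_schwarz.
- exact: innerDl.
- exact: innerZl.
- exact: innerC.
- exact: inner_ge0.
Qed.

Lemma inner_inj x y : (forall z, inner x z = inner y z) -> x = y.
Proof.
move=> h; apply/subr0_eq/normr0_eq0/eqP; rewrite -sqrf_eq0 -inner_norm.
by rewrite innerBl h subrr.
Qed.

Lemma inner_continuous y : continuous (fun x => inner x y).
Proof.
move=> x; apply/cvgrPdist_le => e e0.
have y0 : 0 < `|y| + 1 by rewrite ltr_wpDl.
near=> z; rewrite -innerBl; apply: (le_trans (normr_inner_le _ _)).
apply: (@le_trans _ _ (`|x - z| * (`|y| + 1))); first by rewrite ler_wpM2l// lerDl.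
rewrite -ler_pdivlMr//; near: z.
have : 0 < e / (`|y| + 1) by rewrite divr_gt0.
by move: (e / _); apply/cvgrPdist_le; exact: cvg_id.
Unshelve. all: by end_near. Qed.

End inner_product.

(* The symmetric Lax-Milgram theorem, by minimising [b x x - 2 * l x]. *)
Lemma symmetric_lax_milgram (R : realType) (V : hilbertType R)
    (b : V -> V -> R) (l : V -> R) (a C D : R) : 0 < a -> 0 <= C ->
  (forall x y z, b (x + y) z = b x z + b y z) ->
  (forall (t : R) x y, b (t *: x) y = t * b x y) ->
  (forall x y, b x y = b y x) ->
  (forall x, a * `|x| ^+ 2 <= b x x) ->
  (forall x y, `|b x y| <= C * `|x| * `|y|) ->
  (forall x y, l (x + y) = l x + l y) ->
  (forall (t : R) x, l (t *: x) = t * l x) ->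
  (forall x, `|l x| <= D * `|x|) ->
  exists x, forall y, b x y = l y.
Proof.
move=> a0 C0 bD bZ bC ba bb lD lZ lb.
have bDr x y z : b x (y + z) = b x y + b x z by rewrite bC bD !(bC x).
have bZr t x y : b x (t *: y) = t * b x y by rewrite bC bZ (bC x).
pose J x := b x x - 2 * l x.
pose E := [set J x | x in [set: V]].
have E_lb : lbound E (- (D ^+ 2 / a)).
  move=> _ [x _ <-]; rewrite /J; have := ba x; have := lb x.
  rewrite ler_norml => /andP[_ h1] h2.
  have : 0 <= (a * `|x| - D) ^+ 2 / a by rewrite divr_ge0 ?sqr_ge0// ltW.
  have -> : (a * `|x| - D) ^+ 2 / a = a * `|x| ^+ 2 - 2 * (D * `|x|) + D ^+ 2 / a.
    by field; rewrite gt_eqF.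
  lra.
have E_inf : has_inf E by split; [exists (J 0), 0|exists (- (D ^+ 2 / a))].
have [d dJ xP] : exists2 d : R, forall x, d <= J x &
    forall n : nat, exists x, J x < d + n.+1%:R^-1.
  exists (inf E) => [x|n]; first by apply: ge_inf; [exact: (E_inf.2)|exists x].
  have n0 : (0 : R) < n.+1%:R^-1 by rewrite invr_gt0.
  by have [_ [x _ <-] h] := inf_adherent n0 E_inf; exists x.
pose x n := projT1 (cid (xP n)); have xJ n : J (x n) < d + n.+1%:R^-1.
  exact: (projT2 (cid (xP n))).
(* The parallelogram identity and coercivity: two points where J is almost minimal are close to each
   other, so a minimising sequence is Cauchy. *)
have par p q : a / 2 * `|p - q| ^+ 2 <= J p + J q - 2 * d.
  have e : J p + J q - 2 * J (2^-1 *: (p + q)) = 2^-1 * b (p - q) (p - q).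
    rewrite -[- q]scaleN1r /J lZ lD bZ bZr !bD !bDr !(bZ, bZr) (bC q p).
    move: (b p p) (b p q) (b q q) (l p) (l q) => u v w r s; by field.
  have := dJ (2^-1 *: (p + q)); have := ba (p - q); move: e.
  rewrite (mulrAC a).
  move: (b _ _) (J p) (J q) (J _) (a * `|p - q| ^+ 2) => u v w r s; lra.
have cx : cvg (x @ \oo).
  apply/cauchy_cvgP/cauchy_exP => e e0.
  have [N _ hN] : \forall n \near \oo, n.+1%:R^-1 < a * e ^+ 2 / 4.
    have /cvgrPdist_lt/(_ (a * e ^+ 2 / 4)) := @cvg_harmonic R.
    rewrite divr_gt0 ?mulr_gt0 ?exprn_gt0// => /(_ isT); apply: filterS => n.
    by rewrite sub0r normrN ger0_norm ?harmonic_ge0.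
  exists (x N); exists N => // n /= Nn; rewrite -ball_normE/=.
  rewrite -(@ltr_pXn2r _ 2) ?nnegrE ?(ltW e0)//.
  rewrite -(ltr_pM2l (_ : 0 < a / 2)) ?divr_gt0//.
  apply: (le_lt_trans (par _ _)).
  have := xJ N; have := xJ n; have := hN _ Nn; have := hN _ (leqnn N).
  move: (J (x n)) (J (x N)) n.+1%:R^-1 N.+1%:R^-1 => /= r s u v.
  have -> : a / 2 * e ^+ 2 = a * e ^+ 2 / 4 + a * e ^+ 2 / 4 by field.
  by move: (a * _ / 4) => w; lra.
exists (lim (x @ \oo)) => y; set x' := lim _.
(* Almost minimality replaces the vanishing derivative: along x n + t y, J cannot drop by more than
   1 / (n + 1) for any t, which bounds the discriminant of a quadratic in t. *)
have key n : (b (x n) y - l y) ^+ 2 <= n.+1%:R^-1 * b y y.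
  have h t : 0 <= n.+1%:R^-1 + t * (2 * (b (x n) y - l y)) + t ^+ 2 * b y y.
    have := dJ (x n + t *: y); have := xJ n.
    rewrite /J lD lZ !bD !bDr !bZ !bZr (bC y (x n)).
    move: (b (x n) (x n)) (b (x n) y) (b y y) (l (x n)) (l y) n.+1%:R^-1.
    by move=> r s u v w z; lra.
  have [y0|y0] := eqVneq (b y y) 0.
    rewrite y0 mulr0; have [->|yz] := eqVneq (b (x n) y - l y) 0.
      by rewrite expr0n.
    have := h (- (n.+1%:R^-1 + 1) / (2 * (b (x n) y - l y))).
    rewrite y0 mulr0 addr0 divfK ?mulf_neq0//.
    by rewrite opprD addrA subrr sub0r oppr_ge0 ler10.
  have yp : 0 < b y y.
    by rewrite lt_neqAle eq_sym y0 (le_trans _ (ba y))// mulr_ge0 ?sqr_ge0// ltW.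
  have := h (- (b (x n) y - l y) / b y y).
  rewrite -(ler_pM2r yp) mul0r => {}h'.
  rewrite -subr_ge0; apply: le_trans h' _; rewrite le_eqVlt; apply/orP; left.
  move: y0; move: (b (x n) y) (b y y) (l y) n.+1%:R^-1 => u v w z v0.
  by apply/eqP; field.
have c1 : (b (x n) y - l y) ^+ 2 @[n --> \oo] --> 0.
  apply: (@squeeze_cvgr _ _ _ _ (fun=> 0) (fun n => n.+1%:R^-1 * b y y)).
  - by near=> n; rewrite sqr_ge0 key.
  - exact: cvg_cst.
  - rewrite -[X in _ --> X](mul0r (b y y)); apply: cvgM; last exact: cvg_cst.
    exact: cvg_harmonic.
have c2 : b (x n) y @[n --> \oo] --> b x' y.
  apply/subr_cvg0.
  apply: (@squeeze_cvgr _ _ _ _ (fun n => - (C * `|x n - x'| * `|y|))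
    (fun n => C * `|x n - x'| * `|y|)).
  - near=> n; rewrite -ler_norml (_ : _ - _ = b (x n - x') y) ?bb//.
    by rewrite -[- x']scaleN1r bD bZ mulN1r.
  - rewrite -[X in _ --> X]oppr0; apply: cvgN.
    rewrite -[X in _ --> X](mul0r `|y|); apply: cvgM; last exact: cvg_cst.
    rewrite -[X in _ --> X](mulr0 C); apply: cvgM; first exact: cvg_cst.
    by apply/norm_cvg0P/subr_cvg0.
  - rewrite -[X in _ --> X](mul0r `|y|); apply: cvgM; last exact: cvg_cst.
    rewrite -[X in _ --> X](mulr0 C); apply: cvgM; first exact: cvg_cst.
    by apply/norm_cvg0P/subr_cvg0.
have c3 : (b (x n) y - l y) ^+ 2 @[n --> \oo] --> (b x' y - l y) ^+ 2.
  by apply: cvgM; apply: cvgB => //; exact: cvg_cst.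
have : (b x' y - l y) ^+ 2 == 0.
  by apply/eqP; rewrite -(cvg_lim (@Rhausdorff R) c3); exact: cvg_lim c1.
by rewrite sqrf_eq0 subr_eq0 => /eqP.
Unshelve. all: by end_near. Qed.

Lemma riesz_representation (R : realType) (V : hilbertType R) (l : V -> R)
    (D : R) :
  (forall x y, l (x + y) = l x + l y) ->
  (forall (t : R) x, l (t *: x) = t * l x) ->
  (forall x, `|l x| <= D * `|x|) ->
  exists x, forall y, inner x y = l y.
Proof.
move=> lD lZ lb; apply: (@symmetric_lax_milgram R V (fun x y => inner x y) l 1 1 D) => //.
- exact: innerDl.
- exact: innerZl.
- exact: innerC.
- by move=> x; rewrite mul1r inner_norm.
- by move=> x y; rewrite mul1r normr_inner_le.
Qed.

Lemma bounded_adjoint (R : realType) (V W : hilbertType R) (A : {linear V -> W})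
    (c : R) (w : W) : (forall x, `|A x| <= c * `|x|) ->
  exists v, forall x, inner v x = inner w (A x).
Proof.
move=> Ac; apply: (@riesz_representation _ _ _ (`|w| * c)).
- by move=> x y; rewrite linearD innerDr.
- by move=> t x; rewrite linearZ innerZr.
- move=> x; apply: (le_trans (normr_inner_le _ _)).
  by rewrite -mulrA ler_wpM2l.
Qed.

(* [orth_residual z n] is the projection onto the orthogonal complement of
   [z 0, ..., z (n - 1)]. *)
Fixpoint orth_residual (R : realType) (V : hilbertType R) (z : nat -> V)
    (n : nat) : V -> V :=
  if n is m.+1 then
    let T := orth_residual z m in
    let u := `|T (z m)|^-1 *: T (z m) in
    fun x => T x - inner (T x) u *: u
  else id.

(** When z n lies in the span of its predecessors the residual is 0 and so is this vector; the
    sequence z may be linearly dependent. *)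
Definition gram_schmidt (R : realType) (V : hilbertType R) (z : nat -> V)
    (n : nat) : V :=
  let T := orth_residual z n in `|T (z n)|^-1 *: T (z n).

Section gram_schmidt.
Context (R : realType) (V : hilbertType R) (z : nat -> V).
Let T := orth_residual z.
Let u := gram_schmidt z.

Let TS n x : T n.+1 x = T n x - inner (T n x) (u n) *: u n.
Proof. by []. Qed.

Let TB n x y : T n (x - y) = T n x - T n y.
Proof.
elim: n => [|n ih] //; rewrite !TS ih innerBl scalerBl.
by rewrite !opprD !opprK addrACA.
Qed.

Let TZ n (a : R) x : T n (a *: x) = a *: T n x.
Proof. by elim: n => [|n ih] //; rewrite !TS ih innerZl scalerBr [in RHS]scalerA. Qed.

(** A form of normalisation valid both for a unit vector u n and for u n = 0. *)
Let uu n x : inner (u n) (u n) * inner x (u n) = inner x (u n).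
Proof.
rewrite /u /gram_schmidt -/(T n) innerZl !innerZr inner_norm.
have [->|r0] := eqVneq (T n (z n)) 0; first by rewrite inner0r !mulr0.
have : `|T n (z n)| != 0 by rewrite normr_eq0.
by move: `|_| (inner _ _) => r s; move=> r0'; field.
Qed.

Let T_proj n : (forall x, T n (T n x) = T n x) /\
  (forall x y, inner (T n x) y = inner x (T n y)).
Proof.
elim: n => [|n [idT symT]]; first by split.
have Tu : T n (u n) = u n by rewrite /u /gram_schmidt -/(T n) TZ idT.
split => [x|x y].
  rewrite [T n.+1 x]TS [LHS]TS TB TZ idT Tu innerBl innerZl mulrC uu subrr.
  by rewrite scale0r subr0.
rewrite !TS innerBl innerBr [inner (_ *: _) y]innerZl [inner x (_ *: _)]innerZr.
by rewrite !symT Tu mulrC (innerC (u n)).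
Qed.

Let Tu n : T n (u n) = u n.
Proof. by rewrite /u /gram_schmidt -/(T n) TZ (T_proj n).1. Qed.

Lemma bessel_eq n x :
  `|x| ^+ 2 = \sum_(i < n) inner x (gram_schmidt z i) ^+ 2 + `|T n x| ^+ 2.
Proof.
elim: n => [|n ih]; first by rewrite big_ord0 add0r.
rewrite big_ord_recr/= ih -addrA; congr (_ + _); rewrite -/(u n).
rewrite -!inner_norm TS innerBl !innerBr.
have xu : inner (T n x) (u n) = inner x (u n) by rewrite (T_proj n).2 Tu.
have := uu n x; move: xu; move: (u n) => v.
rewrite !innerZl !innerZr (innerC v (T n x)) => ->.
by move: (inner v v) (inner x v) => a b h; rewrite (mulrC b a) h; ring.
Qed.

Lemma bessel_le n x :
  \sum_(i < n) inner x (gram_schmidt z i) ^+ 2 <= `|x| ^+ 2.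
Proof. by rewrite (bessel_eq n x) lerDl sqr_ge0. Qed.

Let T_le n x : `|T n x| <= `|x|.
Proof.
rewrite -(@ler_pXn2r _ 2) ?nnegrE// (bessel_eq n x) lerDr.
by apply: sumr_ge0 => i _; exact: sqr_ge0.
Qed.

(** The residual after n + 1 steps kills z n, so at x it has norm at most |x - z n|; since residual
    norms decrease with n, approximating x by the z n makes them tend to 0. *)
Lemma parseval_cvg x : (forall e, 0 < e -> exists n, `|x - z n| < e) ->
  \sum_(i < n) inner x (gram_schmidt z i) ^+ 2 @[n --> \oo] --> `|x| ^+ 2.
Proof.
move=> zx.
have TSz n : T n.+1 (z n) = 0.
  rewrite TS; have -> : inner (T n (z n)) (u n) *: u n = T n (z n); last exact: subrr.
  rewrite /u /gram_schmidt -/(T n) innerZr inner_norm scalerA.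
  have [->|r0] := eqVneq (T n (z n)) 0; first by rewrite scaler0.
  have : `|T n (z n)| != 0 by rewrite normr_eq0.
  rewrite -[RHS]scale1r; move=> r0'; congr (_ *: _).
  by move: r0'; move: `|_| => r r0'; field.
have Tdec n m y : (n <= m)%N -> `|T m y| <= `|T n y|.
  move=> /subnK <-; elim: (m - n)%N => [|k ih]; first by rewrite add0n.
  rewrite addSn; apply: le_trans ih; rewrite -(@ler_pXn2r _ 2) ?nnegrE//.
  have := bessel_eq (k + n) y; rewrite (bessel_eq (k + n).+1 y) big_ord_recr/= -addrA.
  by move=> /addrI <-; rewrite lerDr sqr_ge0.
have T0 : `|T n x| ^+ 2 @[n --> \oo] --> (0 : R).
  apply/cvgrPdist_lt => e e0.
  have s0 : 0 < Num.sqrt e by rewrite sqrtr_gt0.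
  have [n nx] := zx _ s0.
  exists n.+1 => // m /= nm; rewrite sub0r normrN ger0_norm ?sqr_ge0//.
  rewrite -[ltRHS](sqr_sqrtr (ltW e0)) ltr_pXn2r ?nnegrE ?(ltW s0)//.
  apply: (le_lt_trans (Tdec _ _ _ nm)); apply: le_lt_trans nx.
  have -> : T n.+1 x = T n.+1 (x - z n) by rewrite TB TSz subr0.
  exact: T_le.
have : `|x| ^+ 2 - `|T n x| ^+ 2 @[n --> \oo] --> `|x| ^+ 2 - 0.
  by apply: cvgB => //; exact: cvg_cst.
rewrite subr0; apply: cvg_trans; apply: near_eq_cvg.
by near=> n; rewrite (bessel_eq n x) addrK.
Unshelve. all: by end_near. Qed.

End gram_schmidt.

Lemma separable_dense_seq (R : realType) (V : normedModType R) : separable V ->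
  exists z : nat -> V, forall x (e : R), 0 < e -> exists n, `|x - z n| < e.
Proof.
move=> [S cS dS].
have hit (x : V) (e : R) : 0 < e -> exists2 y, S y & `|x - y| < e.
  move=> e0; have [y [xy Sy]] : ball x e `&` S !=set0.
    by apply: dS; [exists x; exact: ballxx|exact: ball_open].
  by exists y => //; move: xy; rewrite -ball_normE.
have /pfcard_geP[S0|[f]] := cS.
  by have [y] := hit 0 1 ltr01; rewrite S0.
exists f => x e /(hit x)[y Sy xy].
by have [n _ ny] := 'surj_f Sy; exists n; rewrite ny.
Qed.

(** * Integration against a density *)

Section density.
Local Open Scope ereal_scope.
Context d (T : measurableType d) (R : realType).
Variables (mu : {measure set T -> \bar R}) (p : T -> R).
Hypothesis mp : measurable_fun [set: T] p.
Hypothesis p0 : forall x, (0 <= p x)%R.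

Lemma density_measure : exists nu : {measure set T -> \bar R},
  forall B, nu B = \int[mu]_(x in B) (p x)%:E.
Proof.
pose nu B := \int[mu]_(x in B) (p x)%:E.
have nu0 : nu set0 = 0 by rewrite /nu integral_set0.
have nu_ge0 B : 0 <= nu B by apply: integral_ge0 => x _; rewrite lee_fin.
have nu_sigma : semi_sigma_additive nu.
  move=> F mF tF mUF; rewrite /nu ge0_integral_bigcup//.
  - apply: is_cvg_ereal_nneg_natsum_cond => n _ _.
    by apply: integral_ge0 => x _; rewrite lee_fin.
  - by apply/measurable_EFinP; exact: measurable_funTS.
  - by move=> x _; rewrite lee_fin.
pose nuM := isMeasure.Build _ _ _ nu nu0 nu_ge0 nu_sigma.
pose nu' : {measure set T -> \bar R} := HB.pack nu nuM.
by exists nu'.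
Qed.

Variable nu : {measure set T -> \bar R}.
Hypothesis nuE : forall B, measurable B -> nu B = \int[mu]_(x in B) (p x)%:E.

Import HBNNSimple.

Let mpE : measurable_fun [set: T] (fun x => (p x)%:E).
Proof. exact/measurable_EFinP. Qed.

Lemma ge0_integral_density (f : T -> \bar R) : measurable_fun [set: T] f ->
  (forall x, 0 <= f x) ->
  \int[nu]_x f x = \int[mu]_x (f x * (p x)%:E).
Proof.
move=> mf f0; pose h := nnsfun_approx measurableT mf.
have -> : \int[nu]_x f x = lim (\int[nu]_x (EFin \o h n) x @[n --> \oo]).
  have fE x : f x = lim ((EFin \o h n) x @[n --> \oo]).
    by apply/esym/cvg_lim => //; exact: cvg_nnsfun_approx.
  under eq_integral => x _ do rewrite fE.
  apply: monotone_convergence => //.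
  - by move=> n; apply/measurable_EFinP/measurable_funP.
  - by move=> n x _ /=; rewrite lee_fin.
  - by move=> x _ a b ab; rewrite lee_fin; exact/lefP/nd_nnsfun_approx.
have -> : \int[mu]_x (f x * (p x)%:E) =
    lim (\int[mu]_x ((EFin \o h n) x * (p x)%:E) @[n --> \oo]).
  have fE x : f x * (p x)%:E = lim ((EFin \o h n) x * (p x)%:E @[n --> \oo]).
    by apply/esym/cvg_lim => //; apply: cvgeZr => //; exact: cvg_nnsfun_approx.
  under eq_integral => x _ do rewrite fE.
  apply: monotone_convergence => //.
  - by move=> n; apply/emeasurable_funM => //; apply/measurable_EFinP/measurable_funP.
  - by move=> n x _ /=; rewrite mule_ge0 ?lee_fin.
  - move=> x _ a b ab /=; rewrite lee_wpmul2r ?lee_fin//.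
    exact/lefP/nd_nnsfun_approx.
suff suf n : \int[mu]_x ((EFin \o h n) x * (p x)%:E) = \int[nu]_x (EFin \o h n) x.
  by under [in RHS]eq_fun do rewrite suf.
have mh r : measurable (h n @^-1` [set r]) by exact: measurable_funPTI.
transitivity (\int[nu]_x (\sum_(y \in range (h n)) (y * \1_(h n @^-1` [set y]) x)%:E)); last first.
  by apply: eq_integral => t tE; rewrite /= fimfunE -fsumEFin.
have indich r : measurable_fun [set: T] (fun x => (r * \1_(h n @^-1` [set r]) x)%:E).
  by apply/measurable_EFinP/measurable_funM.
rewrite ge0_integral_fsum//; last by move=> y x _; exact: nnfun_muleindic_ge0.
transitivity (\int[mu]_x (\sum_(y \in range (h n))
    (y * \1_(h n @^-1` [set y]) x)%:E * (p x)%:E)).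
  under [RHS]eq_integral => x xE.
    rewrite -ge0_mule_fsuml => [|y]; last exact: nnfun_muleindic_ge0.
    rewrite fsumEFin // -(fimfunE _ x); over.
  by [].
rewrite ge0_integral_fsum//; last 2 first.
  - by move=> y; apply: emeasurable_funM.
  - by move=> y x _; rewrite mule_ge0 ?nnfun_muleindic_ge0// lee_fin.
apply: eq_fsbigr => r rhn.
under [RHS]eq_integral do rewrite EFinM.
rewrite integralZl_indic_nnsfun => //.
under eq_integral do rewrite EFinM -muleA.
rewrite ge0_integralZl//.
- under eq_integral do rewrite muleC.
  rewrite (eq_integral ((fun x => (p x)%:E) \_ (h n @^-1` [set r]))); last first.
    by move=> x xE; rewrite epatch_indic.
  by rewrite -integral_mkcond -nuE// integral_indic// setIT.
- by apply: emeasurable_funM => //; exact/measurable_EFinP.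
- by move=> t _; rewrite mule_ge0 ?lee_fin.
- by move: rhn; rewrite inE => -[t _ <-]; rewrite lee_fin.
Qed.

Lemma integral_density (f : T -> R) : measurable_fun [set: T] f ->
  mu.-integrable [set: T] (fun x => (f x * p x)%:E) ->
  nu.-integrable [set: T] (fun x => (f x)%:E) /\
  \int[nu]_x (f x)%:E = \int[mu]_x (f x * p x)%:E.
Proof.
move=> mf intfp.
have mN : measurable_fun [set: T] (fun x => `|f x|%R) by exact: measurableT_comp.
have absE x : (`|f x * p x| = `|f x| * p x)%R by rewrite normrM (ger0_norm (p0 x)).
have intN : mu.-integrable [set: T] (fun x => (`|f x| * p x)%:E).
  by move/integrable_norm : intfp; apply: eq_integrable => // x _; rewrite /= absE.
have intnu : nu.-integrable [set: T] (fun x => (f x)%:E).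
  apply/integrableP; split; first exact/measurable_EFinP.
  rewrite ge0_integral_density//; last exact/measurable_EFinP.
  move/integrableP : intN => [_]; apply: le_lt_trans.
  rewrite le_eqVlt; apply/orP; left; apply/eqP; apply: eq_integral => x _ /=.
  by rewrite -EFinM [in RHS]ger0_norm// mulr_ge0.
split => //.
have intNnu : nu.-integrable [set: T] (fun x => `|f x|%:E) by exact: integrable_norm.
(* f = (f + |f|) - |f| is a difference of nonnegative integrable functions, and the nonnegative case
   applies to both. *)
pose g x := (f x + `|f x|)%R.
have g0 x : (0 <= g x)%R by rewrite /g; have := ler_norm (- f x); rewrite normrN; lra.
have mg : measurable_fun [set: T] g by exact: measurable_funD.
have ing : nu.-integrable [set: T] (fun x => (g x)%:E).
  by have := integrableD measurableT intnu intNnu; apply: eq_integrable.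
have ingmu : mu.-integrable [set: T] (fun x => (g x * p x)%:E).
  have := integrableD measurableT intfp intN; apply: eq_integrable => // x _ /=.
  by rewrite -EFinD -mulrDl.
have -> : \int[nu]_x (f x)%:E = \int[nu]_x (g x)%:E - \int[nu]_x `|f x|%:E.
  rewrite -integralB_EFin//; apply: eq_integral => x _.
  by rewrite -EFinB /g addrK.
rewrite ge0_integral_density//; last exact/measurable_EFinP.
rewrite ge0_integral_density//; last exact/measurable_EFinP.
under eq_integral do rewrite -EFinM.
under [X in _ - X]eq_integral do rewrite -EFinM.
rewrite -integralB_EFin//; apply: eq_integral => x _.
by rewrite -EFinB -mulrBl /g addrK.
Qed.

End density.

(** * Gaussian random variables *)

(** Encodes X ~ N(0, v) by the Laplace transform: v = 0 is no special case, and t = 0 says that mu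
    has total mass 1. *)
Definition gaussian_mgf d (T : measurableType d) (R : realType)
    (mu : set T -> \bar R) (X : T -> R) (v : R) :=
  measurable_fun [set: T] X /\
  forall t, (\int[mu]_w (expR (t * X w))%:E = (expR (t ^+ 2 * v / 2))%:E)%E.

Section gaussian_mgf.
Context d (T : measurableType d) (R : realType).
Variables (mu : {measure set T -> \bar R}) (X : T -> R) (v : R).
Hypothesis gX : gaussian_mgf mu X v.

Let mX : measurable_fun [set: T] X. Proof. by have [] := gX. Qed.

Let mexp t : measurable_fun [set: T] (fun w => (expR (t * X w))%:E).
Proof.
apply/measurable_EFinP; apply: measurableT_comp => //.
exact: measurable_funM.
Qed.

Lemma gaussian_mgf_integrable t : mu.-integrable setT (fun w => (expR (t * X w))%:E).
Proof.
apply/integrableP; split; first exact: mexp.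
under eq_integral do rewrite gee0_abs ?lee_fin ?expR_ge0//.
by have [_ ->] := gX; rewrite ltry.
Qed.

Let dom t : mu.-integrable setT
  (fun w => (expR (t * X w) + expR (- t * X w))%:E).
Proof.
have := integrableD measurableT (gaussian_mgf_integrable t) (gaussian_mgf_integrable (- t)).
exact: eq_integrable.
Qed.

Let expabs (t : R) w : 0 <= t -> expR (t * `|X w|) <= expR (t * X w) + expR (- t * X w).
Proof.
move=> t0; have := expR_ge0 (t * X w); have := expR_ge0 (- t * X w).
by case: (ger0P (X w)) => _; rewrite ?mulrN -?mulNr; lra.
Qed.

Let diffquo_le (x h : R) : 0 < h <= 1 -> `|(expR (x * h) - 1) / h| <= expR (2 * `|x|).
Proof.
move=> /andP[h0 h1]; rewrite normrM normfV (gtr0_norm h0) ler_pdivrMr//.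
apply: (le_trans (normr_expR_subr1 _)); rewrite normrM (gtr0_norm h0).
rewrite -mulrA mulrCA [in leRHS]mulrC ler_wpM2l ?(ltW h0)//.
have -> : 2 * `|x| = `|x| + `|x| by ring.
rewrite expRD ler_pM ?expR_ge0//; first by have := expR_ge1Dx `|x|; lra.
by rewrite ler_expR ler_piMr.
Qed.

Let h_ n : (0 : R) < harmonic n <= (1 : R).
Proof. by rewrite harmonic_gt0/= invf_le1// ler1n. Qed.

Lemma gaussian_mean0 : mu.-integrable setT (fun w => (X w)%:E) /\
  (\int[mu]_w (X w)%:E = 0)%E.
Proof.
(* A central difference quotient at 0: its integral is exactly 0 because the Laplace transform is
   even. *)
pose F n w : R := 2^-1 * ((expR (X w * harmonic n) - 1) / harmonic n
  + - ((expR (- X w * harmonic n) - 1) / harmonic n)).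
have mF n : measurable_fun setT (fun w => (F n w)%:E).
  apply/measurable_EFinP; apply: measurable_funM => //; apply: measurable_funD.
    apply: measurable_funM => //; apply: measurable_funB => //.
    by apply: measurableT_comp => //; exact: measurable_funM.
  apply: measurableT_comp => //; apply: measurable_funM => //.
  apply: measurable_funB => //; apply: measurableT_comp => //.
  by apply: measurable_funM => //; exact: measurableT_comp.
have mXE : measurable_fun setT (fun w => (X w)%:E) by exact/measurable_EFinP.
have cF w : (fun n => (F n w)%:E) @ \oo --> (X w)%:E.
  apply: cvg_EFin; first exact: nearW.
  have -> : X w = 2^-1 * (X w + - - X w) by field.
  apply: cvgM; first exact: cvg_cst.
  apply: cvgD; last apply: cvgN; apply: cvg_expR_diffquo;
    by [exact: cvg_harmonic|exact: harmonic_gt0].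
have FG n w : (`|(F n w)%:E| <= (expR (2 * X w) + expR (- 2 * X w))%:E)%E.
  rewrite lee_fin; apply: le_trans (expabs w (ler0n _ 2)).
  have := diffquo_le (X w) (h_ n); have := diffquo_le (- X w) (h_ n).
  rewrite normrN /F; set a := _ / _; set b := _ / _ => hb ha.
  rewrite normrM gtr0_norm ?invr_gt0//; have := ler_normB b a; lra.
have [iX _ cX] := @dominated_convergence _ _ _ mu _ measurableT _ _ _ mF
  mXE (aeW _ (fun t _ => cF t)) (dom 2) (aeW _ (fun t n _ => FG n t)).
split => //; rewrite -(cvg_lim _ cX)//; apply: cvg_lim => //.
rewrite (_ : [sequence _]_n = cst 0%E); first exact: cvg_cst.
apply/funext => n; rewrite [LHS]/=; pose h : R := harmonic n.
have h0 : h != 0 by rewrite gt_eqF// harmonic_gt0.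
have Fe x : F n x = (2 * h)^-1 * (expR (h * X x) - expR (- h * X x)).
  rewrite /F -/h (mulrC (X x)) mulNr (mulrC (X x)) -(mulNr h).
  by move: (expR _) (expR _) => e e'; field.
under eq_integral => x _ do rewrite Fe EFinM EFinB.
have i1 := gaussian_mgf_integrable h; have i2 := gaussian_mgf_integrable (- h).
rewrite integralZl//; last exact: integrableB.
rewrite integralB_EFin//; have [_ mE] := gX.
by rewrite !mE sqrrN subee ?mule0.
Qed.

Lemma gaussian_variance : mu.-integrable setT (fun w => (X w ^+ 2)%:E) /\
  (\int[mu]_w (X w ^+ 2)%:E = v%:E)%E.
Proof.
(* This is the second difference quotient (e^(h X) + e^(- h X) - 2) / h^2. In product form its limit
   and its domination follow from the first quotient; the exponent 5 = 2 + 2 + 1 below counts the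
   three factors. *)
pose F n w : R := ((expR (X w * harmonic n) - 1) / harmonic n) ^+ 2
  * expR (- X w * harmonic n).
have mF n : measurable_fun setT (fun w => (F n w)%:E).
  apply/measurable_EFinP; apply: measurable_funM => //.
    apply: measurable_funX; apply: measurable_funM => //; apply: measurable_funB => //.
    by apply: measurableT_comp => //; exact: measurable_funM.
  apply: measurableT_comp => //.
  by apply: measurable_funM => //; exact: measurableT_comp.
have mXE : measurable_fun setT (fun w => (X w ^+ 2)%:E).
  by apply/measurable_EFinP; exact: measurable_funX.
have cF w : (fun n => (F n w)%:E) @ \oo --> (X w ^+ 2)%:E.
  apply: cvg_EFin; first exact: nearW.
  rewrite -[X in _ --> X]mulr1; apply: cvgM.
    have c1 : (expR (X w * harmonic n) - 1) / harmonic n @[n --> \oo] --> X w.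
      by apply: cvg_expR_diffquo; [exact: harmonic_gt0|exact: cvg_harmonic].
    exact: (cvgM c1 c1).
  rewrite -[X in _ --> X](@expR0 R) -[X in expR X](mulr0 (- X w)).
  apply: (cvg_comp (fun n => - X w * harmonic n) expR); last exact: continuous_expR.
  by apply: cvgM; [exact: cvg_cst|exact: cvg_harmonic].
have FG n w : (`|(F n w)%:E| <= (expR (5 * X w) + expR (- 5 * X w))%:E)%E.
  rewrite lee_fin; apply: le_trans (expabs w (ler0n _ 5)).
  have -> : 5 * `|X w| = 2 * `|X w| + 2 * `|X w| + `|X w| by ring.
  rewrite !expRD normrM (ger0_norm (expR_ge0 _)) normrX expr2.
  have a := diffquo_le (X w) (h_ n).
  rewrite !ler_pM ?mulr_ge0 ?expR_ge0// ler_expR.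
  have /andP[h0 h1] := h_ n; apply: (le_trans (ler_norm _)).
  by rewrite normrM normrN (gtr0_norm h0) ler_piMr.
have [iX _ cX] := @dominated_convergence _ _ _ mu _ measurableT _ _ _ mF
  mXE (aeW _ (fun t _ => cF t)) (dom 5) (aeW _ (fun t n _ => FG n t)).
split => //; rewrite -(cvg_lim _ cX)//; apply: cvg_lim => //.
rewrite (_ : [sequence _]_n = fun n =>
    (2 * ((expR (v / 2 * harmonic n ^+ 2) - 1) / harmonic n ^+ 2))%:E).
  apply: cvg_EFin; first exact: nearW.
  have -> : v = 2 * (v / 2) by field.
  apply: cvgM; first exact: cvg_cst.
  rewrite (_ : 2 * (v / 2) / 2 = v / 2); last by field.
  apply: (@cvg_expR_diffquo _ (fun n => harmonic n ^+ 2)).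
    by move=> n; rewrite exprn_gt0// harmonic_gt0.
  by rewrite -[X in _ --> X](mulr0 0); apply: cvgM; exact: cvg_harmonic.
apply/funext => n; pose h : R := harmonic n.
transitivity (2 * ((expR (v / 2 * h ^+ 2) - 1) / h ^+ 2))%:E => //.
have h0 : h != 0 by rewrite gt_eqF// harmonic_gt0.
rewrite [LHS]/=.
have Fe x : F n x =
    h ^- 2 * (expR (h * X x) + expR (- h * X x) - 2 * expR (0 * X x)).
  rewrite /F -/h (mulrC (X x)) mulNr (mulrC (X x)) -(mulNr h) mul0r expR0 mulNr expRN.
  by have := expR_gt0 (h * X x); move: (expR _) => e e0; field; rewrite h0 gt_eqF.
have i1 := gaussian_mgf_integrable h; have i2 := gaussian_mgf_integrable (- h).
have i0 := gaussian_mgf_integrable 0.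
have i12 : mu.-integrable setT (fun x => (expR (h * X x) + expR (- h * X x))%:E).
  by have := integrableD measurableT i1 i2; exact: eq_integrable.
have i0' : mu.-integrable setT (fun x => (2 * expR (0 * X x))%:E).
  by have := integrableZl measurableT 2 i0; exact: eq_integrable.
under eq_integral => x _ do rewrite Fe EFinM EFinB.
rewrite integralZl//; last exact: integrableB.
rewrite integralB_EFin//.
under eq_integral do rewrite EFinD.
under [X in (_ - X)%E]eq_integral do rewrite EFinM.
rewrite integralD_EFin// integralZl//; have [_ mE] := gX.
rewrite !mE sqrrN expr0n !mul0r expR0.
transitivity (h ^- 2 * (expR (h ^+ 2 * v / 2) + expR (h ^+ 2 * v / 2) - 2 * 1))%:E => //.
congr (_%:E); by rewrite (_ : v / 2 * h ^+ 2 = h ^+ 2 * v / 2); [field|ring].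
Qed.

(** From (t |X|)^4 / 4! <= e^(t |X|) <= e^(t X) + e^(- t X), whence 48 = 2 * 4!. The scale t is left
    free because v may be 0; for any w > 0 with v <= w, t = 1 / sqrt w gives a bound of order
    w^2. *)
Lemma gaussian_fourth_moment (t : R) : 0 < t ->
  (\int[mu]_w (X w ^+ 4)%:E <= (48 / t ^+ 4 * expR (t ^+ 2 * v / 2))%:E)%E.
Proof.
move=> t0.
have le w : X w ^+ 4 <= 24 / t ^+ 4 * (expR (t * X w) + expR (- t * X w)).
  rewrite mulrAC ler_pdivlMr ?exprn_gt0// mulrC.
  have := expabs w (ltW t0); have := @expR_ge1Dxn R (t * `|X w|) 3.
  rewrite mulr_ge0 ?(ltW t0)// => /(_ isT); rewrite exprMn -normrX.
  rewrite ger0_norm ?exprn_even_ge0//.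
  by have -> : (4`!%:R : R) = 24 by []; lra.
apply: (@le_trans _ _ (\int[mu]_w ((24 / t ^+ 4)%:E *
    ((expR (t * X w))%:E + (expR (- t * X w))%:E)))%E).
  apply: ge0_le_integral => //.
  - by move=> w _; rewrite lee_fin exprn_even_ge0.
  - by apply/measurable_EFinP; exact: measurable_funX.
  - by apply: emeasurable_funM => //; apply: emeasurable_funD; exact: mexp.
  - by move=> w _; rewrite -EFinD -EFinM lee_fin.
rewrite integralZl//; last by apply: integrableD => //; exact: gaussian_mgf_integrable.
rewrite integralD//; [|exact: gaussian_mgf_integrable..].
have [_ mE] := gX; rewrite !mE sqrrN -EFinD -EFinM lee_fin.
by rewrite le_eqVlt; apply/orP; left; apply/eqP; field; rewrite gt_eqF.
Qed.

End gaussian_mgf.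

(* Let S be a partial sum and t its expectation.  By Cauchy-Schwarz and the fourth
   moment bound E S^2 = O((t + 1)^2), so an event {r < N} of small probability
   carries at most half of t + 1, while S <= r elsewhere. *)
Lemma gaussian_square_le d (T : measurableType d) (R : realType)
    (P : probability T R) (X : nat -> T -> R) (v : nat -> R) (N : T -> R) :
  (forall i, gaussian_mgf P (X i) (v i)) -> measurable_fun [set: T] N ->
  (forall n t, \sum_(i < n) X i t ^+ 2 <= N t) ->
  exists K, forall n, (\int[P]_t (\sum_(i < n) X i t ^+ 2)%:E <= K%:E)%E.
Proof.
move=> gX mN XN.
have v0 i : 0 <= v i.
  have [_ e] := gaussian_variance (gX i).
  by rewrite -lee_fin -e; apply: integral_ge0 => t _; rewrite lee_fin sqr_ge0.
pose C : R := 48 * expR (2^-1).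
have C0 : 0 < C by rewrite mulr_gt0// expR_gt0.
have X4 i (w : R) : v i <= w -> 0 < w -> (\int[P]_t (X i t ^+ 4)%:E <= (C * w ^+ 2)%:E)%E.
  move=> vw w0.
  have sw : 0 < Num.sqrt w by rewrite sqrtr_gt0.
  have ssw : Num.sqrt w ^+ 2 = w by rewrite sqr_sqrtr// ltW.
  have t0 : 0 < (Num.sqrt w)^-1 by rewrite invr_gt0.
  apply: (le_trans (gaussian_fourth_moment (gX i) t0)).
  rewrite lee_fin /C exprVn invrK (_ : Num.sqrt w ^+ 4 = w ^+ 2); last first.
    by rewrite -[in RHS]ssw -exprM.
  rewrite mulrAC ler_wpM2r ?sqr_ge0// ler_wpM2l// ler_expR exprVn ssw.
  by rewrite -[leRHS]mul1r ler_wpM2r// mulrC ler_pdivrMr ?mul1r.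
(* The sets {k < N} decrease to the empty set, so r is chosen before n. With mass at most (4 C)^-1,
   the last two terms of [Sle] integrate to at most (t + 1) / 4 each, and t <= r + (t + 1) / 2
   yields 2 r + 1. *)
have [r r0 Pr] : exists2 r : R, 0 <= r & (P [set t | (r < N t)%R] <= (4 * C)^-1%:E)%E.
  pose F (k : nat) := [set t | (k%:R < N t)%R].
  have mF k : measurable (F k).
    have := mN measurableT _ (measurable_itv `]k%:R, +oo[); rewrite setTI.
    by congr measurable; apply/seteqP; split => t /=; rewrite in_itv/= andbT.
  have F0 : \bigcap_k F k = set0.
    apply/seteqP; split => // t /= /(_ (Num.bound `|N t|) I); rewrite /F/= => h.
    have h' := archi_boundP (normr_ge0 (N t)).
    by have := lt_trans h' h; rewrite ltNge ler_norm.
  have : P (F k) @[k --> \oo] --> 0%E.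
    rewrite -(@measure0 _ _ _ P) -F0; apply: nonincreasing_cvg_mu => //.
    - by rewrite (le_lt_trans (probability_le1 _ _)) ?ltry.
    - by rewrite F0.
    - move=> k l kl; apply/subsetPset => t /=; apply: le_lt_trans.
      by rewrite ler_nat.
  have C4 : 0 < (4 * C)^-1 by rewrite invr_gt0 mulr_gt0.
  move=> /fine_cvgP[_ /cvgrPdist_lt/(_ _ C4)[k _ /(_ k (leqnn k))]] /=.
  rewrite sub0r normrN ger0_norm ?fine_ge0// => h.
  exists k%:R => //; rewrite -(@fineK _ (P _)) ?lee_fin ?(ltW h)//.
  by apply: fin_num_measure; exact: mF.
exists (2 * r + 1) => -[|n].
  rewrite integral0_eq; first by rewrite lee_fin addr_ge0 ?mulr_ge0.
  by move=> t _; rewrite big_ord0.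
(* Variances may vanish; adding 1 / (n + 1) to each of the n + 1 of them gives positive weights of
   total t + 1. *)
pose w i := v i + n.+1%:R^-1; pose t := \sum_(i < n.+1) v i.
have w0 i : 0 < w i by rewrite ltr_wpDl// invr_gt0.
have wt : \sum_(i < n.+1) w i = t + 1.
  rewrite big_split/= sumr_const card_ord; congr (_ + _).
  by rewrite -[_^-1 *+ _]mulr_natr mulVf// pnatr_eq0.
have t0 : 0 <= t by apply: sumr_ge0.
have mX i : measurable_fun [set: T] (X i) by have [] := gX i.
pose S x := \sum_(i < n.+1) X i x ^+ 2.
pose Q x := \sum_(i < n.+1) X i x ^+ 4 / w i.
have S0 x : 0 <= S x by apply: sumr_ge0 => i _; exact: sqr_ge0.
have Q0 x : 0 <= Q x.
  by apply: sumr_ge0 => i _; rewrite divr_ge0 ?(ltW (w0 _))// exprn_even_ge0.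
(* Weighted Cauchy-Schwarz, read off from the expansion of a nonnegative weighted sum of squares. *)
have SQ x : S x ^+ 2 <= (t + 1) * Q x.
  have t1 : 0 < t + 1 by rewrite ltr_wpDl.
  have : 0 <= \sum_(i < n.+1) w i * (X i x ^+ 2 / w i - S x / (t + 1)) ^+ 2.
    by apply: sumr_ge0 => i _; rewrite mulr_ge0 ?sqr_ge0// ltW.
  have -> : \sum_(i < n.+1) w i * (X i x ^+ 2 / w i - S x / (t + 1)) ^+ 2
      = Q x - 2 * (S x / (t + 1)) * S x + (t + 1) * (S x / (t + 1)) ^+ 2.
    set a := S x / (t + 1).
    transitivity (\sum_(i < n.+1) (X i x ^+ 4 / w i - 2 * a * X i x ^+ 2 + a ^+ 2 * w i)).
      by apply: eq_bigr => i _; field; rewrite gt_eqF.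
    by rewrite big_split/= sumrB -!mulr_sumr wt [a ^+ 2 * _]mulrC.
  have -> : Q x - 2 * (S x / (t + 1)) * S x + (t + 1) * (S x / (t + 1)) ^+ 2
      = (Q x * (t + 1) - S x ^+ 2) / (t + 1) by field; rewrite gt_eqF.
  by rewrite pmulr_lge0 ?invr_gt0// subr_ge0 mulrC.
(* On {r < N}, completing the square gives S <= S^2 / (4 h) + h with h = C (t + 1); elsewhere S <= N
   <= r. *)
have Sle x : S x <= r + ((4 * C)^-1 * Q x + C * (t + 1) * \1_[set t | (r < N t)%R] x).
  have h0 : 0 < C * (t + 1) by rewrite mulr_gt0// ltr_wpDl.
  rewrite indicE; case: (ltP r (N x)) => rN.
    rewrite mem_set//= mulr1.
    have : 0 <= (S x / (2 * (C * (t + 1))) - 1) ^+ 2 * (C * (t + 1)).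
      by rewrite mulr_ge0 ?sqr_ge0// ltW.
    have -> : (S x / (2 * (C * (t + 1))) - 1) ^+ 2 * (C * (t + 1)) =
        (4 * C)^-1 * (S x ^+ 2 / (t + 1)) - S x + C * (t + 1).
      by field; rewrite !gt_eqF// ltr_wpDl.
    have : (4 * C)^-1 * (S x ^+ 2 / (t + 1)) <= (4 * C)^-1 * Q x.
      rewrite ler_wpM2l ?invr_ge0 ?mulr_ge0// ?(ltW C0)//.
      by rewrite ler_pdivrMr 1?mulrC// ltr_wpDl.
    by move: (_ * Q x) (_ * (_ / _)) => a b; lra.
  rewrite memNset/=; last by move=> /lt_le_trans /(_ rN); rewrite ltxx.
  rewrite mulr0 addr0; apply: (le_trans (le_trans (XN _ _) rN)).
  by rewrite lerDl mulr_ge0// invr_ge0 mulr_ge0// ltW.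
have mNr : measurable [set t | (r < N t)%R].
  have := mN measurableT _ (measurable_itv `]r, +oo[); rewrite setTI.
  by congr measurable; apply/seteqP; split => x /=; rewrite in_itv/= andbT.
have mX2 i : measurable_fun [set: T] (fun x => (X i x ^+ 2)%:E).
  by apply/measurable_EFinP; exact: measurable_funX.
have mX4 i : measurable_fun [set: T] (fun x => (X i x ^+ 4 / w i)%:E).
  by apply/measurable_EFinP; apply: measurable_funM => //; exact: measurable_funX.
have intS : (\int[P]_x (S x)%:E = t%:E)%E.
  under eq_integral do rewrite /S -sumEFin.
  rewrite ge0_integral_sum//; last by move=> i x _; rewrite lee_fin sqr_ge0.
  rewrite -sumEFin; apply: eq_bigr => i _.
  by have [_ ->] := gaussian_variance (gX i).
have mQ : measurable_fun [set: T] (fun x => (Q x)%:E).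
  by apply/measurable_EFinP; apply: measurable_sum => i; exact/measurable_EFinP/mX4.
have intQ : (\int[P]_x (Q x)%:E <= (C * (t + 1))%:E)%E.
  under eq_integral do rewrite /Q -sumEFin.
  rewrite ge0_integral_sum//; last first.
    by move=> i x _; rewrite lee_fin divr_ge0 ?(ltW (w0 _))// exprn_even_ge0.
  rewrite -wt mulr_sumr -sumEFin; apply: lee_sum => i _.
  under eq_integral do rewrite EFinM.
  rewrite ge0_integralZr//; last 3 first.
  - by apply/measurable_EFinP; exact: measurable_funX.
  - by move=> x _; rewrite lee_fin exprn_even_ge0.
  - by rewrite lee_fin invr_ge0 ltW.
  have := X4 i (w i) _ (w0 i); rewrite lerDl invr_ge0 => /(_ (ler0n _ _)) h.
  have wV : (0 <= (w i)^-1%:E)%E by rewrite lee_fin invr_ge0 ltW.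
  apply: (le_trans (lee_wpmul2r wV h)).
  by rewrite -EFinM lee_fin expr2 mulrA mulfK ?gt_eqF.
rewrite intS.
have : (\int[P]_x (S x)%:E <= r%:E + ((4 * C)^-1%:E * (C * (t + 1))%:E +
    (C * (t + 1))%:E * (4 * C)^-1%:E))%E.
  have m1 : measurable_fun [set: T] (fun x => ((4 * C)^-1 * Q x)%:E).
    by apply/measurable_EFinP/measurable_funM => //; exact/measurable_EFinP.
  have m2 : measurable_fun [set: T]
      (fun x => (C * (t + 1) * \1_[set t | (r < N t)%R] x)%:E).
    by apply/measurable_EFinP/measurable_funM => //; exact: measurable_indic.
  have CV : 0 <= (4 * C)^-1 by rewrite invr_ge0 mulr_ge0 ?(ltW C0).
  have Ct : 0 <= C * (t + 1) by rewrite mulr_ge0 ?addr_ge0 ?(ltW C0).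
  have e1 x : (0 <= ((4 * C)^-1 * Q x)%:E)%E by rewrite lee_fin mulr_ge0.
  have e2 x : (0 <= (C * (t + 1) * \1_[set t | (r < N t)%R] x)%:E)%E.
    by rewrite lee_fin mulr_ge0// indicE ler0n.
  apply: (@le_trans _ _ (\int[P]_x (r%:E + (((4 * C)^-1 * Q x)%:E +
      (C * (t + 1) * \1_[set t | (r < N t)%R] x)%:E)))%E).
    apply: ge0_le_integral => //.
    - by move=> x _; rewrite lee_fin.
    - by apply/measurable_EFinP; apply: measurable_sum => i; exact: measurable_funX.
    - by apply: emeasurable_funD => //; exact: emeasurable_funD.
    - by move=> x _; rewrite -!EFinD lee_fin.
  rewrite ge0_integralD//; last 2 first.
  - by move=> x _; rewrite adde_ge0.
  - exact: emeasurable_funD.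
  rewrite integral_cst// [X in (_ * X)%E]probability_setT mule1 leeD2l//.
  rewrite ge0_integralD//.
  apply: leeD.
    under eq_integral do rewrite EFinM.
    rewrite ge0_integralZl//; first exact: lee_wpmul2l.
    by move=> x _; rewrite lee_fin.
  under eq_integral do rewrite EFinM.
  rewrite ge0_integralZl//; last exact/measurable_EFinP/measurable_indic.
  by rewrite integral_indic// setIT lee_wpmul2l// lee_fin.
rewrite intS -!EFinM -!EFinD !lee_fin.
have -> : (4 * C)^-1 * (C * (t + 1)) = (t + 1) / 4 by field; rewrite gt_eqF.
have -> : C * (t + 1) / (4 * C) = (t + 1) / 4 by field; rewrite gt_eqF.
by lra.
Qed.

Lemma normal_gaussian_mgf (R : realType) (s : R) : s != 0 ->
  gaussian_mgf (normal_prob 0 s) (fun x : R => x) (s ^+ 2).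
Proof.
move=> s0; split => // t.
have mE : measurable_fun [set: R] (fun x : R => (expR (t * x))%:E).
  by apply/measurable_EFinP; apply: measurableT_comp => //; exact: measurable_funM.
rewrite (@ge0_integral_density _ _ _ lebesgue_measure (normal_pdf 0 s)) //; last 2 first.
- exact: measurable_normal_pdf.
- by move=> x; exact: normal_pdf_ge0.
(* Completing the square: tilting N(0, s^2) by e^(t x) gives e^(t^2 s^2 / 2) times N(t s^2, s^2). *)
have e x : ((expR (t * x))%:E * (normal_pdf 0 s x)%:E =
    (expR (t ^+ 2 * s ^+ 2 / 2))%:E * (normal_pdf (t * s ^+ 2) s x)%:E)%E.
  rewrite -!EFinM !normal_pdfE//; congr (_%:E).
  rewrite mulrCA [RHS]mulrCA; congr (_ * _); rewrite /normal_fun -!expRD.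
  by congr expR; field.
under eq_integral do rewrite e.
rewrite ge0_integralZl//; last 2 first.
- by apply/measurable_EFinP; exact: measurable_normal_pdf.
- by move=> x _; rewrite lee_fin normal_pdf_ge0.
by rewrite integral_normal_pdf mule1.
Qed.

Section laws.
Context d (T : measurableType d) (R : realType).

Lemma ge0_integral_law (mu : {measure set T -> \bar R})
    (nu : {measure set (measurableTypeR R) -> \bar R}) (X : T -> R)
    (f : R -> \bar R) :
  measurable_fun [set: T] X -> measurable_fun [set: R] f ->
  (forall x, 0 <= f x)%E ->
  (forall B : set (measurableTypeR R), measurable B -> mu (X @^-1` B) = nu B) ->
  (\int[mu]_w f (X w) = \int[nu]_x f x)%E.
Proof.
move=> mX mf f0 h.
pose mXm := isMeasurableFun.Build _ _ T (measurableTypeR R) X mX.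
pose X' : {mfun T >-> measurableTypeR R} := HB.pack X mXm.
transitivity (\int[pushforward mu X']_x f x)%E.
  by rewrite (@ge0_integral_pushforward _ _ _ (measurableTypeR R) _ X').
by apply: (@eq_measure_integral _ _ _ _ nu) => B mB _; exact: h.
Qed.

Lemma centered_gaussian_mgf (P : probability T R) (X : T -> R) :
  measurable_fun [set: T] X ->
  is_centered_normal (fun B => P (X @^-1` B)) ->
  exists s : R, gaussian_mgf P X (s ^+ 2) /\
    forall B : set R, measurable B -> P (X @^-1` B) = centered_normal s B.
Proof.
move=> mX [s hs]; exists s; split => //; split => // t.
have mE : measurable_fun [set: R] (fun x : R => (expR (t * x))%:E).
  by apply/measurable_EFinP; apply: measurableT_comp => //; exact: measurable_funM.
have E0 (x : R) : (0 <= (expR (t * x))%:E)%E by rewrite lee_fin expR_ge0.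
have [s0|s0] := eqVneq s 0.
  rewrite (@ge0_integral_law P (\d_(0%R : measurableTypeR R)) X _ mX mE E0) => [|B mB].
    by rewrite integral_dirac// diracT mul1e mulr0 expR0 s0 expr0n/= mulr0 mul0r expR0.
  by apply: (etrans (hs B mB)); rewrite /centered_normal s0 eqxx.
rewrite (@ge0_integral_law P (normal_prob 0 s) X _ mX mE E0) => [|B mB].
  by have [_ ->] := normal_gaussian_mgf s0.
by apply: (etrans (hs B mB)); rewrite /centered_normal (negbTE s0).
Qed.

(** Rational arguments only: for the posterior each identity costs a null set, and countably many of
    these can be discarded together. *)
Lemma gaussian_law (mu : {measure set T -> \bar R}) (X : T -> R) (s : R) :
  s != 0 -> measurable_fun [set: T] X ->
  (forall q : rat, (\int[mu]_w (expR (ratr q * X w))%:E =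
    (expR (ratr q ^+ 2 * s ^+ 2 / 2))%:E)%E) ->
  forall B, measurable B -> mu (X @^-1` B) = normal_prob 0 s B.
Proof.
move=> s0 mX hX B mB.
pose mXm := isMeasurableFun.Build _ _ T (measurableTypeR R) X mX.
pose X' : {mfun T >-> measurableTypeR R} := HB.pack X mXm.
pose Y := [set Z : R -> R | exists q : rat, Z = (fun x => ratr q * x)].
have mq (q : rat) : measurable_fun [set: R] (fun x : R => (expR (ratr q * x))%:E).
  by apply/measurable_EFinP; apply: measurableT_comp => //; exact: measurable_funM.
rewrite -[LHS]/(pushforward mu X' B); move: B mB.
apply: (@laplace_measure_unique _ (measurableTypeR R) R (pushforward mu X') (normal_prob 0 s) Y) => //.
- by move=> _ [q ->]; exact: measurable_funM.
- by exists 0; apply/funext => x; rewrite raddf0 mul0r.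
- move=> _ _ [q ->] [r ->]; exists (q + r); apply/funext => x /=.
  by rewrite raddfD mulrDl.
- by move=> _ [q ->]; exists (- q); apply/funext => x /=; rewrite raddfN mulNr.
- move=> _ n [q ->]; exists (q / n.+1%:R); apply/funext => x /=.
  by rewrite fmorph_div/= ratr_nat mulrAC.
- move=> _ [q ->].
  have iN := gaussian_mgf_integrable (normal_gaussian_mgf s0) (ratr q).
  have e : (\int[pushforward mu X']_x (expR (ratr q * x))%:E =
      (expR (ratr q ^+ 2 * s ^+ 2 / 2))%:E)%E.
    have E0 (x : R) : (0 <= (expR (ratr q * x))%:E)%E by rewrite lee_fin expR_ge0.
    by rewrite -(@ge0_integral_law mu _ X _ mX (mq q) E0).
  split => //; last by rewrite e; have [_ ->] := normal_gaussian_mgf s0.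
  apply/integrableP; split; first exact: mq.
  under eq_integral do rewrite gee0_abs ?lee_fin ?expR_ge0//.
  by rewrite e ltry.
- rewrite RGenOInfty.measurableE; apply: sub_smallest2r => //.
  move=> _ [x ->]; exists (fun y => ratr 1 * y), x; split; first by exists 1.
  by apply/seteqP; split => y /=; rewrite in_itv/= andbT rmorph1 mul1r.
Qed.

End laws.

Lemma normal_prob_scale (R : realType) (s : R) B : s != 0 -> measurable B ->
  normal_prob 0 s B = normal_prob 0 1 [set x | B (s * x)].
Proof.
move=> s0 mB; rewrite -(@gaussian_law _ _ R (normal_prob 0 1) (fun x => s * x) s)//.
  exact: measurable_funM.
move=> q; have [_ h] := @normal_gaussian_mgf R 1 (oner_neq0 _).
under eq_integral do rewrite mulrA.
by rewrite h; congr (expR _)%:E; ring.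
Qed.

Lemma normal_prob_itv_le (R : realType) (x y : R) : x <= y ->
  (normal_prob 0 1 `[x, y] <= (normal_peak 1 * (y - x))%:E)%E.
Proof.
move=> xy; apply: (@le_trans _ _ (\int[lebesgue_measure]_(z in `[x, y]) (normal_peak 1)%:E)%E).
  apply: ge0_le_integral => //.
  - by move=> z _; rewrite lee_fin normal_pdf_ge0.
  - by apply/measurable_EFinP; apply: measurable_funTS; exact: measurable_normal_pdf.
  - by move=> z _; rewrite lee_fin normal_pdf_ub// oner_neq0.
rewrite integral_cst//= lebesgue_measure_itv/= lte_fin; case: ifP => [_|/negbT].
  by rewrite -EFinB -EFinM.
by rewrite mule0 lee_fin mulr_ge0 ?normal_peak_ge0// subr_ge0.
Qed.

Lemma normal_prob_itv_gt0 (R : realType) (x y : R) : x < y ->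
  (0 < normal_prob 0 1 `]x, y])%E.
Proof.
move=> xy; pose m := Num.max `|x| `|y|; pose c := normal_peak 1 * expR (- m ^+ 2 / 2).
have n1 : (1 : R) != 0 by exact: oner_neq0.
have c0 : 0 < c by rewrite mulr_gt0 ?expR_gt0// normal_peak_gt0.
apply: (@lt_le_trans _ _ (\int[lebesgue_measure]_(z in `]x, y]) c%:E)%E).
  rewrite integral_cst//= lebesgue_measure_itv/= lte_fin xy -EFinB -EFinM lte_fin.
  by rewrite mulr_gt0// subr_gt0.
apply: ge0_le_integral => //.
- by move=> z _; rewrite lee_fin ltW.
- by apply/measurable_EFinP; apply: measurable_funTS; exact: measurable_normal_pdf.
- move=> z /=; rewrite in_itv/= => /andP[xz zy].
  rewrite lee_fin normal_pdfE// /c ler_wpM2l ?normal_peak_ge0// /normal_fun ler_expR.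
  rewrite subr0 expr1n ler_wpM2r ?invr_ge0// lerN2 -(real_normK (num_real z)).
  have m0 : 0 <= m by rewrite le_max normr_ge0.
  rewrite ler_pXn2r ?nnegrE// ler_norml.
  have := ler_norm y; have := ler_norm (- x); rewrite normrN => hx hy.
  have hx' : `|x| <= m by rewrite le_max lexx.
  have hy' : `|y| <= m by rewrite le_max lexx orbT.
  by apply/andP; split; lra.
Qed.

(** * Symmetric intervals under the normal law *)

Section normal_interval.
Context {R : realType}.
Implicit Types (s t z : R).

Let G z := fine (normal_prob (0 : R) 1 `[- z, z]).

Let GE z : normal_prob (0 : R) 1 `[- z, z] = (G z)%:E.
Proof. by rewrite fineK// fin_num_measure. Qed.

Let G_mono z z' : z <= z' -> G z <= G z'.
Proof.
move=> zz'; rewrite -lee_fin -!GE; apply: le_measure; rewrite ?inE//.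
by move=> x /=; rewrite !in_itv/=; lra.
Qed.

Let G_strict z z' : 0 <= z -> z < z' -> G z < G z'.
Proof.
move=> z0 zz'; rewrite -lte_fin -!GE.
apply: (@lt_le_trans _ _ (normal_prob (0 : R) 1 `[(- z)%R, z] + normal_prob (0 : R) 1 `]z, z'])%E).
  by rewrite lteDl ?normal_prob_itv_gt0// fin_num_measure.
rewrite -measureU//.
  apply: le_measure; rewrite ?inE//; first exact: measurableU.
  by move=> x /= []; rewrite !in_itv/=; lra.
by apply/seteqP; split => x //= []; rewrite !in_itv/=; lra.
Qed.

Let G_lip z t : 0 <= t -> G (z + t) <= G (z - t) + 4 * normal_peak 1 * t.
Proof.
move=> t0; rewrite -lee_fin EFinD -!GE.
have h x : (normal_prob (0 : R) 1 `[(x - t)%R, (x + t)%R] <= (2 * normal_peak 1 * t)%:E)%E.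
  apply: le_trans (normal_prob_itv_le _) _; first by lra.
  by rewrite lee_fin le_eqVlt; apply/orP; left; apply/eqP; ring.
apply: (@le_trans _ _ (normal_prob (0 : R) 1 `[(- (z - t))%R, (z - t)%R] +
   (normal_prob (0 : R) 1 `[(- z - t)%R, (- z + t)%R] +
    normal_prob (0 : R) 1 `[(z - t)%R, (z + t)%R]))%E); last first.
  rewrite leeD2l// (_ : 4 * _ * t = 2 * normal_peak 1 * t + 2 * normal_peak 1 * t); last ring.
  by rewrite EFinD leeD.
apply: (@le_trans _ _ (normal_prob (0 : R) 1 (`[- (z - t), (z - t)] `|`
   (`[(- z - t)%R, (- z + t)%R] `|` `[(z - t)%R, (z + t)%R])))).
  apply: le_measure; rewrite ?inE//; first by do 2 apply: measurableU => //.
  move=> x /=; rewrite !in_itv/= => xz.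
  have [|x1] := leP x (- z + t); first by right; left; lra.
  have [|x2] := leP (z - t) x; first by right; right; lra.
  by left; lra.
apply: (le_trans (measureU2 _ _ _)) => //; first exact: measurableU.
by rewrite leeD2l// measureU2.
Qed.

Lemma PhiE s z : 0 < s -> Phi s (s * z) = fine (normal_prob (0 : R) 1 `[- z, z]).
Proof.
move=> s0; have sn0 : s != 0 by rewrite gt_eqF.
have e : [set x | `[- (s * z), s * z]%classic (s * x)] = `[- z, z]%classic.
  by apply/seteqP; split => x /=; rewrite !in_itv/= -mulrN !ler_pM2l.
by rewrite /Phi /centered_normal (negbTE sn0) (normal_prob_scale sn0)// e.
Qed.

(** After scaling, both sides are the u-quantile of |Z| for a standard normal Z, which is unique by
    strict monotonicity. The sign of r is deduced: a negative r gives an empty interval, of mass 0 <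
    u. The witness r / s * s' shows that the [xget] in [Phi_inv] does not return its default. *)
Lemma Phi_inv_unique s s' r u : 0 < s -> 0 < s' -> 0 < u ->
  Phi s r = u -> r / s = Phi_inv s' u / s'.
Proof.
move=> s0 s'0 u0 ru.
have E t (k : R) : 0 < k -> Phi k t = G (t / k).
  move=> k0; rewrite /G -(PhiE _ k0); congr (Phi k _).
    by rewrite mulrC divfK// gt_eqF.
have r0 : 0 <= r.
  rewrite leNgt; apply/negP => r0; move: ru; rewrite /Phi.
  rewrite set_itv_ge ?bnd_simp; last by rewrite -ltNge; lra.
  rewrite /centered_normal gt_eqF// measure0 => u0'.
  by move: u0; rewrite -u0' ltxx.
have ex : [set t | 0 <= t /\ Phi s' t = u] (r / s * s').
  split; first by rewrite mulr_ge0 ?divr_ge0 ?(ltW s0) ?(ltW s'0).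
  by rewrite E// mulfK ?gt_eqF// -E.
have [t0 tu] : [set t | 0 <= t /\ Phi s' t = u] (Phi_inv s' u).
  exact: xgetPex (ex_intro _ _ ex).
have : G (r / s) = G (Phi_inv s' u / s').
  by apply: etrans (esym (E r s s0)) _; rewrite ru -[LHS]tu; exact: E.
have a0 : 0 <= r / s by rewrite divr_ge0 ?(ltW s0).
have b0 : 0 <= Phi_inv s' u / s' by rewrite divr_ge0 ?(ltW s'0).
move: a0 b0; case: (ltgtP (r / s) (Phi_inv s' u / s')) => // lt a0 b0 GG.
- by have := G_strict a0 lt; rewrite GG ltxx.
- by have := G_strict b0 lt; rewrite GG ltxx.
Qed.

Lemma normal_interval_cvg (F : set_system R) (FF : Filter F) (b t r : R -> R) z :
  (\forall e \near F, 0 < t e) -> b e / t e @[e --> F] --> 0 ->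
  r e / t e @[e --> F] --> z ->
  normal_prob (0 : R) 1 [set x | `|b e + t e * x| <= r e] @[e --> F] -->
  normal_prob (0 : R) 1 `[- z, z].
Proof.
move=> t0 b0 rz; rewrite GE.
have mB e : measurable [set x | `|b e + t e * x| <= r e].
  have mf : measurable_fun [set: R] (fun x : R => `|b e + t e * x|).
    apply: measurableT_comp => //; apply: measurable_funD; first exact: measurable_cst.
    apply: measurable_funM => //; exact: measurable_cst.
  have := mf measurableT _ (measurable_itv `]-oo, r e]); rewrite setTI.
  by congr measurable; apply/seteqP; split => x /=; rewrite in_itv.
apply/fine_cvgP; split; first by near=> e; apply: fin_num_measure; exact: mB.
apply/cvgrPdist_le => eta eta0 /=.
have p0 : 0 < normal_peak (1 : R) by rewrite normal_peak_gt0// oner_neq0.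
(* By [G_lip], G (z + h) - G (z - h) <= eta; the centre and the radius may each deviate by h / 2. *)
pose h := eta / (4 * normal_peak 1).
have h0 : 0 < h by rewrite divr_gt0// mulr_gt0.
have h2 : 0 < h / 2 by rewrite divr_gt0.
have hE : 4 * normal_peak 1 * h = eta by rewrite /h mulrC divfK// gt_eqF// mulr_gt0.
near=> e.
have te : 0 < t e by near: e.
have be : `|b e / t e| <= h / 2.
  rewrite -normrN -sub0r; near: e.
  by move/cvgrPdist_le : b0; exact.
have re : `|z - r e / t e| <= h / 2.
  by near: e; move/cvgrPdist_le : rz; exact.
have fE (X : set R) : measurable X -> (fine (normal_prob (0 : R) 1 X))%:E = normal_prob (0 : R) 1 X.
  by move=> mX; rewrite fineK// fin_num_measure.
have key x : (`|b e + t e * x| <= r e) = (`|b e / t e + x| <= r e / t e).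
  have -> : b e + t e * x = (b e / t e + x) * t e.
    by rewrite mulrDl divfK ?gt_eqF// [x * _]mulrC.
  by rewrite normrM (gtr0_norm te) ler_pdivlMr.
set g := fine _.
have lo : G (z - h) <= g.
  rewrite -lee_fin !fE//; apply: le_measure; rewrite ?inE//; first exact: mB.
  move=> x /=; rewrite in_itv/= key; move: be re.
  rewrite !ler_norml; move: (b e / t e) (r e / t e) => u v; lra.
have hi : g <= G (z + h).
  rewrite -lee_fin !fE//; apply: le_measure; rewrite ?inE//; first exact: mB.
  move=> x /=; rewrite in_itv/= key; move: be re.
  rewrite !ler_norml; move: (b e / t e) (r e / t e) => u v; lra.
have a1 := G_mono (_ : z - h <= z) ; have a2 := G_mono (_ : z <= z + h).
have := G_lip z (ltW h0); rewrite hE => l.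
have {}a1 : G (z - h) <= G z by apply: a1; rewrite gerBl ltW.
have {}a2 : G z <= G (z + h) by apply: a2; rewrite lerDl ltW.
rewrite ler_norml; move: g lo hi a1 a2 l => g.
by move: (G z) (G (z - h)) (G (z + h)) => x y u; clear; move=> *; apply/andP; split; lra.
Unshelve. all: by end_near. Qed.

End normal_interval.

(** * Gaussian measures on Hilbert spaces *)

Lemma continuous_borel_measurable (R : realType) (U : ptopologicalType)
    (f : U -> R) : continuous f -> measurable_fun [set: borel U] f.
Proof.
move=> cf; apply: (measurability _ (RGenOInfty.measurableE R)) => _ [_ [x ->] <-].
rewrite setTI; apply: sub_sigma_algebra.
by move/continuousP : cf; apply; exact: rray_open.
Qed.

Lemma continuous_borel_borel (U W : ptopologicalType) (f : U -> W) :
  continuous f -> @measurable_fun _ _ (borel U) (borel W) setT f.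
Proof.
move=> cf; apply: (@measurability _ _ (borel U) (borel W) setT f (@open W)) => // _ [A oA <-].
by rewrite setTI; apply: sub_sigma_algebra; move/continuousP : cf; exact.
Qed.

(** A closed ball is the intersection of the half-spaces that contain it with normals in a dense
    sequence, and an open set is a countable union of closed balls centred on that sequence. *)
Lemma borel_half_spaces (R : realType) (V : hilbertType R) : separable V ->
  (@measurable _ (borel V)) `<=` <<s [set A | exists (X : V -> R) b,
    (exists z, X = fun f => inner f z) /\ A = [set t | b < X t]] >>.
Proof.
move=> sV; set G := (X in <<s X >>).
have [z zP] := separable_dense_seq sV.
have sG : sigma_algebra [set: V] <<s G >> by exact: smallest_sigma_algebra.
have GI (F : nat -> set V) : (forall n, <<s G >> (F n)) -> <<s G >> (\bigcap_n F n).
  by move=> GF; exact: (@bigcapT_measurable _ (g_sigma_algebraType G)).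
have GU (F : nat -> set V) : (forall n, <<s G >> (F n)) -> <<s G >> (\bigcup_n F n).
  by move=> GF; exact: (@bigcupT_measurable _ (g_sigma_algebraType G)).
have ballE x r : 0 <= r -> [set f : V | `|f - x| <= r] =
    \bigcap_k ~` [set f | r * `|z k| + inner x (z k) < inner f (z k)].
  move=> r0; apply/seteqP; split => [f /= fx k _ /=|f /= h].
    apply/negP; rewrite -leNgt -lerBlDr -innerBl.
    apply: (le_trans (ler_norm _)); apply: (le_trans (normr_inner_le _ _)).
    by rewrite ler_wpM2r.
  rewrite leNgt; apply/negP => rf; pose y := f - x.
  have y0 : 0 < `|y| by exact: le_lt_trans rf.
  (* Chosen so that |y|^2 - |y| e, a lower bound of <y, z k>, exceeds r (|y| + e), an upper bound of
     r |z k|: the difference is e (|y| + r). *)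
  pose e := `|y| * (`|y| - r) / (2 * (`|y| + r)).
  have yr : 0 < `|y| + r by rewrite ltr_wpDr.
  have e0 : 0 < e by rewrite divr_gt0 ?mulr_gt0// subr_gt0.
  have [k zk] := zP y e e0.
  apply: (h k I) => /=; rewrite -ltrBrDr -innerBl -/y.
  have -> : inner y (z k) = `|y| ^+ 2 - inner y (y - z k).
    by rewrite innerBr inner_norm opprB addrC subrK.
  have h1 : inner y (y - z k) <= `|y| * e.
    apply: (le_trans (ler_norm _)); apply: (le_trans (normr_inner_le _ _)).
    by rewrite ler_wpM2l// ltW.
  have h2 : `|z k| <= `|y| + e.
    have -> : z k = y - (y - z k) by rewrite opprB addrC subrK.
    by apply: (le_trans (ler_normB _ _)); rewrite lerD2l ltW.
  have h3 : r * `|z k| <= r * (`|y| + e) by rewrite ler_wpM2l.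
  have eE : e * (2 * (`|y| + r)) = `|y| * (`|y| - r).
    by rewrite /e divfK// gt_eqF// mulr_gt0.
  have h4 : 0 < e * (`|y| + r) by rewrite mulr_gt0.
  have aux (a b n t : R) : a <= n * t -> r * b <= r * (n + t) ->
    t * (2 * (n + r)) = n * (n - r) -> 0 < t * (n + r) -> r * b < n ^+ 2 - a.
    by clear; move=> *; nra.
  exact: aux h1 h3 eE h4.
have Gball x r : 0 <= r -> <<s G >> [set f : V | `|f - x| <= r].
  move=> r0; rewrite ballE//; apply: GI => k.
  have [_ GC _] := sG; rewrite -setTD; apply: GC; apply: sub_sigma_algebra.
  by exists (fun f => inner f (z k)), (r * `|z k| + inner x (z k)); split => //; exists (z k).
apply: smallest_sub => // U oU.
pose B n m := [set f : V | `|f - z n| <= m.+1%:R^-1].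
pose A n m := if `[< B n m `<=` U >] then B n m else set0.
have -> : U = \bigcup_n \bigcup_m A n m.
  apply/seteqP; split => [f Uf|f [n _ [m _]]]; last first.
    by rewrite /A; case: asboolP => // h /h.
  have /nbhs_ballP[e /= e0 fe] : nbhs f U by exact: open_nbhs_nbhs.
  have [m me] : exists m, m.+1%:R^-1 < e / 2.
    have : \forall m \near \oo, harmonic m < e / 2.
      have /cvgrPdist_lt/(_ (e / 2)) := @cvg_harmonic R.
      rewrite divr_gt0// => /(_ isT); apply: filterS => n.
      by rewrite sub0r normrN ger0_norm ?harmonic_ge0.
    by move=> [m _ /(_ m (leqnn m))] h; exists m.
  have m0 : (0 : R) < m.+1%:R^-1 by rewrite invr_gt0.
  have [n fn] := zP f _ m0.
  exists n => //; exists m => //; rewrite /A asboolT; first by rewrite /B/= ltW.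
  move=> g /= gB; apply: fe; rewrite -ball_normE/=.
  have -> : f - g = (f - z n) - (g - z n) by rewrite opprB addrA subrK.
  apply: (le_lt_trans (ler_normB _ _)).
  by rewrite [ltRHS]splitr ltrD ?(lt_trans fn)// (le_lt_trans gB).
apply: (GU) => n; apply: (GU) => m; rewrite /A; case: asboolP => _.
  by apply: Gball; rewrite invr_ge0.
by have [] := sG.
Qed.

Definition covariance_form (R : realType) (V : hilbertType R)
    (Pi : probability (borel V) R) (x y : V) : R :=
  fine (\int[Pi]_f (inner f x * inner f y)%:E)%E.

Section gaussian_measure.
Context (R : realType) (V : hilbertType R) (Pi : probability (borel V) R).
Hypothesis sepV : separable V.
Hypothesis Pi_gauss : centered_gaussian Pi.
Let cov := covariance_form Pi.

Lemma measurable_inner (x : V) : measurable_fun [set: borel V] (fun f : V => inner f x).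
Proof. by apply: continuous_borel_measurable; exact: inner_continuous. Qed.

Lemma measurable_norm_borel : measurable_fun [set: borel V] (fun f : V => `|f|).
Proof. by apply: continuous_borel_measurable; exact: norm_continuous. Qed.

Lemma gaussian_inner (x : V) : gaussian_mgf Pi (fun f => inner f x) (cov x x).
Proof.
have [s [gs _]] := centered_gaussian_mgf (measurable_inner x) (Pi_gauss x).
suff -> : cov x x = s ^+ 2 by [].
have [_ e] := gaussian_variance gs; rewrite /cov /covariance_form.
by under eq_integral do rewrite -expr2; rewrite e.
Qed.

(** The second-moment case of Fernique's theorem. By Bessel, the partial sums of squared coordinates
    stay below the finite variable |f|^2, so [gaussian_square_le] bounds their expectations
    uniformly; Parseval and monotone convergence conclude. *)
Lemma gaussian_norm_square : Pi.-integrable setT (fun f : V => (`|f| ^+ 2)%:E).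
Proof.
have [z zP] := separable_dense_seq sepV.
pose X i (f : V) := inner f (gram_schmidt z i).
have mN : measurable_fun [set: borel V] (fun f : V => `|f| ^+ 2).
  by apply: measurable_funX; exact: measurable_norm_borel.
have [K hK] := @gaussian_square_le _ _ _ Pi X _ _
  (fun i => gaussian_inner (gram_schmidt z i)) mN (fun n f => bessel_le z n f).
apply/integrableP; split; first exact/measurable_EFinP.
apply: (@le_lt_trans _ _ K%:E); last by rewrite ltry.
pose S n (f : V) : \bar R := (\sum_(i < n) X i f ^+ 2)%:E.
have -> : (\int[Pi]_f `|(`|f| ^+ 2)%:E| = \int[Pi]_f limn (S ^~ f))%E.
  apply: eq_integral => f _; rewrite gee0_abs ?lee_fin ?sqr_ge0//.
  apply/esym/cvg_lim => //; apply: cvg_EFin; first exact: nearW.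
  by apply: parseval_cvg => e; exact: zP.
rewrite monotone_convergence//.
- apply: lime_le; last by near=> n; exact: hK.
  apply: ereal_nondecreasing_is_cvgn => m n mn; apply: ge0_le_integral => //.
  + by move=> f _; rewrite lee_fin sumr_ge0// => i _; exact: sqr_ge0.
  + apply/measurable_EFinP; apply: measurable_sum => i.
    by apply: measurable_funX; exact: measurable_inner.
  + apply/measurable_EFinP; apply: measurable_sum => i.
    by apply: measurable_funX; exact: measurable_inner.
  + move=> f _; rewrite lee_fin -!(big_mkord xpredT (fun i => X i f ^+ 2)).
    by rewrite (big_cat_nat _ mn)//= lerDl sumr_ge0// => i _; exact: sqr_ge0.
- move=> n; apply/measurable_EFinP; apply: measurable_sum => i.
  by apply: measurable_funX; exact: measurable_inner.
- by move=> n f _; rewrite lee_fin sumr_ge0// => i _; exact: sqr_ge0.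
- move=> f _ m n mn; rewrite lee_fin -!(big_mkord xpredT (fun i => X i f ^+ 2)).
  by rewrite (big_cat_nat _ mn)//= lerDl sumr_ge0// => i _; exact: sqr_ge0.
Unshelve. all: by end_near. Qed.

Let K := fine (\int[Pi]_f (`|f : V| ^+ 2)%:E).

Lemma integrable_inner_mul (x y : V) :
  Pi.-integrable setT (fun f : V => (inner f x * inner f y)%:E).
Proof.
have := integrableZl measurableT (`|x| * `|y|) gaussian_norm_square.
apply: le_integrable => //.
  by apply/measurable_EFinP; apply: measurable_funM; exact: measurable_inner.
move=> f _; rewrite -EFinM lee_fin [leLHS]normrM [leRHS]ger0_norm ?mulr_ge0 ?sqr_ge0//.
have -> : `|x| * `|y| * `|f| ^+ 2 = (`|f| * `|x|) * (`|f| * `|y|) by ring.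
by apply: ler_pM => //; exact: normr_inner_le.
Qed.

Lemma covE (x y : V) : (\int[Pi]_f (inner f x * inner f y)%:E = (cov x y)%:E)%E.
Proof. by rewrite fineK//; apply: integrable_fin_num => //; exact: integrable_inner_mul. Qed.

Lemma covC x y : cov x y = cov y x.
Proof. by congr fine; apply: eq_integral => f _; rewrite mulrC. Qed.

Lemma covDl x y z : cov (x + y) z = cov x z + cov y z.
Proof.
apply: EFin_inj; rewrite EFinD -!covE -integralD_EFin//; first last.
- exact: integrable_inner_mul.
- exact: integrable_inner_mul.
by apply: eq_integral => f _; rewrite innerDr mulrDl.
Qed.

Lemma covZl (a : R) x y : cov (a *: x) y = a * cov x y.
Proof.
apply: EFin_inj; rewrite EFinM -!covE -integralZl//; last exact: integrable_inner_mul.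
by apply: eq_integral => f _; rewrite innerZr -mulrA.
Qed.

Lemma cov_ge0 x : 0 <= cov x x.
Proof.
by rewrite -lee_fin -covE; apply: integral_ge0 => f _; rewrite lee_fin -expr2 sqr_ge0.
Qed.

Lemma cov_le : exists2 C : R, 0 <= C & forall x y, `|cov x y| <= C * `|x| * `|y|.
Proof.
pose C := fine (\int[Pi]_f (`|f : V| ^+ 2)%:E).
exists C; first by rewrite fine_ge0// integral_ge0// => f _; rewrite lee_fin sqr_ge0.
move=> x y; rewrite -lee_fin -abse_EFin -covE.
apply: (le_trans (le_abse_integral _ _ _)) => //.
  exact: (measurable_int _ (integrable_inner_mul x y)).
have CE : (\int[Pi]_f (`|f : V| ^+ 2)%:E = C%:E)%E.
  by rewrite fineK//; apply: integrable_fin_num => //; exact: gaussian_norm_square.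
have -> : (C * `|x| * `|y|)%:E = ((`|x| * `|y|)%:E * C%:E)%E by rewrite -EFinM; congr _%:E; ring.
rewrite -CE -integralZl//; last exact: gaussian_norm_square.
apply: ge0_le_integral => //.
- by apply: measurableT_comp => //; exact: (measurable_int _ (integrable_inner_mul x y)).
- apply: (measurable_int Pi); apply: integrableZl => //; exact: gaussian_norm_square.
- move=> f _; rewrite -EFinM lee_fin normrM.
  have -> : `|x| * `|y| * `|f| ^+ 2 = (`|f| * `|x|) * (`|f| * `|y|) by ring.
  by apply: ler_pM => //; exact: normr_inner_le.
Qed.

Lemma covariance_operator x : exists k : V, forall z, inner k z = cov x z.
Proof.
have [C C0 hC] := cov_le.
apply: (@riesz_representation _ _ _ (C * `|x|)).
- by move=> y z; rewrite !(covC x) covDl.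
- by move=> t y; rewrite !(covC x) covZl.
- exact: hC.
Qed.

(** The shifted prior and the prior with density exp(<f, x> - cov x x / 2) have the same Laplace
    transform, z |-> exp(cov x z + cov z z / 2), and half-spaces generate the Borel sets. *)
Theorem cameron_martin (x k : V) (F : borel V -> \bar R) :
  (forall z, inner k z = cov x z) ->
  measurable_fun [set: borel V] F -> (forall f, 0 <= F f)%E ->
  (\int[Pi]_f F (f + k)%R =
   \int[Pi]_f (F f * (expR (inner f x - cov x x / 2))%:E))%E.
Proof.
move=> kx mF F0.
have mshift : @measurable_fun _ _ (borel V) (borel V) setT (fun f => f + k).
  apply: continuous_borel_borel => f; apply: cvgD; first exact: cvg_id.
  exact: cvg_cst.
pose mSm := isMeasurableFun.Build _ _ (borel V) (borel V) (fun f => f + k) mshift.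
pose S : {mfun (borel V) >-> (borel V)} := HB.pack (fun f : borel V => f + k) mSm.
pose p (f : V) := expR (inner f x - cov x x / 2).
have mp : measurable_fun [set: borel V] p.
  apply: measurableT_comp => //; apply: measurable_funB => //.
  exact: measurable_inner.
have p0 f : 0 <= p f by exact: expR_ge0.
have [nu nuE] := density_measure Pi mp p0.
have expE z : (\int[Pi]_f (expR (inner f z))%:E = (expR (cov z z / 2))%:E)%E.
  have [_ /(_ 1)] := gaussian_inner z; rewrite expr1n mul1r => <-.
  by apply: eq_integral => f _; rewrite mul1r.
have expI z : Pi.-integrable setT (fun f : V => (expR (inner f z))%:E).
  by move: (gaussian_mgf_integrable (gaussian_inner z) 1); apply: eq_integrable => // f _;
    rewrite mul1r.
have mexp z : measurable_fun [set: borel V] (fun f : V => (expR (inner f z))%:E).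
  by apply/measurable_EFinP; apply: measurableT_comp => //; exact: measurable_inner.
pose Y := [set X : V -> R | exists z, X = fun f => inner f z].
have unique : forall B, measurable B -> pushforward Pi S B = nu B.
  apply: (@laplace_measure_unique _ (borel V) R (pushforward Pi S) nu Y).
  - by move=> _ [z ->]; exact: measurable_inner.
  - by exists 0; apply/funext => f; rewrite inner0r.
  - by move=> _ _ [y ->] [z ->]; exists (y + z); apply/funext => f; rewrite innerDr.
  - by move=> _ [y ->]; exists (- y); apply/funext => f; rewrite /= innerNr.
  - move=> _ n [y ->]; exists (n.+1%:R^-1 *: y); apply/funext => f.
    by rewrite innerZr mulrC.
  - move=> _ [z ->].
    have e1 : (\int[pushforward Pi S]_f (expR (inner f z))%:E =
        (expR (cov x z + cov z z / 2))%:E)%E.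
      transitivity (\int[Pi]_f (expR (inner (f + k) z))%:E)%E.
        by rewrite (@ge0_integral_pushforward _ _ _ (borel V) _ S).
      under eq_integral do rewrite innerDl kx addrC expRD EFinM.
      by rewrite ge0_integralZl// expE expRD EFinM.
    have e2 : (\int[nu]_f (expR (inner f z))%:E = (expR (cov x z + cov z z / 2))%:E)%E.
      rewrite (ge0_integral_density mp p0 (fun B _ => nuE B))//.
      under eq_integral => f _.
        rewrite -EFinM /p -expRD addrA -innerDr expRD EFinM muleC.
        over.
      rewrite /= ge0_integralZl//.
      rewrite expE -EFinM -expRD covDl !(covC _ (z + x)) !covDl; congr (expR _)%:E.
      by rewrite (covC z x); field.
    split; last by rewrite e1 e2.
    + apply/integrableP; split => //.
      under eq_integral do rewrite gee0_abs ?lee_fin ?expR_ge0//.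
      by rewrite e1 ltry.
    + apply/integrableP; split => //.
      under eq_integral do rewrite gee0_abs ?lee_fin ?expR_ge0//.
      by rewrite e2 ltry.
  - exact: borel_half_spaces.
rewrite -(ge0_integral_density mp p0 (fun B _ => nuE B))//.
transitivity (\int[pushforward Pi S]_f F f)%E.
  by rewrite (@ge0_integral_pushforward _ _ _ (borel V) _ S).
by apply: eq_measure_integral => B mB _; exact: unique.
Qed.

End gaussian_measure.

Lemma quadratic_discriminant_le (R : realFieldType) (a b c : R) :
  (forall t, 0 <= a + t * (2 * c) + t ^+ 2 * b) -> 0 <= b -> c ^+ 2 <= a * b.
Proof.
move=> h b0; have [bz|bn] := eqVneq b 0.
  rewrite bz mulr0; have [->|cn] := eqVneq c 0; first by rewrite expr0n.
  have := h (- (a + 1) / (2 * c)); rewrite bz mulr0 addr0 divfK ?mulf_neq0//.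
  by rewrite opprD addrA subrr sub0r oppr_ge0 ler10.
have bp : 0 < b by rewrite lt_neqAle eq_sym bn.
have := h (- c / b); rewrite -(ler_pM2r bp) mul0r.
have -> : (a + - c / b * (2 * c) + (- c / b) ^+ 2 * b) * b = a * b - c ^+ 2.
  by field.
by rewrite subr_ge0.
Qed.

(** Iterated, this expands the integral of a square term by term while carrying integrability
    along. *)
Lemma integral_add_scale d (T : measurableType d) (R : realType)
    (mu : {measure set T -> \bar R}) (F G : T -> R) (a b r : R) :
  mu.-integrable setT (fun w => (F w)%:E) -> (\int[mu]_w (F w)%:E = a%:E)%E ->
  mu.-integrable setT (fun w => (G w)%:E) -> (\int[mu]_w (G w)%:E = b%:E)%E ->
  mu.-integrable setT (fun w => (F w + r * G w)%:E) /\
  (\int[mu]_w (F w + r * G w)%:E = (a + r * b)%:E)%E.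
Proof.
move=> iF eF iG eG.
have irG : mu.-integrable setT (fun w => (r * G w)%:E).
  by have := integrableZl measurableT r iG; exact: eq_integrable.
split; first by have := integrableD measurableT iF irG; exact: eq_integrable.
under eq_integral do rewrite EFinD.
by rewrite integralD_EFin// eF EFinD EFinM -eG -integralZl.
Qed.

(** * The RKHS inequality and the almost sure linearity of white noise *)

Section rkhs_and_noise.
Context (R : realType) (V : hilbertType R) (Pi : probability (borel V) R).
Hypothesis sepV : separable V.
Hypothesis Pi_gauss : centered_gaussian Pi.
Let cov := covariance_form Pi.

Lemma rkhs_norm_ge0 h : 0 <= rkhs_norm Pi h.
Proof. by rewrite fine_ge0// Lnorm_ge0. Qed.

(** Cauchy-Schwarz in L^2(Pi) for a representative xi of h and <., x>. Through this inequality RKHS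
    norms enter the estimates of q and of the bias. *)
Lemma rkhs_inner_le h x : rkhs Pi h ->
  inner h x ^+ 2 <= rkhs_norm Pi h ^+ 2 * cov x x.
Proof.
move=> hh; set xi := xget (fun=> 0) (rkhs_repr Pi h).
have [xiL _ xiE] : rkhs_repr Pi h xi by exact: xgetPex.
have ixi2 := Lfun2_integrable_sqr xiL.
have mxi : measurable_fun [set: borel V] (xi : borel V -> R).
  by move: xiL; rewrite inE => /andP[]; rewrite inE.
have ixx := integrable_inner_mul sepV Pi_gauss x x.
have iX2 : Pi.-integrable setT (fun f : V => (inner f x ^+ 2)%:E).
  by move: ixx; apply: eq_integrable => // f _; rewrite expr2.
have mX := measurable_inner x.
pose a := fine (\int[Pi]_f (xi f ^+ 2)%:E).
have aE : (\int[Pi]_f (xi f ^+ 2)%:E = a%:E)%E.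
  by rewrite fineK//; exact: integrable_fin_num.
have normE : rkhs_norm Pi h ^+ 2 = a.
  rewrite /rkhs_norm -/xi; set n := (X in fine X).
  have n0 : (0 <= n)%E by exact: Lnorm_ge0.
  have nE : (n `^ 2 = a%:E)%E.
    rewrite /n poweR_Lnorm// -aE; apply: eq_integral => f _ /=.
    by rewrite powR_mulrn// real_normK// num_real.
  have nfin : n \is a fin_num.
    by rewrite ge0_fin_numE//; move: nE; case: (n) => [r _|/=|//]; rewrite ?ltry// pnatr_eq0.
  move: nE n0; rewrite -(fineK nfin) /= lee_fin => -[<-] h0.
  by rewrite powR_mulrn.
have ixiX : Pi.-integrable setT (fun f : V => (xi f * inner f x)%:E).
  have : Pi.-integrable setT (fun f : V => (xi f ^+ 2 + inner f x ^+ 2)%:E).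
    by have := integrableD measurableT ixi2 iX2; exact: eq_integrable.
  apply: le_integrable => //.
    by apply/measurable_EFinP; exact: measurable_funM.
  move=> f _ /=; rewrite lee_fin [leRHS]ger0_norm ?addr_ge0 ?sqr_ge0//.
  have := sqr_ge0 (xi f - inner f x); have := sqr_ge0 (xi f + inner f x).
  have := sqr_ge0 (xi f); have := sqr_ge0 (inner f x).
  by rewrite ler_norml !sqrrD sqrrN; move: (xi f) (inner f x) => u v; lra.
rewrite normE; apply: quadratic_discriminant_le; last exact: cov_ge0.
move=> t; rewrite -lee_fin.
have -> : (a + t * (2 * inner h x) + t ^+ 2 * cov x x)%:E =
    (\int[Pi]_f ((xi f + t * inner f x) ^+ 2)%:E)%E.
  have [i1 e1] := integral_add_scale (t * 2) ixi2 aE ixiX (xiE x).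
  have [_ e2] := integral_add_scale (t ^+ 2) i1 e1 ixx (covE sepV Pi_gauss x x).
  rewrite mulrA -e2; apply: eq_integral => f _; congr _%:E; ring.
by apply: integral_ge0 => f _; rewrite lee_fin sqr_ge0.
Qed.

Context d (Omega : measurableType d) (P : probability Omega R).
Variables (W : V -> {RV P >-> R}).
Hypothesis W_noise : white_noise W.

Lemma white_noise_mgf (x : V) : gaussian_mgf P (W x) (`|x| ^+ 2).
Proof.
have [h1 h2] := W_noise.
have mW : measurable_fun [set: Omega] (W x) by [].
have h : is_centered_normal (fun B => P (W x @^-1` B)).
  have := h1 1%N (fun=> x) (fun=> 1); congr is_centered_normal.
  apply/funext => B; congr (P _); apply/seteqP.
  by split => w /=; rewrite big_ord1 mul1r.
have [s [gs _]] := centered_gaussian_mgf mW h.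
suff -> : `|x| ^+ 2 = s ^+ 2 by [].
have [_ e] := gaussian_variance gs.
apply: EFin_inj; rewrite -inner_norm -h2 unlock -e.
by apply: eq_integral => w _; rewrite expr2.
Qed.

(** The covariance turns the second moment of the defect into |z - x - t y|^2 with z = x + t y,
    which is 0. *)
Lemma white_noise_linear (x y : V) (t : R) :
  {ae P, forall w, W (x + t *: y) w = W x w + t * W y w}.
Proof.
have [_ h2] := W_noise.
have iW z : P.-integrable setT (fun w => (W z w ^+ 2)%:E).
  by have [] := gaussian_variance (white_noise_mgf z).
have iWW z z' : P.-integrable setT (fun w => (W z w * W z' w)%:E).
  have : P.-integrable setT (fun w => (W z w ^+ 2 + W z' w ^+ 2)%:E).
    by have := integrableD measurableT (iW z) (iW z'); exact: eq_integrable.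
  apply: le_integrable => //; first by apply/measurable_EFinP; exact: measurable_funM.
  move=> w _ /=; rewrite lee_fin [leRHS]ger0_norm ?addr_ge0 ?sqr_ge0//.
  have := sqr_ge0 (W z w - W z' w); have := sqr_ge0 (W z w + W z' w).
  have := sqr_ge0 (W z w); have := sqr_ge0 (W z' w).
  by rewrite ler_norml !sqrrD sqrrN; move: (W z w) (W z' w) => u v; lra.
have eWW z z' : (\int[P]_w (W z w * W z' w)%:E = (inner z z')%:E)%E.
  by rewrite -h2 unlock.
pose D w := W (x + t *: y) w - W x w - t * W y w.
have mD : measurable_fun [set: Omega] D.
  apply: measurable_funB; first exact: measurable_funB.
  exact: measurable_funM.
have D0 : (\int[P]_w (D w ^+ 2)%:E = 0)%E.
  pose z := x + t *: y.
  have [i1 e1] := integral_add_scale 1 (iWW z z) (eWW _ _) (iWW x x) (eWW _ _).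
  have [i2 e2] := integral_add_scale (t ^+ 2) i1 e1 (iWW y y) (eWW _ _).
  have [i3 e3] := integral_add_scale (- 2) i2 e2 (iWW z x) (eWW _ _).
  have [i4 e4] := integral_add_scale (- (2 * t)) i3 e3 (iWW z y) (eWW _ _).
  have [i5 e5] := integral_add_scale (2 * t) i4 e4 (iWW x y) (eWW _ _).
  rewrite (_ : 0%E = (inner z z + 1 * inner x x + t ^+ 2 * inner y y +
      - 2 * inner z x + - (2 * t) * inner z y + 2 * t * inner x y)%:E).
    by rewrite -e5; apply: eq_integral => w _; congr _%:E; rewrite /D -/z; ring.
  by congr _%:E; rewrite /z !(innerDl, innerDr, innerZl, innerZr) (innerC y x); ring.
have /ae_eq_integral_abs : (\int[P]_w `|(D w ^+ 2)%:E| = 0)%E.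
  rewrite -D0; apply: eq_integral => w _.
  by rewrite gee0_abs// lee_fin sqr_ge0.
have mD2 : measurable_fun [set: Omega] (fun w => (D w ^+ 2)%:E).
  by apply/measurable_EFinP; exact: measurable_funX.
move=> /(_ measurableT mD2); apply: filterS => w /= /(_ I) [] /eqP.
by rewrite sqrf_eq0 /D -addrA -opprD subr_eq0 => /eqP.
Qed.

Lemma white_noise_scale (y : V) (t : R) : {ae P, forall w, W (t *: y) w = t * W y w}.
Proof.
(* The second instance reads W 0 = W 0 + W 0, hence W 0 = 0 almost surely. *)
apply: filterS2 (white_noise_linear 0 y t) (white_noise_linear 0 0 1) => w.
rewrite !add0r scaler0 mul1r => -> /eqP.
by rewrite -subr_eq0 opprD addrA subrr sub0r oppr_eq0 => /eqP ->; rewrite add0r.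
Qed.

End rkhs_and_noise.

(** * Posterior distributions *)

Lemma ae_exists d (T : measurableType d) (R : realType) (P : probability T R)
    (Q : T -> Prop) : {ae P, forall x, Q x} -> exists x, Q x.
Proof.
move=> [B [mB B0 QB]]; apply: contrapT => /forallNP nQ.
have BT : B = setT by apply/seteqP; split => // x _; exact/QB/nQ.
by move: B0; rewrite BT probability_setT => /eqP; rewrite onee_eq0.
Qed.

Section mean.
Context (R : realType) (V : hilbertType R).

Lemma mean_unique (mu : set (borel V) -> \bar R) (m : V) :
  is_mean mu m -> mean mu = m.
Proof.
move=> [i hm]; rewrite /mean; case: xgetP => [m' _ [_ hm']|/(_ m)]; last first.
  by case; split.
apply: inner_inj => x; rewrite innerC (innerC m).
by apply: EFin_inj; rewrite innerC -hm' hm innerC.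
Qed.

Lemma is_mean_ex (mu : {measure set (borel V) -> \bar R}) :
  mu.-integrable [set: borel V] (fun f : V => `|f|%:E) -> exists m, is_mean mu m.
Proof.
move=> i.
have ix (x : V) : mu.-integrable [set: borel V] (fun f : V => (inner f x)%:E).
  have := integrableZr measurableT `|x| i; apply: le_integrable => //.
    by apply/measurable_EFinP; exact: measurable_inner.
  move=> f _; rewrite lee_fin (ger0_norm (mulr_ge0 _ _))//.
  exact: normr_inner_le.
have hE (x : V) : (\int[mu]_f (inner f x)%:E = (fine (\int[mu]_f (inner f x)%:E))%:E)%E.
  by rewrite fineK//; exact: integrable_fin_num.
have [|||m hm] := @riesz_representation _ V (fun x => fine (\int[mu]_f (inner f x)%:E)%E)
  (fine (\int[mu]_(f in [set: borel V]) `|f : V|%:E)%E).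
- move=> x y; apply: EFin_inj; rewrite EFinD -!hE -integralD_EFin//; [|exact: ix..].
  by apply: eq_integral => f _; rewrite innerDr.
- move=> t x; apply: EFin_inj; rewrite EFinM -!hE -integralZl//.
  by apply: eq_integral => f _; rewrite innerZr.
- move=> x; rewrite -lee_fin -abse_EFin -hE EFinM fineK; last exact: integrable_fin_num.
  rewrite -integralZr//; apply: (le_trans (le_abse_integral _ _ _)) => //.
    exact: (measurable_int _ (ix x)).
  apply: ge0_le_integral => //.
  - by apply: measurableT_comp => //; exact: (measurable_int _ (ix x)).
  - by apply: emeasurable_funM => //; exact: (measurable_int _ i).
  - by move=> f _; rewrite lee_fin; exact: normr_inner_le.
- by exists m; split => // x; rewrite hE hm.
Qed.

End mean.

Section posterior_measure.
Context (R : realType) (V V2 : hilbertType R) (A : V -> V2).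
Variables (Pi : probability (borel V) R) (e : R) (M : V2 -> R).
Let l : V -> R := likelihood A e M.
Hypothesis ml : measurable_fun [set: borel V] l.
Let Z := (\int[Pi]_f (l f)%:E)%E.
Let post := posterior A Pi e M.

Let l_ge0 f : 0 <= l f. Proof. exact: expR_ge0. Qed.

Let mlE : measurable_fun [set: borel V] (fun f => (l f)%:E).
Proof. exact/measurable_EFinP. Qed.

Lemma evidence_gt0 : (0 < Z)%E.
Proof.
rewrite lt0e integral_ge0 ?andbT; last by move=> f _; rewrite lee_fin.
apply/eqP => Z0.
have := (@ae_eq_integral_abs _ _ _ Pi _ measurableT _ mlE).1.
under eq_integral do rewrite gee0_abs ?lee_fin ?l_ge0//.
move=> /(_ Z0)/ae_exists[f /(_ I) [] /eqP].
by rewrite gt_eqF// expR_gt0.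
Qed.

(** Since the inverse of +oo is 0, r is the normalising constant in all cases; with infinite
    evidence the posterior is the zero measure. *)
Let r := fine (Z^-1)%E.

Let rE : (r%:E = Z^-1)%E.
Proof.
rewrite /r; have := evidence_gt0; case: Z => [z||]//.
by rewrite lte_fin => z0; rewrite inver gt_eqF.
Qed.

Let r_ge0 : 0 <= r.
Proof. by rewrite -lee_fin rE inve_ge0; exact: ltW evidence_gt0. Qed.

Lemma posterior_measure : exists nu : {measure set (borel V) -> \bar R},
  (nu : set (borel V) -> \bar R) = post /\
  forall B, measurable B -> nu B = (\int[Pi]_(f in B) (r * l f)%:E)%E.
Proof.
have [nu0 nu0E] := density_measure Pi ml l_ge0.
exists (mscale (NngNum r_ge0) nu0); split.
  apply/funext => B; change (r%:E * nu0 B = post B)%E.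
  by rewrite nu0E /post /posterior -/Z -rE muleC.
move=> B mB; change (r%:E * nu0 B = \int[Pi]_(f in B) (r * l f)%:E)%E.
rewrite nu0E -ge0_integralZl//.
- exact: measurable_funTS.
- by move=> f _; rewrite lee_fin.
Qed.

Lemma evidence_invK : (Z < +oo)%E -> (r%:E * Z = 1)%E.
Proof.
rewrite rE; have := evidence_gt0; case: Z => [z||]//.
rewrite lte_fin => z0 _; rewrite inver gt_eqF// -EFinM mulVf// gt_eqF//.
Qed.

(** Valid for every path with a measurable likelihood, even where no mean exists and [xget] returns
    0; the measurability of the posterior mean in the path is read off from this formula. *)
Lemma inner_mean_posterior (x : V) : inner (mean post) x =
  if (\int[Pi]_f ((1 + `|f|) * l f)%:E < +oo)%E
  then (fine Z)^-1 * fine (\int[Pi]_f (inner f x * l f)%:E)%E else 0.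
Proof.
have [nu [nuE nuB]] := posterior_measure.
have mp : measurable_fun [set: borel V] (fun f : V => r * l f).
  exact: measurable_funM.
have p0 (f : V) : 0 <= r * l f by rewrite mulr_ge0.
have mn := @measurable_norm_borel R V.
have mJ : measurable_fun [set: borel V] (fun f : V => ((1 + `|f|) * l f)%:E).
  apply/measurable_EFinP; apply: measurable_funM => //.
  exact: measurable_funD.
have J0 (f : V) : (0 <= ((1 + `|f|) * l f)%:E)%E.
  by rewrite lee_fin mulr_ge0// addr_ge0.
have Jge (f : V) : `|f| * l f <= (1 + `|f|) * l f by rewrite ler_wpM2r// lerDr.
have Zge (f : V) : l f <= (1 + `|f|) * l f by rewrite ler_peMl// lerDl.
rewrite -nuE; case: ifPn => [Joo|Joo].
  have iJ : Pi.-integrable setT (fun f : V => ((1 + `|f|) * l f)%:E).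
    apply/integrableP; split => //.
    by under eq_integral do rewrite gee0_abs//.
  have iN : Pi.-integrable setT (fun f : V => (`|f| * l f)%:E).
    apply: le_integrable iJ => //; first exact/measurable_EFinP/measurable_funM.
    by move=> f _; rewrite !gee0_abs// lee_fin// mulr_ge0.
  have iZ : Pi.-integrable setT (fun f : V => (l f)%:E).
    by apply: le_integrable iJ => // f _; rewrite !gee0_abs// lee_fin//.
  have rZ : r = (fine Z)^-1.
    have := evidence_gt0; rewrite /r; have := integrable_fin_num measurableT iZ.
    by rewrite -/Z; case: Z => [z||]//= _; rewrite lte_fin => z0; rewrite inver gt_eqF.
  have irN (h : V -> R) : Pi.-integrable setT (fun f : V => (h f * l f)%:E) ->
      Pi.-integrable setT (fun f : V => (h f * (r * l f))%:E).
    move=> ih; have := integrableZl measurableT r ih.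
    by apply: eq_integrable => // f _; rewrite -EFinM mulrCA.
  have [inu _] := integral_density mp p0 nuB mn (irN _ iN).
  have [m hm] := is_mean_ex inu.
  rewrite (mean_unique hm); case: hm => _ hm; apply: EFin_inj; rewrite -hm.
  have ix : Pi.-integrable setT (fun f : V => (inner f x * l f)%:E).
    have := integrableZl measurableT `|x| iN; apply: le_integrable => //.
      by apply/measurable_EFinP; apply: measurable_funM => //; exact: measurable_inner.
    move=> f _; rewrite -EFinM !abse_EFin lee_fin !normrM (ger0_norm (l_ge0 f)).
    by rewrite !normr_id mulrA ler_wpM2r// mulrC normr_inner_le.
  have [_ ->] := integral_density mp p0 nuB (@measurable_inner _ _ x) (irN _ ix).
  under eq_integral do rewrite mulrCA EFinM.
  by rewrite integralZl// rZ EFinM fineK//; exact: integrable_fin_num.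
rewrite /mean; case: xgetP => [m _ [inu hm]|]; last by rewrite inner0l.
(* A mean exists although the integral of (1 + |f|) l is infinite. Either the evidence is infinite
   and the zero measure has mean 0, or the integrability of the norm contradicts the assumption. *)
have [Zoo|Zoo] := eqVneq Z +oo%E.
  have r0 : r = 0 by rewrite /r Zoo invey.
  apply: EFin_inj; rewrite -hm.
  have i0 : Pi.-integrable setT (fun f : V => (inner f x * (r * l f))%:E).
    have := integrable0 Pi [set: borel V].
    by apply: eq_integrable => // f _; rewrite r0 mul0r mulr0.
  have [_ ->] := integral_density mp p0 nuB (@measurable_inner _ _ x) i0.
  by rewrite r0; under eq_integral do rewrite mul0r mulr0; rewrite integral0.
exfalso; move/negP : Joo; apply.
have Zfin : (Z < +oo)%E by rewrite ltey.
have r_gt0 : 0 < r by have Z0 := evidence_gt0; rewrite -lte_fin rE inve_gt0// gt_eqF.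
have fin (y : \bar R) : (r%:E * y < +oo -> y < +oo)%E.
  by case: y => [y||]; rewrite ?ltry ?ltNyr// gt0_muley ?lte_fin.
have := integrable_lty measurableT inu.
rewrite (ge0_integral_density mp p0 nuB)//; last exact/measurable_EFinP.
under eq_integral do rewrite -EFinM mulrCA EFinM.
rewrite ge0_integralZl//; last 2 first.
- exact/measurable_EFinP/measurable_funM.
- by move=> f _; rewrite lee_fin mulr_ge0.
move=> Noo.
under eq_integral do rewrite mulrDl mul1r EFinD.
rewrite ge0_integralD//; last 2 first.
- by move=> f _; rewrite lee_fin mulr_ge0.
- exact/measurable_EFinP/measurable_funM.
rewrite lte_add_pinfty//.
  exact: fin Noo.
by move=> f _; rewrite lee_fin.
Qed.

End posterior_measure.

(** * The exact posterior law of the functional *)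

Section posterior_law.
Context (R : realType) (V W2 : hilbertType R).
Hypothesis sepV : separable V.
Variables (A : {linear V -> W2}) (A_cont : continuous A).
Variable adj : W2 -> V.
Hypothesis adjE : forall g x, inner (adj g) x = inner g (A x).
Context d (Omega : measurableType d) (P : probability Omega R).
Variables (W : W2 -> {RV P >-> R}) (W_noise : white_noise W).
Variables (N : W2 -> Omega -> R) (N_mod : measurable_modification W N).
Variable f0 : V.
Variables (Pi : probability (borel V) R) (Pi_gauss : centered_gaussian Pi).
Variables (e : R) (e_gt0 : 0 < e).
Let cov := covariance_form Pi.

Definition lik (w : Omega) (f : V) := likelihood A e (observation A (N ^~ w) e f0) f.

Lemma lik_ge0 w f : 0 <= lik w f. Proof. exact: expR_ge0. Qed.

Let measurable_noise (g : W2) :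
  measurable_fun [set: borel V * Omega] (fun z => N (A z.1 + g) z.2).
Proof.
have [mN _] := N_mod.
have mAg : @measurable_fun _ _ (borel V) (borel W2) setT (fun f => A f + g).
  apply: continuous_borel_borel => f.
  by apply: cvgD; [exact: A_cont|exact: cvg_cst].
apply: (measurableT_comp mN (_ : measurable_fun setT (fun z : borel V * Omega =>
  (A z.1 + g : borel W2, z.2)))).
apply: measurable_fun_pair; first exact: (measurableT_comp mAg measurable_fst).
exact: measurable_snd.
Qed.

Let measurable_noise_cst (g : W2) : measurable_fun [set: Omega] (N g).
Proof.
by have [mN _] := N_mod; exact: (measurableT_comp mN (pair1_measurable (g : borel W2))).
Qed.

Lemma measurable_inner_op (g : W2) :
  measurable_fun [set: borel V] (fun f : V => inner (A f) g).
Proof.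
apply: continuous_borel_measurable => f.
exact: (cvg_comp _ _ (A_cont (x := f)) (@inner_continuous _ _ g _)).
Qed.

Let measurable_innerA (g : W2) :
  measurable_fun [set: borel V * Omega] (fun z => inner (A z.1) g).
Proof. exact: (measurableT_comp (measurable_inner_op g) measurable_fst). Qed.

Let measurable_normA : measurable_fun [set: borel V * Omega] (fun z => `|A z.1|).
Proof.
have m : measurable_fun [set: borel V] (fun f : V => `|A f|).
  apply: continuous_borel_measurable => f.
  exact: (cvg_comp _ _ (A_cont (x := f)) (@norm_continuous _ _ _)).
exact: (measurableT_comp m measurable_fst).
Qed.

Lemma measurable_lik : measurable_fun [set: borel V * Omega] (fun z => lik z.2 z.1).
Proof.
apply: measurableT_comp => //; apply: measurable_funB.
  apply: measurable_funM => //; apply: measurable_funD.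
    have := measurable_innerA (A f0); congr measurable_fun.
    by apply/funext => z; rewrite innerC.
  apply: measurable_funM => //.
  have := measurable_noise 0; congr measurable_fun.
  by apply/funext => z; rewrite addr0.
apply: measurable_funM; first exact: measurable_cst.
exact: measurable_funX.
Qed.

Lemma measurable_lik_sec w : measurable_fun [set: borel V] (lik w).
Proof. exact: (measurableT_comp measurable_lik (pair2_measurable w)). Qed.

Lemma noise_mod_mgf (g : W2) : gaussian_mgf P (N g) (`|g| ^+ 2).
Proof.
have [mN aeN] := N_mod.
have mNg := measurable_noise_cst g; split => // t; have [_ <-] := white_noise_mgf W_noise g.
apply: ae_eq_integral => //.
- apply/measurable_EFinP; apply: measurableT_comp => //; exact: measurable_funM.
- apply/measurable_EFinP; apply: measurableT_comp => //; exact: measurable_funM.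
- by have := aeN g; apply: filterS => w -> _.
Qed.

(** For a fixed f this is almost sure linearity. Integrating the absolute defect over the product
    and applying Tonelli exchanges the two quantifiers; joint measurability of the modification
    serves this exchange. *)
Lemma noise_shift (g : W2) : {ae P, forall w, {ae Pi, forall f,
  N (A f + g) w = N (A f) w + N g w}}.
Proof.
have [mN aeN] := N_mod.
(* The spurious [+ 0] makes both path terms instances of [measurable_noise]. *)
pose h (z : borel V * Omega) := N (A z.1 + g) z.2 - (N (A z.1 + 0) z.2 + N g z.2).
have mh : measurable_fun setT (fun z => (`|h z|)%:E).
  apply/measurable_EFinP; apply: measurableT_comp => //; apply: measurable_funB.
    exact: measurable_noise.
  apply: measurable_funD; first exact: measurable_noise.
  exact: (measurableT_comp (measurable_noise_cst g) measurable_snd).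
have h0 z : (0 <= (`|h z|)%:E)%E by rewrite lee_fin.
have z0 : (\int[P]_w \int[Pi]_f (`|h (f, w)|)%:E = 0)%E.
  rewrite -(fubini_tonelli (fun z => (`|h z|)%:E))//.
  apply: integral0_eq => f _.
  rewrite (ae_eq_integral (cst 0%E))//; first by rewrite integral0.
    exact: (measurableT_comp mh (pair1_measurable f)).
  have := white_noise_linear W_noise (A f) g 1.
  apply: filterS2 (filterI (aeN (A f + g)) (filterI (aeN (A f)) (aeN g))).
  by move=> w [/= e1 [e2 e3]]; rewrite scale1r mul1r => e4 _;
    rewrite /h/= addr0 e1 e2 e3 e4 subrr normr0.
have mG : measurable_fun setT (fun w => (\int[Pi]_f (`|h (f, w)|)%:E)%E).
  exact: (measurable_fun_fubini_tonelli_G (fun z => (`|h z|)%:E)).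
have := (@ae_eq_integral_abs _ _ _ P _ measurableT _ mG).1 _.
have -> : (\int[P]_x `|\int[Pi]_f (`|h (f, x)|)%:E| = 0)%E.
  rewrite -z0; apply: eq_integral => w _.
  by rewrite gee0_abs// integral_ge0.
move=> /(_ erefl); apply: filterS => w /= /(_ I) hw.
have mhw : measurable_fun setT (fun f => (`|h (f, w)|)%:E).
  exact: (measurableT_comp mh (pair2_measurable w)).
have hw' : (\int[Pi]_f `|(`|h (f, w)|)%:E| = 0)%E.
  by rewrite -[RHS]hw; apply: eq_integral => f _; rewrite gee0_abs.
have := (@ae_eq_integral_abs _ _ _ Pi _ measurableT _ mhw).1 hw'.
apply: filterS => f /= /(_ I) [] /eqP.
by rewrite normr_eq0 /h/= addr0 subr_eq0 => /eqP.
Qed.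

(** The Gaussian expectation of e^(N(A f) / e) cancels the quadratic term, leaving the exponential
    of a continuous linear functional of f. *)
Lemma lik_mean (f : V) :
  (\int[P]_w (lik w f)%:E = (expR (inner f (e ^- 2 *: adj (A f0))))%:E)%E.
Proof.
pose a := expR (e ^- 2 * inner (A f0) (A f) - 2^-1 * e ^- 2 * `|A f| ^+ 2).
have likE w : lik w f = a * expR (e^-1 * N (A f) w).
  rewrite /lik /likelihood /observation /a -expRD; congr expR.
  by field; rewrite gt_eqF.
under eq_integral do rewrite likE EFinM.
have [mN Nexp] := noise_mod_mgf (A f).
have mE : measurable_fun setT (fun w => (expR (e^-1 * N (A f) w))%:E).
  by apply/measurable_EFinP; apply: measurableT_comp => //; exact: measurable_funM.
have a0 : (0 <= a%:E)%E by rewrite lee_fin expR_ge0.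
rewrite ge0_integralZl// Nexp -EFinM -expRD innerZr (innerC f) adjE; congr (expR _)%:E.
by field; rewrite gt_eqF.
Qed.

(** Averaging over the noise first leaves (1 + |f|) e^u with u linear in f, and |f| e^u <= |f|^2 +
    e^(2 u). *)
Lemma lik_integrable :
  (Pi \x P)%E.-integrable setT (fun z => ((1 + `|z.1|) * lik z.2 z.1)%:E).
Proof.
have mg : measurable_fun [set: borel V * Omega]
    (fun z => ((1 + `|z.1|) * lik z.2 z.1)%:E).
  apply/measurable_EFinP; apply: measurable_funM; last exact: measurable_lik.
  apply: measurable_funD; first exact: measurable_cst.
  exact: (measurableT_comp (@measurable_norm_borel R V) measurable_fst).
apply/(integrable12ltyP Pi P mg) => /=.
pose y := e ^- 2 *: adj (A f0).
have i1 := gaussian_mgf_integrable (gaussian_inner Pi_gauss y) 1.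
have i2 := gaussian_mgf_integrable (gaussian_inner Pi_gauss y) 2.
have i3 := gaussian_norm_square sepV Pi_gauss.
have i : Pi.-integrable setT (fun f : V => (expR (1 * inner f y) +
    1 * (`|f| ^+ 2) + 1 * expR (2 * inner f y))%:E).
  have fin (h : V -> R) : Pi.-integrable setT (fun f : V => (h f)%:E) ->
      (\int[Pi]_f (h f)%:E = (fine (\int[Pi]_f (h f)%:E))%:E)%E.
    by move=> ih; rewrite fineK//; exact: integrable_fin_num.
  have [j ej] := integral_add_scale 1 i1 (fin _ i1) i3 (fin _ i3).
  by have [] := integral_add_scale 1 j ej i2 (fin _ i2).
apply: le_lt_trans (integrable_lty _ i) => //.
apply: ge0_le_integral => //.
- by move=> f _; apply: integral_ge0.
- have mabs : measurable_fun setT 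
      (fun z : borel V * Omega => `|((1 + `|z.1|) * lik z.2 z.1)%:E|%E).
    exact: measurableT_comp.
  exact: (@measurable_fun_fubini_tonelli_F _ _ _ _ _ P _ mabs (fun _ => abse_ge0 _)).
- exact: (measurable_int _ i).
- move=> f _.
  have -> : (\int[P]_w `|((1 + `|f|) * lik w f)%:E| = ((1 + `|f|) * expR (inner f y))%:E)%E.
    have ml : measurable_fun setT (fun w => (lik w f)%:E).
      apply/measurable_EFinP.
      exact: (measurableT_comp measurable_lik (pair1_measurable (f : borel V))).
    have l0 w : (0 <= (lik w f)%:E)%E by rewrite lee_fin lik_ge0.
    have n0 : (0 <= (1 + `|f|)%:E)%E by rewrite lee_fin addr_ge0.
    rewrite EFinM -lik_mean -ge0_integralZl//.
    apply: eq_integral => w _.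
    by rewrite gee0_abs ?EFinM// lee_fin mulr_ge0 ?lik_ge0 ?addr_ge0.
  rewrite lee_fin !mul1r mulrDl mul1r -addrA lerD2l.
  have -> : 2 * inner f y = inner f y + inner f y by ring.
  rewrite expRD; have := sqr_ge0 (`|f| - expR (inner f y)).
  have := sqr_ge0 (`|f|); have := sqr_ge0 (expR (inner f y)).
  by move: (`|f|) (expR _) => a b; rewrite sqrrB; nra.
Qed.

Lemma ae_lik_integrable :
  {ae P, forall w, Pi.-integrable setT (fun f : V => ((1 + `|f|) * lik w f)%:E)}.
Proof. exact: ae_integrable2 lik_integrable. Qed.

(* The choice of [q] makes the posterior law of [- inner (A f) v] explicit: the
   Cameron-Martin shift by [t k] trades the tilt by [t <A f, q>] for a tilt by
   [- t e^-2 <A f, A k>], and [q + e^-2 A k = - v]. *)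
Lemma posterior_laplace (v q : W2) (k : V) (t : R) :
  (forall z, inner k z = cov (adj q) z) -> A k = - e ^+ 2 *: (v + q) ->
  {ae P, forall w,
    (\int[Pi]_f (lik w f * expR (t * - inner (A f) v))%:E =
     (expR (t * (e ^- 2 * (inner (A f0) (A k) + e * N (A k) w))
       + t ^+ 2 * (cov (adj q) (adj q) + e ^- 2 * `|A k| ^+ 2) / 2))%:E
      * \int[Pi]_f (lik w f)%:E)%E}.
Proof.
move=> kE AkE; have e_neq0 : e != 0 by rewrite gt_eqF.
have shift := noise_shift (A (t *: k)).
have [mN aeN] := N_mod.
have scale : {ae P, forall w, N (A (t *: k)) w = t * N (A k) w}.
  have := white_noise_scale W_noise (A k) t; rewrite -linearZ.
  by apply: filterS2 (filterI (aeN (A (t *: k))) (aeN (A k))) => w [/= -> ->].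
apply: filterS2 shift scale => w shift scale.
(* The exponential factor is tuned to the shift: it cancels the cross term - t e^-2 <A f, A k> that
   the quadratic part of the likelihood produces at f + t k, so the shifted integrand is a constant
   times the likelihood. *)
pose F (f : borel V) := (lik w f * expR (t * (e ^- 2 * inner (A f) (A k))))%:E.
have mF : measurable_fun setT F.
  apply/measurable_EFinP; apply: measurable_funM; first exact: measurable_lik_sec.
  apply: measurableT_comp => //; apply: measurable_funM => //.
  by apply: measurable_funM => //; exact: measurable_inner_op.
have F0 f : (0 <= F f)%E.
  by rewrite /F lee_fin; exact: mulr_ge0 (lik_ge0 w f) (expR_ge0 _).
pose x := t *: adj q.
have tkE z : inner (t *: k) z = cov x z.
  by rewrite innerZl kE /x /cov (covZl sepV Pi_gauss).
have := cameron_martin sepV Pi_gauss tkE mF F0.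
set m := e ^- 2 * _.
pose a := expR (t * m + t ^+ 2 * (e ^- 2 * `|A k| ^+ 2) / 2).
pose b := expR (- (t ^+ 2 * cov (adj q) (adj q) / 2)).
have ml : measurable_fun [set: borel V] (fun f => (lik w f)%:E).
  by apply/measurable_EFinP; exact: measurable_lik_sec.
have l0 f : (0 <= (lik w f)%:E)%E by rewrite lee_fin; exact: lik_ge0.
have mshift : @measurable_fun _ _ (borel V) (borel V) setT (fun f => f + t *: k).
  apply: continuous_borel_borel => f; apply: cvgD; first exact: cvg_id.
  exact: cvg_cst.
have a0 : (0 <= a%:E)%E by rewrite lee_fin expR_ge0.
have b0 : (0 <= b%:E)%E by rewrite lee_fin expR_ge0.
have mtilt : measurable_fun [set: borel V]
    (fun f : V => (lik w f * expR (t * - inner (A f) v))%:E).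
  apply/measurable_EFinP; apply: measurable_funM; first exact: measurable_lik_sec.
  apply: measurableT_comp => //; apply: measurable_funM => //.
  by apply: measurableT_comp => //; exact: measurable_inner_op.
have tilt0 (f : V) : (0 <= (lik w f * expR (t * - inner (A f) v))%:E)%E.
  by rewrite lee_fin; exact: mulr_ge0 (lik_ge0 w f) (expR_ge0 _).
have -> : (\int[Pi]_f F (f + t *: k)%R = a%:E * \int[Pi]_f (lik w f)%:E)%E.
  rewrite -ge0_integralZl//.
  apply: ae_eq_integral => //.
  - exact: (measurableT_comp mF mshift).
  - exact: emeasurable_funM.
  apply: negligibleS shift => f /=; apply: contra_not => {}shift _.
  rewrite /F -EFinM; congr _%:E.
  rewrite /lik /likelihood /observation linearD shift scale /a -!expRD; congr expR.
  rewrite linearZ -!inner_norm !innerDl !innerDr !innerZl !innerZr.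
  rewrite (innerC (A k) (A f)) /m.
  move: (inner (A f0) (A f)) (inner (A f0) (A k)) (N (A f) w) (N (A k) w).
  move: (inner (A f) (A f)) (inner (A f) (A k)) (inner (A k) (A k)).
  by move=> x1 x2 x3 x4 x5 x6 x7; field.
have -> : (\int[Pi]_f (F f * (expR (inner f x - covariance_form Pi x x / 2))%:E) =
    b%:E * \int[Pi]_f (lik w f * expR (t * - inner (A f) v))%:E)%E.
  rewrite -ge0_integralZl//.
  apply: eq_integral => f _; rewrite /F -!EFinM; congr _%:E.
  rewrite /b; move: (lik w f) => l; rewrite -[LHS]mulrA [RHS]mulrCA -!expRD.
  congr (_ * expR _).
  rewrite /x innerZr (innerC f) adjE AkE -!/(cov _ _).
  rewrite /cov (covZl sepV Pi_gauss) (covC _ (adj q) (t *: _)) (covZl sepV Pi_gauss).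
  rewrite innerZr innerDr (innerC q (A f)).
  by move: (inner _ _) (inner _ _) (covariance_form _ _ _) => x1 x2 x3; field.
move=> ab.
set X := (\int[Pi]_f (lik w f * expR (t * - inner (A f) v))%:E)%E in ab *.
have -> : X = (b^-1%:E * (b%:E * X))%E.
  by rewrite muleA -EFinM mulVf ?mul1e// gt_eqF// expR_gt0.
rewrite -ab muleA -EFinM /a /b -expRN opprK -expRD; congr (_%:E * _)%E.
by congr expR; field.
Qed.


Let post (w : Omega) := posterior A Pi e (observation A (N ^~ w) e f0).

Lemma measurable_inner_mean (x : V) :
  measurable_fun [set: Omega] (fun w => inner (mean (post w)) x).
Proof.
under eq_fun do rewrite (inner_mean_posterior Pi (measurable_lik_sec _)).
have mJ : measurable_fun setT
    (fun z : borel V * Omega => ((1 + `|z.1|) * lik z.2 z.1)%:E).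
  exact: (measurable_int _ lik_integrable).
have J0 (z : borel V * Omega) : (0 <= ((1 + `|z.1|) * lik z.2 z.1)%:E)%E.
  by rewrite lee_fin; exact: mulr_ge0 (addr_ge0 ler01 (normr_ge0 _)) (lik_ge0 _ _).
have mZ : measurable_fun setT (fun z : borel V * Omega => (lik z.2 z.1)%:E).
  by apply/measurable_EFinP; exact: measurable_lik.
have Z0 (z : borel V * Omega) : (0 <= (lik z.2 z.1)%:E)%E.
  by rewrite lee_fin; exact: lik_ge0.
have mx : measurable_fun setT
    (fun z : borel V * Omega => (inner z.1 x * lik z.2 z.1)%:E).
  apply/measurable_EFinP; apply: measurable_funM; last exact: measurable_lik.
  exact: (measurableT_comp (@measurable_inner R V x) measurable_fst).
have ix : (Pi \x P)%E.-integrable setT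
    (fun z : borel V * Omega => (inner z.1 x * lik z.2 z.1)%:E).
  have := integrableZl measurableT `|x| lik_integrable.
  apply: le_integrable => // z _; rewrite -EFinM !abse_EFin lee_fin !normrM normr_id.
  rewrite mulrA ler_wpM2r// (le_trans (normr_inner_le _ _))// mulrC ler_wpM2l//.
  by rewrite ger0_norm ?lerDr// addr_ge0.
have mfineT : measurable_fun [set: \bar R] (@fine R) by exact: fine_measurable.
apply: measurable_fun_ifT => //.
- apply: measurable_fun_lte => //.
  exact: (@measurable_fun_fubini_tonelli_G _ _ _ _ _ Pi _ mJ J0).
- apply: measurable_funM; last first.
    apply: (measurableT_comp mfineT).
    exact: (@measurable_fubini_G _ _ _ _ _ Pi P _ ix).
  have mfZ : measurable_fun [set: Omega] (fun w => fine (\int[Pi]_f (lik w f)%:E)%E).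
    apply: (measurableT_comp mfineT).
    exact: (@measurable_fun_fubini_tonelli_G _ _ _ _ _ Pi _ mZ Z0).
  have := measurableT_comp (@measurable_powR R (-1)) mfZ.
  congr measurable_fun; apply/funext => w /=; rewrite powR_inv1// fine_ge0//.
  by apply: integral_ge0 => f _; rewrite lee_fin; exact: lik_ge0.
Qed.

(** The quantifier over r stands inside the almost sure one, because the radius to be inserted for r
    depends on the path. *)
Theorem posterior_functional (v q : W2) (k : V) (s : R) :
  (forall z, inner k z = cov (adj q) z) -> A k = - e ^+ 2 *: (v + q) ->
  cov (adj q) (adj q) + e ^- 2 * `|A k| ^+ 2 = s ^+ 2 -> s != 0 ->
  {ae P, forall w,
    let m := e ^- 2 * (inner (A f0) (A k) + e * N (A k) w) in
    - inner (A (mean (post w))) v = m /\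
    forall r, post w [set f | `|m - - inner (A f) v| <= r] =
      normal_prob 0 s `[- r, r]}.
Proof.
move=> kE AkE sE s0.
(* The exceptional null set of [posterior_laplace] depends on t; enumerating the rational t by
   [unpickle] leaves a countable union of null sets. *)
have laplace : {ae P, forall w, forall n,
    if (unpickle n : option rat) is Some t' then let t : R := ratr t' in
      (\int[Pi]_f (lik w f * expR (t * - inner (A f) v))%:E =
     (expR (t * (e ^- 2 * (inner (A f0) (A k) + e * N (A k) w))
       + t ^+ 2 * (cov (adj q) (adj q) + e ^- 2 * `|A k| ^+ 2) / 2))%:E
      * \int[Pi]_f (lik w f)%:E)%E else True}.
  apply: ae_foralln => n; case: (unpickle n : option rat) => [t'|].
    exact: posterior_laplace kE AkE.
  exact: aeW.
pose m w := e ^- 2 * (inner (A f0) (A k) + e * N (A k) w).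
suff : {ae P, forall w, - inner (A (mean (post w))) v = m w /\
    forall r, post w [set f | `|m w - - inner (A f) v| <= r] =
      normal_prob 0 s `[- r, r]} by [].
apply: filterS2 laplace ae_lik_integrable => w; rewrite -/(m w).
move: (m w) => {}m laplace iJ.
have ml := measurable_lik_sec w.
have l0 := lik_ge0 w.
have [nu [nuE nuB]] := posterior_measure Pi ml.
have invZ := @evidence_invK _ _ _ _ Pi _ _ ml.
set r := fine _ in invZ nuB.
have mn := @measurable_norm_borel R V.
have iZ : Pi.-integrable setT (fun f : V => (lik w f)%:E).
  apply: le_integrable iJ => //; first exact/measurable_EFinP.
  move=> f _; rewrite !abse_EFin lee_fin normrM ler_peMl//.
  by rewrite ger0_norm ?lerDl// addr_ge0.
have iN : Pi.-integrable setT (fun f : V => (`|f| * lik w f)%:E).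
  apply: le_integrable iJ => //.
    by apply/measurable_EFinP; exact: measurable_funM.
  move=> f _; rewrite !abse_EFin lee_fin !normrM ler_wpM2r//.
  by rewrite normr_id ger0_norm ?lerDr// addr_ge0.
have {}invZ := invZ (integrable_lty measurableT iZ).
have r0 : 0 <= r.
  by rewrite /r fine_ge0// inve_ge0 integral_ge0// => f _; rewrite lee_fin expR_ge0.
have mp : measurable_fun [set: borel V] (fun f : V => r * lik w f).
  exact: measurable_funM.
have p0 (f : V) : 0 <= r * lik w f by exact: mulr_ge0.
pose X (f : borel V) := - inner (A f) v - m.
have mX : measurable_fun [set: borel V] X.
  apply: measurable_funB; last exact: measurable_cst.
  by apply: measurableT_comp => //; exact: measurable_inner_op.
have mexp (t : R) : measurable_fun [set: borel V] (fun f => (expR (t * X f))%:E).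
  by apply/measurable_EFinP; apply: measurableT_comp => //; exact: measurable_funM.
have lawX B : measurable B -> nu (X @^-1` B) = normal_prob 0 s B.
  apply: gaussian_law => // t'; set t : R := ratr t'.
  have := laplace (pickle t'); rewrite pickleK -/t /= sE => lap.
  rewrite (ge0_integral_density mp p0 nuB)//.
  transitivity (\int[Pi]_f ((expR (- t * m) * r)%:E *
      (lik w f * expR (t * - inner (A f) v))%:E))%E.
    apply: eq_integral => f _; rewrite -!EFinM /X mulrBr -mulNr expRD; congr _%:E.
    by move: (lik w f) (expR _) (expR _) => x y z; ring.
  rewrite ge0_integralZl//; last 3 first.
  - apply/measurable_EFinP; apply: measurable_funM => //.
    apply: measurableT_comp => //; apply: measurable_funM => //.
    by apply: measurableT_comp => //; exact: measurable_inner_op.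
  - by move=> f _; rewrite lee_fin; exact: mulr_ge0 (l0 _) (expR_ge0 _).
  - by rewrite lee_fin mulr_ge0// expR_ge0.
  rewrite lap [X in (_ * X)%E]muleC muleA EFinM -(muleA _ r%:E) invZ mule1.
  by rewrite -EFinM -expRD mulNr addKr.
have gX : gaussian_mgf nu X (s ^+ 2).
  split => // t; have [mid <-] := normal_gaussian_mgf s0.
  apply: (@ge0_integral_law _ _ _ nu (normal_prob 0 s) X (fun x => (expR (t * x))%:E)) => //.
  by apply/measurable_EFinP; apply: measurableT_comp => //; exact: measurable_funM.
have nuT : nu setT = 1%E.
  by rewrite -(preimage_setT X) lawX// probability_setT.
split; last first.
  move=> b; rewrite /post -nuE -lawX//; congr (nu _); apply/seteqP.
  by split => f /=; rewrite in_itv/= /X -ler_norml -normrN opprB.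
have irN : Pi.-integrable setT (fun f : V => (`|f| * (r * lik w f))%:E).
  have := integrableZl measurableT r iN.
  by apply: eq_integrable => // f _; rewrite -EFinM mulrCA.
have [inu _] := integral_density mp p0 nuB mn irN.
have [m0 hm0] := is_mean_ex inu.
have [iX X0] := gaussian_mean0 gX.
rewrite /post -nuE (mean_unique hm0); case: hm0 => _ /(_ (adj v)).
rewrite innerC adjE innerC.
have -> : (\int[nu]_f (inner f (adj v))%:E = \int[nu]_f (- X f - m)%:E)%E.
  by apply: eq_integral => f _; rewrite innerC adjE innerC /X; congr _%:E; ring.
under eq_integral do rewrite EFinB.
rewrite integralB_EFin//; last 2 first.
- by have := integrableN iX; apply: eq_integrable.
- apply/integrableP; split; first exact: measurable_cst.
  by rewrite integral_cst// nuT mule1 ltry.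
rewrite integral_cst// nuT mule1.
under eq_integral do rewrite EFinN.
rewrite integralN ?X0//; last exact: integrable_add_def.
by rewrite oppe0 sub0e => -[<-]; rewrite opprK.
Qed.

End posterior_law.

(** * Asymptotics *)

Lemma extension_unique (R : realType) (U : Type) (V : topologicalType)
    (iota : U -> V) (g : U -> R) (G : V -> R) :
  dense (range iota) -> continuous G -> G \o iota = g -> extension iota g = G.
Proof.
move=> diota cG Gg; rewrite /extension; case: xgetP => [G' _ [cG' G'g]|/(_ G)]; last by case.
apply/funext => x; apply: contrapT => G'x.
have cD : continuous (G' - G) by move=> y; apply: cvgB; [exact: cG'|exact: cG].
have oD : open ((G' - G) @^-1` [set y | y != 0]).
  by move/continuousP : cD; apply; exact: open_neq.
have [|y [Dy [u _ uy]]] := diota _ _ oD.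
  by exists x; rewrite /= subr_eq0; exact/eqP.
have e1 := congr1 (@^~ u) G'g; have e2 := congr1 (@^~ u) Gg.
have : G' (iota u) - G (iota u) != 0 by rewrite uy.
by rewrite (e1 : G' (iota u) = g u) (e2 : G (iota u) = g u) subrr eqxx.
Qed.

(** The small-ball term is nonnegative, so the infimum is at most x. One factor 2 makes the bound
    strict, which yields an actual g; the other clears the 1/2 in front of the squared norm. *)
Lemma concentration_approx (R : realType) (V : hilbertType R)
    (Pi : probability (borel V) R) (f0 : V) (delta x : R) : 0 < x ->
  (concentration Pi f0 delta <= x%:E)%E ->
  exists g, [/\ rkhs Pi g, `|g - f0| <= delta & rkhs_norm Pi g ^+ 2 < 4 * x].
Proof.
move=> x0; rewrite /concentration; set I := ereal_inf _ => cx.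
have : (I < (2 * x)%:E)%E.
  apply: (@le_lt_trans _ _ x%:E); last by rewrite lte_fin ltr_pMl// ltr1n.
  apply: le_trans cx; rewrite leeDl// oppe_ge0 lne_le0.
  apply: probability_le1; rewrite -[X in measurable X]setTI.
  have := @measurable_norm_borel R V measurableT `]-oo, delta]%classic (measurable_itv _).
  by congr measurable; apply/seteqP; split => f /=; rewrite in_itv/=.
move=> /ereal_inf_lt[_ [g [gr gd] <-]]; rewrite lte_fin => gx; exists g; split => //.
by move: gx; rewrite ltr_pdivrMr//; lra.
Qed.

Lemma measure_ae d (T : measurableType d) (R : realType)
    (mu : {measure set T -> \bar R}) (X Y : set T) :
  measurable X -> measurable Y -> {ae mu, forall x, X x <-> Y x} -> mu X = mu Y.
Proof.
move=> mX mY XY; rewrite -[X]setIT -[Y]setIT -!integral_indic//.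
apply: ae_eq_integral => //.
- by apply/measurable_EFinP; exact: measurable_indic.
- by apply/measurable_EFinP; exact: measurable_indic.
apply: filterS XY => x XY _; congr _%:E.
have [xX|xX] := boolP (x \in X).
  by rewrite !indicE xX (mem_set (XY.1 (set_mem xX))).
rewrite !indicE (negbTE xX); case: (boolP (x \in Y)) => // /set_mem/XY/mem_set.
by rewrite (negbTE xX).
Qed.

(** * The Cameron-Martin direction, its size and the bias *)

Section shift.
Context (R : realType) (V W2 : hilbertType R).
Hypothesis sepV : separable V.
Variables (A : {linear V -> W2}) (c : R).
Hypothesis c_gt0 : 0 < c.
Hypothesis A_bound : forall f, `|A f| <= c * `|f|.
Variable adj : W2 -> V.
Hypothesis adjE : forall g x, inner (adj g) x = inner g (A x).
Variables (Pi : probability (borel V) R) (Pi_gauss : centered_gaussian Pi).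
Let cov := covariance_form Pi.

Let adjD x y : adj (x + y) = adj x + adj y.
Proof. by apply: inner_inj => z; rewrite innerDl !adjE innerDl. Qed.

Let adjZ (t : R) x : adj (t *: x) = t *: adj x.
Proof. by apply: inner_inj => z; rewrite innerZl !adjE innerZl. Qed.

Let adj_le x : `|adj x| <= c * `|x|.
Proof.
have [->|a0] := eqVneq (adj x) 0; first by rewrite normr0 mulr_ge0// ltW.
rewrite -(@ler_pM2r _ `|adj x|) ?normr_gt0// -expr2 -inner_norm adjE.
rewrite (le_trans (ler_norm _))// (le_trans (normr_inner_le _ _))//.
by rewrite mulrAC mulrC ler_wpM2r.
Qed.

(** Lax-Milgram for the covariance form plus e^2 <., .>, which is coercive with constant e^2. The
    last identity is the equation tested at q; the bounds on q start from it. *)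
Lemma cameron_martin_direction (v : W2) (e : R) : 0 < e -> exists (q : W2) (k : V),
  [/\ forall z, inner k z = cov (adj q) z, A k = - e ^+ 2 *: (v + q) &
     cov (adj q) (adj q) + e ^+ 2 * `|q| ^+ 2 = - e ^+ 2 * inner v q].
Proof.
move=> e0; have [C C0 hC] := cov_le sepV Pi_gauss.
have [||||||||||q hq] := @symmetric_lax_milgram _ W2
  (fun x y => cov (adj x) (adj y) + e ^+ 2 * inner x y)
  (fun y => - e ^+ 2 * inner v y) (e ^+ 2) (C * c * c + e ^+ 2) (e ^+ 2 * `|v|).
- by rewrite exprn_gt0.
- by rewrite addr_ge0 ?sqr_ge0// !mulr_ge0// ltW.
- move=> x y z; rewrite adjD /cov (covDl sepV Pi_gauss) innerDl; ring.
- move=> t x y; rewrite adjZ /cov (covZl sepV Pi_gauss) innerZl; ring.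
- by move=> x y; rewrite innerC /cov covC.
- by move=> x; rewrite -inner_norm lerDr; exact: cov_ge0.
- move=> x y; rewrite (le_trans (ler_normD _ _))// !mulrDl lerD//.
    apply: (le_trans (hC _ _)).
    rewrite -!mulrA ler_wpM2l//.
    have := ler_pM (normr_ge0 _) (normr_ge0 _) (adj_le x) (adj_le y).
    by congr (_ <= _); ring.
  by rewrite normrM ger0_norm ?sqr_ge0// -mulrA ler_wpM2l ?sqr_ge0// normr_inner_le.
- by move=> x y; rewrite innerDr mulrDr.
- by move=> t x; rewrite innerZr mulrCA.
- move=> x; rewrite mulNr normrN normrM (ger0_norm (sqr_ge0 e)) -mulrA.
  by rewrite ler_wpM2l ?sqr_ge0// normr_inner_le.
have [k hk] := covariance_operator sepV Pi_gauss (adj q).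
exists q, k; split => //.
  apply: inner_inj => y; rewrite innerC -adjE innerC hk innerZl innerDl.
  by have := hq y; rewrite /cov; lra.
by rewrite -inner_norm hq.
Qed.

Variables (h : V) (h_rkhs : rkhs Pi h).

(** Let K be the covariance term and u = <h, adj q>. The identity gives K <= e^2 |u| and |q|^2 <=
    |u|, while u^2 <= xi^2 K by the RKHS inequality; inserting the latter in the former bounds K,
    and then |q|^4 <= xi^2 K. *)
Lemma direction_bounds (q : W2) (e : R) : 0 < e ->
  cov (adj q) (adj q) + e ^+ 2 * `|q| ^+ 2 = - e ^+ 2 * inner (A h) q ->
  cov (adj q) (adj q) <= (e ^+ 2 * rkhs_norm Pi h) ^+ 2 /\
  `|q| <= e * rkhs_norm Pi h.
Proof.
move=> e0 qE; have := rkhs_inner_le sepV Pi_gauss (adj q) h_rkhs.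
have := cov_ge0 sepV Pi_gauss (adj q); have := rkhs_norm_ge0 Pi h.
rewrite -!/(cov _ _) innerC adjE innerC.
have e20 : 0 < e ^+ 2 by rewrite exprn_gt0.
move: e20 qE (normr_ge0 q).
move: (cov _ _) (rkhs_norm _ _) (inner _ _) `|q| => K xi u n e20 qE n0 xi0 K0 uK.
have Kle : K <= (e ^+ 2 * xi) ^+ 2.
  have [->|Kn0] := eqVneq K 0; first exact: sqr_ge0.
  rewrite -(@ler_pM2r _ K) ?lt0r ?Kn0// -expr2.
  apply: (@le_trans _ _ ((- e ^+ 2 * u) ^+ 2)).
    have p : 0 <= e ^+ 2 * n ^+ 2 by rewrite mulr_ge0 ?sqr_ge0.
    by rewrite -qE ler_pXn2r ?nnegrE ?addr_ge0// lerDl.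
  have -> : (- e ^+ 2 * u) ^+ 2 = (e ^+ 2) ^+ 2 * u ^+ 2 by ring.
  have -> : (e ^+ 2 * xi) ^+ 2 * K = (e ^+ 2) ^+ 2 * (xi ^+ 2 * K) by ring.
  by rewrite ler_wpM2l// sqr_ge0.
split => //; rewrite -(@ler_pXn2r _ 4) ?nnegrE//; last exact: mulr_ge0 (ltW e0) xi0.
have nu : n ^+ 2 <= - u.
  rewrite -(ler_pM2l e20); move: qE; rewrite mulNr mulrN => <-.
  by rewrite lerDr.
apply: (@le_trans _ _ (u ^+ 2)).
  rewrite -sqrrN (_ : n ^+ 4 = (n ^+ 2) ^+ 2); last by rewrite -exprM.
  by rewrite ler_pXn2r ?nnegrE ?sqr_ge0// (le_trans (sqr_ge0 n)).
apply: (le_trans uK); apply: (le_trans (ler_wpM2l (sqr_ge0 _) Kle)).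
by rewrite le_eqVlt; apply/orP; left; apply/eqP; ring.
Qed.

(** With xi the RKHS norm of h, the constant is 3 = 2 + 1. The part g contributes at most 2 (delta /
    e) times e^2 xi; the remainder g - f0 contributes at most c delta / (2 c) times e xi. *)
Lemma bias_bound (f0 g : V) (q : W2) (e delta : R) : 0 < e -> 0 < delta ->
  cov (adj q) (adj q) + e ^+ 2 * `|q| ^+ 2 = - e ^+ 2 * inner (A h) q ->
  rkhs Pi g -> `|g - f0| <= delta / (2 * c) ->
  rkhs_norm Pi g ^+ 2 < 4 * (delta / e) ^+ 2 ->
  `|inner (A f0) q| <= 3 * (delta * e * rkhs_norm Pi h).
Proof.
move=> e0 d0 qE gr gf0 gn; have [Kle nle] := direction_bounds e0 qE.
have xi0 := rkhs_norm_ge0 Pi h.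
have fE : inner (A f0) q = inner (A g) q - inner (A (g - f0)) q.
  by rewrite linearB innerBl; ring.
have le1 : `|inner (A g) q| <= 2 * (delta * e * rkhs_norm Pi h).
  have r0 : 0 <= 2 * (delta * e * rkhs_norm Pi h).
    by rewrite mulr_ge0// mulr_ge0// mulr_ge0// ltW.
  rewrite -(@ler_pXn2r _ 2) ?nnegrE// real_normK ?num_real//.
  have := rkhs_inner_le sepV Pi_gauss (adj q) gr; rewrite innerC adjE innerC => /le_trans; apply.
  apply: (le_trans (ler_wpM2l (sqr_ge0 _) Kle)).
  apply: (le_trans (ler_wpM2r (sqr_ge0 _) (ltW gn))).
  rewrite le_eqVlt; apply/orP; left; apply/eqP.
  by field; rewrite gt_eqF.
have le2 : `|inner (A (g - f0)) q| <= delta * e * rkhs_norm Pi h.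
  apply: (le_trans (normr_inner_le _ _)).
  rewrite -mulrA; apply: ler_pM => //.
  apply: (le_trans (A_bound _)); apply: (le_trans (ler_wpM2l (ltW c_gt0) gf0)).
  have -> : c * (delta / (2 * c)) = delta / 2 by field; rewrite gt_eqF.
  by lra.
rewrite fE; apply: (le_trans (ler_normB _ _)).
by apply: (le_trans (lerD le1 le2)); lra.
Qed.

End shift.

Lemma scaled_noise_law (R : realType) (V : hilbertType R) d (Omega : measurableType d)
    (P : probability Omega R) (W : V -> {RV P >-> R}) (N : V -> Omega -> R)
    (a : R) (g : V) :
  white_noise W -> measurable_modification W N -> a * `|g| != 0 ->
  forall B, measurable B -> P ((fun w => a * N g w) @^-1` B) = normal_prob 0 (a * `|g|) B.
Proof.
move=> W_noise N_mod ag0; have [mN Nmgf] := noise_mod_mgf W_noise N_mod g.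
apply: gaussian_law => //; first exact: measurable_funM.
move=> t; under eq_integral do rewrite mulrA.
by rewrite Nmgf; congr (expR _)%:E; ring.
Qed.

(** An event that does not depend on f has posterior mass 0 or 1. This excludes a vanishing
    functional in the theorem. *)
Lemma posterior_no_constant (R : realType) (V V2 : hilbertType R) (A : V -> V2)
    (Pi : probability (borel V) R) (e : R) (M : V2 -> R) (Q : Prop) (a : R) :
  measurable_fun [set: borel V] (likelihood A e M) -> 0 < a < 1 ->
  posterior A Pi e M [set f | Q] <> a%:E.
Proof.
move=> ml /andP[a0 a1]; have Z0 := evidence_gt0 Pi ml.
have [q|nq] := pselect Q.
  have -> : [set _ : V | Q] = setT by apply/seteqP; split.
  rewrite /posterior; move: Z0; case: (\int[Pi]_f _)%E => [z||]//.
  - by rewrite lte_fin => z0; rewrite inver gt_eqF// -EFinM divff ?gt_eqF// => -[]; lra.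
  - by rewrite invey mule0 => _ -[]; lra.
have -> : [set _ : V | Q] = set0 by apply/seteqP; split.
by rewrite /posterior integral_set0 mul0e => -[]; lra.
Qed.

Section rates.
Context (R : realType) (W2 : hilbertType R).
Variables (v : W2) (q : R -> W2) (xi : R).
Hypothesis q_le : forall e, 0 < e -> `|q e| <= e * xi.

Let cvg_lin (b : R) : e * b @[e --> 0^'+] --> 0.
Proof.
apply: cvg_at_right_filter; rewrite -[X in _ --> X](mul0r b).
by apply: cvgM; [exact: cvg_id|exact: cvg_cst].
Qed.

Let cvg_add_lin (f : R -> R) (a b : R) :
  f e @[e --> 0^'+] --> a -> f e + e * b @[e --> 0^'+] --> a.
Proof. by move=> fa; rewrite -[a]addr0; apply: cvgD. Qed.

Let near_gt0 : \forall e \near (0 : R)^'+, 0 < e.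
Proof. exact: nbhs_right_gt. Qed.

Lemma cvg_norm_shift : `|v + q e| @[e --> 0^'+] --> `|v|.
Proof.
apply: (@squeeze_cvgr _ _ _ _ (fun e => `|v| + e * - xi) (fun e => `|v| + e * xi)).
- near=> e; have e0 : 0 < e by near: e.
  have := q_le e0; have := ler_normD v (q e); have := lerB_normD v (q e).
  rewrite mulrN; move: (`|v + q e|) (`|v|) (`|q e|) => x y z; lra.
- by apply: cvg_add_lin; exact: cvg_cst.
- by apply: cvg_add_lin; exact: cvg_cst.
Unshelve. all: by end_near. Qed.

(** As K = O(e^4), the quotient lies between |v + q| and |v + q| + e xi. *)
Lemma cvg_posterior_deviation (K : R -> R) :
  (forall e, 0 < e -> 0 <= K e <= (e ^+ 2 * xi) ^+ 2) -> 0 <= xi ->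
  Num.sqrt (K e + e ^+ 2 * `|v + q e| ^+ 2) / e @[e --> 0^'+] --> `|v|.
Proof.
move=> hK xi0; have vq := cvg_norm_shift.
apply: (@squeeze_cvgr _ _ _ _ (fun e => `|v + q e|) (fun e => `|v + q e| + e * xi)).
- near=> e; have e0 : 0 < e by near: e.
  have /andP[K0 Kle] := hK _ e0.
  rewrite ler_pdivlMr// ler_pdivrMr//; move: (`|v + q e|) (normr_ge0 (v + q e)) => x x0.
  apply/andP; split.
    rewrite -[leLHS]ger0_norm ?(mulr_ge0 x0 (ltW e0))// -sqrtr_sqr ler_wsqrtr//.
    by rewrite exprMn mulrC lerDr.
  have y0 : 0 <= (x + e * xi) * e.
    by rewrite mulr_ge0 ?(ltW e0)// addr_ge0// mulr_ge0// ltW.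
  rewrite -[leRHS]ger0_norm// -sqrtr_sqr ler_wsqrtr//.
  apply: (le_trans (lerD Kle (lexx _))).
  have : 0 <= x * (e * xi) * e ^+ 2 by rewrite !mulr_ge0// ?sqr_ge0// ltW.
  have -> : ((x + e * xi) * e) ^+ 2 = (e ^+ 2 * xi) ^+ 2 + e ^+ 2 * x ^+ 2
    + 2 * (x * (e * xi) * e ^+ 2) by ring.
  by move=> h; rewrite lerDl mulr_ge0.
- exact: vq.
- exact: cvg_add_lin.
Unshelve. all: by end_near. Qed.

End rates.

Theorem corollary5 (R : realType)
  (* separable Hilbert spaces, with W1 dense in Wbar *)
  (W1 W2 Wbar : hilbertType R)
  (sepW1 : separable W1) (sepW2 : separable W2) (sepWbar : separable Wbar)
  (iota : {linear W1 -> Wbar}) (iota_inj : injective iota)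
  (iota_dense : dense (range iota))
  (* the forward operator on Wbar, its restriction to W1, and the adjoint *)
  (A : {linear Wbar -> W2})
  (A_cont : continuous A)
  (A1_cont : continuous (A \o iota)) (A1_inj : injective (A \o iota))
  (Astar : W2 -> W1)
  (Astar_adj : forall (f : W1) (g : W2),
     inner (A (iota f)) g = inner f (Astar g))
  (c : R) (c_gt0 : 0 < c) (A_bound : forall f : Wbar, `|A f| <= c * `|f|)
  (* white noise *)
  (d : measure_display) (Omega : measurableType d) (P : probability Omega R)
  (W : W2 -> {RV P >-> R}) (W_noise : white_noise W)
  (N : W2 -> Omega -> R) (N_mod : measurable_modification W N)
  (* truth and prior *)
  (f0 : Wbar)
  (Pi : probability (borel Wbar) R) (Pi_gauss : centered_gaussian Pi)
  (Pi_conc : concentration_condition Pi f0 c)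
  (* the functional *)
  (psi : W1) (C : R) (C_gt0 : 0 < C)
  (psi_bound : forall phi : W1, `|inner psi phi| <= C * `|iota phi|)
  (psit : Wbar) (psit_rkhs : rkhs Pi psit)
  (psiE : psi = - Astar (A psit))
  (alpha : R) (alpha_gt0 : 0 < alpha) (alpha_lt1 : alpha < 1)
  (Reps : R -> Omega -> R)
  (Reps_meas : forall e : R, 0 < e -> measurable_fun [set: Omega] (Reps e)) :
  let M (e : R) (w : Omega) : W2 -> R := observation A (N ^~ w) e f0 in
  let post (e : R) (w : Omega) := posterior A Pi e (M e w) in
  let L : Wbar -> R := extension iota (fun f : W1 => inner f psi) in
  let fbar (e : R) (w : Omega) : Wbar := mean (post e w) in
  let Ceps (e : R) (w : Omega) : set R :=
    [set x | `|L (fbar e w) - x| <= Reps e w] in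
  (forall e : R, 0 < e ->
     {ae P, forall w, post e w [set f | Ceps e w (L f)] = (1 - alpha)%:E}) ->
  (P [set w | Ceps e w (L f0)] @[e --> 0^'+] --> (1 - alpha)%:E) /\
  cvg_in_probability P 0^'+ (fun e w => e^-1 * Reps e w)
    (Phi_inv `|A psit| (1 - alpha)).
Proof.
move=> M post L fbar Ceps hpost; pose v := A psit.
have alpha01 : 0 < 1 - alpha < 1 by apply/andP; split; lra.
have [adj adjE] : exists adj : W2 -> Wbar, forall g x, inner (adj g) x = inner g (A x).
  by have [adj h] := choice (fun g => bounded_adjoint g A_bound); exists adj.
have LE : L = fun f => - inner (A f) v.
  apply: extension_unique => //.
    move=> f; apply: cvgN.
    exact: (cvg_comp _ _ (A_cont f) (@inner_continuous _ _ v _)).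
  by apply/funext => f /=; rewrite psiE innerNr -Astar_adj.
have near_gt0 : \forall e \near (0 : R)^'+, 0 < e by exact: nbhs_right_gt.
(* For v = 0 the functional L is 0, so the credible event is constant in f and cannot have posterior
   mass 1 - alpha. *)
have [v0|v0] := eqVneq v 0.
  have [w] := ae_exists (hpost 1 ltr01); rewrite /Ceps LE v0.
  have -> : [set f : Wbar | `|- inner (A (fbar 1 w)) 0 - - inner (A f) 0| <= Reps 1 w] =
      [set f | 0 <= Reps 1 w].
    by apply/funext => f /=; rewrite !inner0r oppr0 subrr normr0.
  move=> h; exfalso; move: h.
  exact: posterior_no_constant (measurable_lik_sec A_cont N_mod f0 1 w) alpha01.
have sigma0 : 0 < `|v| by rewrite normr_gt0.
(* The premise 0 < e stands under the existential so that [choice] yields functions of every e; (0,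
   0) is a placeholder for e <= 0. *)
have : forall e : R, exists qk : W2 * Wbar, 0 < e ->
    [/\ forall z, inner qk.2 z = covariance_form Pi (adj qk.1) z,
      A qk.2 = - e ^+ 2 *: (v + qk.1) &
      covariance_form Pi (adj qk.1) (adj qk.1) + e ^+ 2 * `|qk.1| ^+ 2 =
        - e ^+ 2 * inner v qk.1].
  move=> e; have [e0|e0] := ltP 0 e; last by exists (0, 0).
  have [q [k qkP]] := cameron_martin_direction sepWbar c_gt0 A_bound adjE Pi_gauss v e0.
  by exists (q, k).
move=> /choice[qk qkP].
pose q e := (qk e).1; pose k e := (qk e).2.
pose K e := covariance_form Pi (adj (q e)) (adj (q e)).
pose s e := Num.sqrt (K e + e ^+ 2 * `|v + q e| ^+ 2).
pose xi := rkhs_norm Pi psit; pose z := Phi_inv `|v| (1 - alpha) / `|v|.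
pose b e := - inner (A f0) (q e).
have xi0 : 0 <= xi by exact: rkhs_norm_ge0.
have bounds e : 0 < e -> K e <= (e ^+ 2 * xi) ^+ 2 /\ `|q e| <= e * xi.
  move=> e0; have [_ _ qE] := qkP _ e0.
  exact: (direction_bounds sepWbar adjE Pi_gauss psit_rkhs e0 qE).
have q_le e : 0 < e -> `|q e| <= e * xi by move=> /bounds[].
have K_le e : 0 < e -> 0 <= K e <= (e ^+ 2 * xi) ^+ 2.
  by move=> /bounds[-> _]; rewrite andbT; exact: cov_ge0.
have tlim := cvg_norm_shift (v := v) q_le.
have slim := cvg_posterior_deviation (v := v) q_le K_le xi0.
have near_vq : \forall e \near 0^'+, 0 < `|v + q e| by exact: (cvgr_gt _ tlim).
have near_s : \forall e \near 0^'+, 0 < s e.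
  near=> e; have e0 : 0 < e by near: e.
  rewrite -[s e](@mulfVK _ e) ?gt_eqF// mulr_gt0//; near: e.
  exact: (cvgr_gt _ slim).
(* Inserting the random radius in the posterior law, [Phi_inv_unique] forces it to be the constant s
   e * z. The last clause does not involve w and is kept for [normal_z]. *)
have radius e : 0 < e -> 0 < s e -> {ae P, forall w, Reps e w = s e * z /\
    L (fbar e w) - L f0 = b e + e^-1 * N (A (k e)) w
    /\ Phi (s e) (s e * z) = 1 - alpha}.
  move=> e0 s0; have [kE AkE qE] := qkP _ e0.
  have sE : K e + e ^- 2 * `|A (k e)| ^+ 2 = s e ^+ 2.
    rewrite sqr_sqrtr; last first.
      by have /andP[K0 _] := K_le _ e0; rewrite addr_ge0// mulr_ge0 ?sqr_ge0.
    rewrite AkE normrZ normrN (ger0_norm (sqr_ge0 e)).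
    by move: (K e) `|_| => x y; field; rewrite gt_eqF.
  have := posterior_functional sepWbar A_cont adjE W_noise N_mod f0 Pi_gauss e0 kE AkE
    sE (lt0r_neq0 s0).
  apply: filterS2 (hpost _ e0) => w hw [mE lawE].
  have -> : L (fbar e w) - L f0 = b e + e^-1 * N (A (k e)) w.
    rewrite LE mE AkE innerZr innerDr /b.
    move: (inner _ v) (inner _ (q e)) (N _ w) => x y n.
    by field; rewrite gt_eqF.
  have := lawE (Reps e w); rewrite -mE.
  have -> : [set f | `|- inner (A (mean (post e w))) v - - inner (A f) v| <= Reps e w] =
      [set f | Ceps e w (L f)] by rewrite /Ceps LE.
  move: hw; rewrite /post => -> /esym Pn.
  have PR : Phi (s e) (Reps e w) = 1 - alpha.
    by rewrite /Phi /centered_normal gt_eqF// Pn.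
  have RE : Reps e w = s e * z.
    have := Phi_inv_unique s0 sigma0 (proj1 (andP alpha01)) PR.
    by rewrite -/z => <-; rewrite mulrC divfK// gt_eqF.
  by rewrite -RE.
have mRdiff e : 0 < e -> measurable_fun setT (fun w => `|L (fbar e w) - L f0|).
  move=> e0; apply: measurableT_comp => //; apply: measurable_funB => //.
  have := measurable_inner_mean sepWbar A_cont adjE W_noise N_mod f0 Pi_gauss e0 (adj v).
  move=> /measurable_funN; congr measurable_fun.
  apply/funext => w; change (- inner (fbar e w) (adj v) = L (fbar e w)).
  by rewrite LE (innerC _ (adj v)) adjE innerC.
split; last first.
  have Rlim : s e / e * z @[e --> 0^'+] --> Phi_inv `|v| (1 - alpha).
    have -> : Phi_inv `|v| (1 - alpha) = `|v| * z by rewrite /z mulrC divfK// gt_eqF.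
    exact: cvgMr_tmp.
  (* Almost surely the scaled radius is the constant s e / e * z, which is within eta of the limit
     for small e; the probability is then exactly 0. *)
  move=> eta eta0; apply: cvg_near_cst.
  have near_R : \forall e \near 0^'+, `|Phi_inv `|v| (1 - alpha) - s e / e * z| <= eta.
    by move/cvgrPdist_le : Rlim; exact.
  near=> e.
  have e0 : 0 < e by near: e.
  have s0 : 0 < s e by near: e.
  have close : `|Phi_inv `|v| (1 - alpha) - s e / e * z| <= eta by near: e.
  apply: measure_negligible.
    have mX : measurable_fun setT (fun w => `|e^-1 * Reps e w - Phi_inv `|v| (1 - alpha)|).
      apply: measurableT_comp => //; apply: measurable_funB => //.
      by apply: measurable_funM => //; exact: Reps_meas.
    have := mX measurableT _ (measurable_itv `]eta, +oo[); rewrite setTI.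
    by congr measurable; apply/funext => w; rewrite /= in_itv/= andbT.
  apply: negligibleS (radius _ e0 s0) => w /= far [RE [_ _]].
  have RE' : e^-1 * Reps e w = s e / e * z by rewrite RE; ring.
  by move: far; rewrite RE' distrC ltNge close.
(* The standard deviation of L fbar under the law of the data, as opposed to the posterior deviation
   s e. *)
pose t e := e * `|v + q e|.
have coverage : \forall e \near 0^'+,
    normal_prob (0 : R) 1 [set x | `|b e + t e * x| <= s e * z] =
    P [set w | Ceps e w (L f0)].
  near=> e.
  have e0 : 0 < e by near: e.
  have s0 : 0 < s e by near: e.
  have vq0 : 0 < `|v + q e| by near: e.
  have [_ AkE _] := qkP _ e0.
  have tE : e^-1 * `|A (k e)| = t e.
    rewrite AkE normrZ normrN (ger0_norm (sqr_ge0 e)) /t.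
    by move: `|_| => x; field; rewrite gt_eqF.
  have t_neq0 : t e != 0 by rewrite gt_eqF// mulr_gt0.
  have mB : measurable [set x : R | `|b e + x| <= s e * z].
    rewrite -[X in measurable X]setTI; apply: measurable_fun_le => //.
    by apply: measurableT_comp => //; exact: measurable_funD.
  have law := @scaled_noise_law _ _ _ _ _ _ _ e^-1 (A (k e)) W_noise N_mod.
  rewrite tE in law.
  have [mN _] := noise_mod_mgf W_noise N_mod (A (k e)).
  have -> : P [set w | Ceps e w (L f0)] =
      P ((fun w => e^-1 * N (A (k e)) w) @^-1` [set x : R | `|b e + x| <= s e * z]).
    apply: measure_ae.
    - rewrite -[X in measurable X]setTI; apply: measurable_fun_le => //.
      + exact: mRdiff.
      + exact: Reps_meas.
    - rewrite -[X in measurable X]setTI.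
      have mNe : measurable_fun setT (fun w => e^-1 * N (A (k e)) w).
        exact: measurable_funM.
      exact: mNe.
    - by apply: filterS (radius _ e0 s0) => w [RE [LfE _]]; rewrite /Ceps /= LfE RE.
  by rewrite (law t_neq0 _ mB) (normal_prob_scale t_neq0 mB).
(* By [PhiE] the value of Phi (s e) at s e * z does not depend on e, so one small e and one path
   transfer the level 1 - alpha to the standard normal law. *)
have normal_z : normal_prob (0 : R) 1 `[- z, z] = (1 - alpha)%:E.
  have [e [e0 s0]] := filter_ex (filterI near_gt0 near_s).
  have [w [_ [_]]] := ae_exists (radius _ e0 s0).
  rewrite PhiE// => <-; rewrite fineK//.
  exact: fin_num_measure.
rewrite -normal_z.
apply: cvg_trans (near_eq_cvg coverage) _.
have near_t : \forall e \near 0^'+, 0 < t e.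
  by apply: filterS2 near_gt0 near_vq => e e0 t0; exact: mulr_gt0.
apply: (@normal_interval_cvg _ _ _ _ t) => //; last first.
  have -> : (fun e => s e * z / t e) = (fun e => s e / e * (z / `|v + q e|)).
    by apply/funext => e; rewrite /t invfM; ring.
  rewrite [X in _ --> X](_ : z = `|v| * (z / `|v|)); last by rewrite mulrC divfK// gt_eqF.
  by apply: cvgM slim _; apply: cvgMl_tmp; apply: cvgV; rewrite ?gt_eqF.
have [delta [delta0 delta_infty conc]] := Pi_conc.
have near_delta : \forall e \near 0^'+, 0 < delta e / e by exact: cvgry_gt.
(* Dividing the bias, at most 3 delta e xi, by t e = e |v + q e| cancels e and leaves a multiple of
   delta. *)
have near_b : \forall e \near 0^'+,
    - (delta e * (3 * xi / `|v + q e|)) <= b e / t e <= delta e * (3 * xi / `|v + q e|).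
  near=> e.
  have e0 : 0 < e by near: e.
  have vq0 : 0 < `|v + q e| by near: e.
  have de0 : 0 < delta e / e by near: e.
  have d0 : 0 < delta e by rewrite -(mulfVK (lt0r_neq0 e0) (delta e)) mulr_gt0.
  have [_ _ qE] := qkP _ e0.
  have conce : (concentration Pi f0 (delta e / (2 * c)) <= ((delta e / e) ^+ 2)%:E)%E.
    by near: e.
  have [g [gr gf0 gn]] := concentration_approx (exprn_gt0 2 de0) conce.
  have := bias_bound sepWbar c_gt0 A_bound adjE Pi_gauss psit_rkhs e0 d0 qE gr gf0 gn.
  rewrite -ler_norml normrM normfV (gtr0_norm (mulr_gt0 e0 vq0)) normrN => bb.
  rewrite ler_pdivrMr ?mulr_gt0//; apply: (le_trans bb).
  rewrite le_eqVlt; apply/orP; left; apply/eqP.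
  by rewrite -/xi; field; rewrite gt_eqF.
have blim : delta e * (3 * xi / `|v + q e|) @[e --> 0^'+] --> 0.
  rewrite -[X in _ --> X](mul0r (3 * xi / `|v|)); apply: cvgM delta0 _.
  by apply: cvgMl_tmp; apply: cvgV => //; rewrite gt_eqF.
apply: (squeeze_cvgr near_b) => //.
by rewrite -[X in _ --> X]oppr0; apply: cvgN.
Unshelve. all: by end_near. Qed.
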